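(* Consider an arbitrary graph $G$ on $n$ nodes where each node has a unique $b$-bit identifier, where $b=\Omega(\log n)$. There is a deterministic distributed algorithm that computes a network decomposition of $G$ with $O(\log n)$ colors and weak-diameter $O(\log^3 n)$ in $O(\log^8 n + (\log^* b) \cdot \log^5 n)$ rounds of the $\mathsf{CONGEST}$ model, using $O(b)$-bit messages. Moreover, for each cluster $\mathcal{C}$ of vertices, the algorithm provides a Steiner tree $T_{\mathcal{C}}$ with radius $O(\log^3 n)$ in $G$ whose set of terminal nodes is equal to $\mathcal{C}$, and each vertex of $G$ is in $O(\log n)$ Steiner trees of any given color out of the $O(\log n)$ color classes.
   Context: $\mathsf{CONGEST}$ model with $O(b)$-bit messages: synchronous rounds on the network $G$, per round each node sends one $O(b)$-bit message to each neighbor; nodes initially know only local information. A network decomposition with $C$ colors and weak-diameter $D$ is a partition of $V(G)$ into disjoint clusters, each assigned one of $C$ colors, such that clusters joined by an edge of $G$ have different colors and any two vertices of a cluster have distance at most $D$ in $G$. A Steiner tree for a cluster $\mathcal{C}$ is a subtree of $G$ containing all vertices of $\mathcal{C}$ (terminal nodes) and possibly other vertices. $\log^*$ denotes the iterated logarithm. *)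

(* Defs.v *)
From mathcomp Require Import all_boot.
Set Implicit Arguments.
Unset Strict Implicit.
Unset Printing Implicit Defensive.

Fixpoint log_star_aux (fuel x : nat) : nat :=
  match fuel with
  | 0 => 0
  | f.+1 => if x <= 1 then 0 else (log_star_aux f (trunc_log 2 x)).+1
  end.
Definition log_star (x : nat) : nat := log_star_aux x x.

(** Local output of a node:
    - its color,
    - the label of its cluster (two nodes are in the same cluster iff
      they have the same label),
    - its participation in Steiner trees: a list of entries
      (cluster label k, parent), where parent = None means the node is
      the root of the Steiner tree of cluster k, and parent = Some i means
      its parent in that tree is the neighbor with identifier i. *)
Record node_output := NodeOutput {
  out_color : nat;
  out_cluster : nat;
  out_trees : seq (nat * option nat) }.

(** A deterministic synchronous message-passing algorithm.
    Every node starts knowing n, b, its own identifier and the sorted list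
    of identifiers of its neighbors.  In each round, every node sends to
    every neighbor (addressed by identifier) a bit string, then updates its
    state from the list of (sender identifier, message) pairs it received.
    Local computation is unbounded.  The algorithm stops after
    [alg_rounds n b] rounds and every node outputs [alg_output] of its state. *)
Record congest_alg := CongestAlg {
  alg_state : Type;
  alg_init : nat -> nat -> nat -> seq nat -> alg_state;
  alg_send : alg_state -> nat -> seq bool;
  alg_recv : alg_state -> seq (nat * seq bool) -> alg_state;
  alg_rounds : nat -> nat -> nat;
  alg_output : alg_state -> node_output }.

Definition nbr_ids (T : finType) (e : rel T) (id : T -> nat) (v : T) : seq nat :=
  sort leq [seq id u | u <- enum T & e v u].

Definition inbox (A : congest_alg) (T : finType) (e : rel T) (id : T -> nat)
  (st : T -> alg_state A) (v : T) : seq (nat * seq bool) :=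
  sort (fun p q : nat * seq bool => p.1 <= q.1)
    [seq (id u, @alg_send A (st u) (id v)) | u <- enum T & e v u].

Fixpoint state_at (A : congest_alg) (T : finType) (e : rel T) (id : T -> nat)
  (b : nat) (t : nat) : T -> alg_state A :=
  match t with
  | 0 => fun v => @alg_init A #|T| b (id v) (nbr_ids e id v)
  | t'.+1 => let st := state_at A e id b t' in
             fun v => @alg_recv A (st v) (@inbox A T e id st v)
  end.

Definition final_output (A : congest_alg) (T : finType) (e : rel T)
  (id : T -> nat) (b : nat) (v : T) : node_output :=
  @alg_output A (state_at A e id b (alg_rounds A #|T| b) v).

Definition within (T : finType) (e : rel T) (D : nat) (u v : T) : Prop :=
  exists p : seq T, [/\ path e u p, last u p = v & size p <= D].

Definition in_tree (T : finType) (o : T -> node_output) (k : nat) (v : T) : bool :=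
  k \in map fst (out_trees (o v)).

Definition tparent (T : finType) (o : T -> node_output) (k : nat) (v : T)
  : option (option nat) :=
  match [seq p.2 | p <- out_trees (o v) & p.1 == k] with
  | [::] => None
  | x :: _ => Some x
  end.

Definition tedge (T : finType) (e : rel T) (id : T -> nat)
  (o : T -> node_output) (k : nat) : rel T :=
  fun w u => [&& in_tree o k w, in_tree o k u, e w u &
                tparent o k w == Some (Some (id u))].

Definition is_cluster_label (T : finType) (o : T -> node_output) (k : nat) : Prop :=
  exists u, out_cluster (o u) = k.

Definition network_decomposition (T : finType) (e : rel T)
  (o : T -> node_output) (ncol diam : nat) : Prop :=
  [/\ (forall v, out_color (o v) < ncol),
      (forall u v, out_cluster (o u) = out_cluster (o v) ->
                   out_color (o u) = out_color (o v)),
      (forall u v, e u v -> out_cluster (o u) <> out_cluster (o v) ->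
                   out_color (o u) <> out_color (o v)) &
      (forall u v, out_cluster (o u) = out_cluster (o v) -> within e diam u v)].

Definition steiner_trees (T : finType) (e : rel T) (id : T -> nat)
  (o : T -> node_output) (rad load : nat) : Prop :=
  [/\ (forall v, in_tree o (out_cluster (o v)) v),
      (forall k v, in_tree o k v -> is_cluster_label o k),
      (forall k, is_cluster_label o k ->
         exists r : T,
           [/\ in_tree o k r, tparent o k r = Some None,
               (forall r', in_tree o k r' -> tparent o k r' = Some None -> r' = r) &
               (forall w, in_tree o k w ->
                  exists p : seq T,
                    [/\ path (tedge e id o k) w p, last w p = r & size p <= rad])]) &
      (forall v c,
         count (fun k => [exists u, (out_cluster (o u) == k) && (out_color (o u) == c)])
               (undup (map fst (out_trees (o v)))) <= load)].

(* Main.v *)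
Require Import Defs.
From mathcomp Require Import all_boot zify.
Set Implicit Arguments.
Unset Strict Implicit.
Unset Printing Implicit Defensive.

(** The colors are built one after the other, each by a variant of the
    clustering of Rozhon and Ghaffari on the still uncolored vertices; every
    vertex starts as a cluster with its own Steiner tree.

    Growing.  Suppose that clusters are split into red and blue ones.  In a
    step, every red vertex with a blue neighbour proposes to the cluster of
    such a neighbour, hanging itself below it in that cluster's Steiner tree.
    A blue cluster of size [s] accepts its [p] proposals if [s <= 2 P p], and
    otherwise kills the proposers; it then never has a red neighbour again.
    A cluster that keeps having red neighbours grows by a factor [1 + 1 / (2 P)]
    per step, so that after [2 P log n] steps living red and blue vertices are
    not adjacent; at most a fraction [1 / (2 P)] of the vertices was killed.
    A vertex enters at most one new tree in such a subphase.

    Choosing the bits.  Identifiers may be much longer than [log n], hence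
    their bits are not used directly.  Instead every cluster points to an
    adjacent cluster.  [log^* b] steps of Cole and Vishkin color this
    pseudoforest with 16 colors, and each cluster splits the clusters that
    point to it into two halves by parity of their rank in its Steiner tree.
    Among [N >= 2] clusters of a component, a class (color, half) contains at
    most [2 N / 3] of them, since no member of the class is pointed to by
    another one.  Separating the five bits of the classes therefore shrinks the
    number of clusters per component by [2 / 3], and [2 log n] phases, that is
    [P = 10 log n] subphases, leave isolated clusters made of at least half of
    the vertices.

    Cost.  Everything a cluster computes is a prefix sum over its Steiner tree,
    of depth [O(log^3 n)].  Each vertex relays for [O(log n)] trees, which costs
    a factor [O(log n)] for values of [O(b)] bits, but the values exchanged
    during the Cole-Vishkin steps have only [O(log b)] bits, so that
    [log^* b] of these aggregations cost [O((log n + log^* b) log^3 n)]. *)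

(** * Slicing long messages into rounds *)

Fixpoint bits_of (w d : nat) : seq bool :=
  if w is w'.+1 then odd d :: bits_of w' d./2 else [::].

Fixpoint nat_of_bits (s : seq bool) : nat :=
  if s is x :: s' then x + (nat_of_bits s').*2 else 0.

Lemma size_bits_of w d : size (bits_of w d) = w.
Proof. by elim: w d => //= w IH d; rewrite IH. Qed.

Lemma bits_ofK w d : nat_of_bits (bits_of w d) = d %% 2 ^ w.
Proof.
elim: w d => [|w IH] d /=; first by rewrite expn0 modn1.
rewrite IH -[in RHS](odd_double_half d) expnS.
have -> : odd d + d./2.*2 = d./2 * 2 + odd d by rewrite addnC muln2.
have hp : 0 < 2 ^ w by rewrite expn_gt0.
set q := d./2.
have -> : q * 2 + odd d = q %/ 2 ^ w * (2 * 2 ^ w) + ((q %% 2 ^ w).*2 + odd d).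
  by rewrite {1}(divn_eq q (2 ^ w)) mulnDl -mulnA (mulnC _ 2) -addnA muln2.
rewrite modnMDl [RHS]modn_small; first by rewrite addnC.
have := ltn_pmod q hp; rewrite mul2n.
by case: (odd d) => h; rewrite /= ?addn0 ?addn1 ?ltn_double ?ltn_Sdouble.
Qed.

Fixpoint enc_digits (w m : nat) (l : seq nat) : seq bool :=
  if m is m'.+1 then bits_of w (head 0 l) ++ enc_digits w m' (behead l) else [::].

Fixpoint dec_digits (w m : nat) (s : seq bool) : seq nat :=
  if m is m'.+1 then nat_of_bits (take w s) :: dec_digits w m' (drop w s) else [::].

(** What a receiver decodes: digits that are too wide are reduced, missing ones read as zero. Being
    total, it allows the semantics to be stated first and the absence of overflow to be proved
    later. *)
Definition norm_digits (w m : nat) (l : seq nat) : seq nat :=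
  mkseq (fun j => nth 0 l j %% 2 ^ w) m.

Lemma size_enc_digits w m l : size (enc_digits w m l) = m * w.
Proof.
by elim: m l => //= m IH l; rewrite size_cat size_bits_of IH mulSn.
Qed.

Lemma enc_digitsK w m l :
  dec_digits w m (enc_digits w m l) = norm_digits w m l.
Proof.
rewrite /norm_digits; elim: m l => //= m IH l.
rewrite take_size_cat ?size_bits_of // drop_size_cat ?size_bits_of //.
rewrite bits_ofK IH /mkseq /= nth0; congr (_ :: _).
rewrite -[1]addn0 iotaDl -map_comp; apply: eq_map => j /=.
by rewrite nth_behead.
Qed.

Lemma norm_digits_id w m l :
  all (fun d => d < 2 ^ w) l -> size l <= m ->
  forall j, nth 0 (norm_digits w m l) j = nth 0 l j.
Proof.
move=> /all_nthP hl hs j.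
case: (ltnP j m) => hj; last first.
  by rewrite !nth_default ?size_mkseq // (leq_trans hs).
rewrite nth_mkseq //; case: (ltnP j (size l)) => hj2.
  by rewrite modn_small // hl.
by rewrite nth_default // mod0n.
Qed.

(** Width and count are fixed in advance and shared by all vertices, so that all of them spend the
    same number of rounds on an instruction and stay synchronised. *)
Record instr (S : Type) := Instr {
  i_width : nat;
  i_count : nat;
  i_msg : S -> nat -> seq nat;
  i_upd : S -> seq (nat * seq nat) -> S }.

(** A quotient plus one instead of a ceiling: for positive [w] the capacity strictly exceeds the
    payload, and an instruction with empty messages still takes a round to execute. *)
Definition slots (S : Type) (w : nat) (i : instr S) : nat :=
  (i_count i * i_width i) %/ w + 1.

Record rstate (S : Type) := RState {
  r_word : nat;
  r_nbrs : seq nat;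
  r_prog : seq (instr S);
  r_slot : nat;
  r_acc : seq (nat * seq bool);
  r_st : S }.

(** * Compiling programs into message-passing algorithms *)

Section Compile.
Variables (S : Type) (prog : nat -> nat -> seq (instr S)).
Variables (init : nat -> S) (outp : S -> node_output) (word : nat -> nat).

Definition boundary w (nb : seq nat) p s : rstate S :=
  RState w nb p 0 [seq (i, [::]) | i <- nb] s.

Definition r_payload (i : instr S) (s : S) (k : nat) : seq bool :=
  enc_digits (i_width i) (i_count i) (i_msg i s k).

Definition r_send (r : rstate S) (k : nat) : seq bool :=
  if r_prog r is i :: _ then
    take (r_word r) (drop (r_slot r * r_word r) (r_payload i (r_st r) k))
  else [::].

(** Pieces can be appended through [zip] because the inbox lists the neighbours in the same
    increasing order of identifiers in every round. *)
Definition r_recv (r : rstate S) (inb : seq (nat * seq bool)) : rstate S :=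
  if r_prog r is i :: p then
    let acc := [seq (q.1.1, q.1.2 ++ q.2.2) | q <- zip (r_acc r) inb] in
    if (r_slot r).+1 == slots (r_word r) i then
      boundary (r_word r) (r_nbrs r) p
        (i_upd i (r_st r)
           [seq (q.1, dec_digits (i_width i) (i_count i) q.2) | q <- acc])
    else RState (r_word r) (r_nbrs r) (i :: p) (r_slot r).+1 acc (r_st r)
  else r.

Definition compile : congest_alg := @CongestAlg (rstate S)
  (fun n b i nb => boundary (word b) nb (prog n b) (init i))
  r_send r_recv
  (fun n b => \sum_(i <- prog n b) slots (word b) i)
  (fun r => outp (r_st r)).

Variables (T : finType) (e : rel T) (id : T -> nat).

Definition nbrs (v : T) : seq T :=
  sort (fun x y => id x <= id y) [seq u <- enum T | e v u].

Definition step (i : instr S) (x : T -> S) (v : T) : S :=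
  i_upd i (x v)
    [seq (id u, norm_digits (i_width i) (i_count i) (i_msg i (x u) (id v)))
    | u <- nbrs v].

Fixpoint run (p : seq (instr S)) (x : T -> S) : T -> S :=
  if p is i :: p' then run p' (step i x) else x.

Lemma run_cat p q x : run (p ++ q) x = run q (run p x).
Proof. by elim: p x => //= i p IH x. Qed.

Lemma nbr_ids_nbrs v : nbr_ids e id v = map id (nbrs v).
Proof. by rewrite /nbr_ids /nbrs sort_map. Qed.

Lemma inbox_nbrs (st : T -> alg_state compile) v :
  inbox e id st v = [seq (id u, r_send (st u) (id v)) | u <- nbrs v].
Proof.
rewrite /inbox /nbrs; set f := fun u => (id u, _).
by rewrite sort_map.
Qed.

Lemma mem_nbrs v u : (u \in nbrs v) = e v u.
Proof. by rewrite mem_sort mem_filter mem_enum andbT. Qed.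

Variable b : nat.
Hypothesis word_gt0 : 0 < word b.
Let st_at := @state_at compile T e id b.
Let w := word b.

Lemma compile_slot t i p (x : T -> S) j :
  (forall v, st_at t v = boundary w (nbr_ids e id v) (i :: p) (x v)) ->
  j < slots w i ->
  forall v, st_at (t + j) v =
    RState w (nbr_ids e id v) (i :: p) j
      [seq (id u, take (j * w) (r_payload i (x u) (id v))) | u <- nbrs v] (x v).
Proof.
move=> h0; elim: j => [|j IH] hj v.
  rewrite addn0 h0 /boundary nbr_ids_nbrs -map_comp; congr RState.
  by apply: eq_map => u /=; rewrite take0.
have {}IH := IH (ltnW hj).
rewrite addnS /st_at /= -/st_at inbox_nbrs IH /r_recv /= ltn_eqF //.
congr RState; rewrite zip_map -map_comp; apply: eq_map => u /=.
by rewrite IH /r_send /= mulSnr takeD.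
Qed.

Lemma compile_instr t i p (x : T -> S) :
  (forall v, st_at t v = boundary w (nbr_ids e id v) (i :: p) (x v)) ->
  forall v, st_at (t + slots w i) v =
    boundary w (nbr_ids e id v) p (step i x v).
Proof.
move=> h0 v.
have hs : slots w i = (slots w i).-1.+1 by rewrite prednK // /slots addn1.
have hj : (slots w i).-1 < slots w i by rewrite {2}hs.
have hc := compile_slot h0 hj.
rewrite {1}hs addnS /st_at /= -/st_at inbox_nbrs hc /r_recv /= -hs eqxx.
congr boundary; rewrite /step; congr i_upd.
rewrite zip_map -!map_comp; apply: eq_map => u /=.
rewrite hc /r_send /= -takeD -mulSnr -hs.
rewrite take_oversize ?enc_digitsK //.
rewrite size_enc_digits /slots addn1 ltnW // [X in X < _](divn_eq _ w).
by rewrite mulSnr ltn_add2l ltn_pmod.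
Qed.

Lemma compile_run t p (x : T -> S) :
  (forall v, st_at t v = boundary w (nbr_ids e id v) p (x v)) ->
  forall v, st_at (t + \sum_(i <- p) slots w i) v =
    boundary w (nbr_ids e id v) [::] (run p x v).
Proof.
elim: p t x => [|i p IH] t x h0 v; first by rewrite big_nil addn0 h0.
rewrite big_cons addnA; apply: IH => u; exact: compile_instr.
Qed.

Lemma compile_final v :
  final_output compile e id b v =
  outp (run (prog #|T| b) (fun u => init (id u)) v).
Proof.
have := @compile_run 0 (prog #|T| b) _ (fun u => erefl) v.
rewrite add0n => h; exact: (congr1 (fun r => outp (r_st r)) h).
Qed.

Lemma r_recv_word r inb : r_word (r_recv r inb) = r_word r.
Proof.
case: r => w' nb [|i p] sl acc s //=.
by rewrite /r_recv /=; case: eqP.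
Qed.

Lemma r_word_state t v : r_word (st_at t v) = word b.
Proof. by elim: t v => // t IH v; rewrite -(IH v) /st_at /= r_recv_word. Qed.

Lemma compile_send_size t u k :
  size (@alg_send compile (st_at t u) k) <= word b.
Proof.
rewrite -(r_word_state t u); move: (st_at t u) => r.
case: r => w' nb [|i p] sl acc s //=.
by rewrite /r_send /= size_take_min geq_minl.
Qed.

End Compile.

(** * Prefix sums along a rooted tree *)

Section PrefixSums.
Variables (T : finType) (inT : pred T) (par : T -> option T) (key : T -> nat).
Variables (d : T -> nat) (D : nat) (own : T -> nat).
Hypothesis key_inj : injective key.
Hypothesis par_in : forall v p, inT v -> par v = Some p -> inT p /\ d p < d v.
Hypothesis root_uniq : forall v v',
  inT v -> inT v' -> par v = None -> par v' = None -> v = v'.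
Hypothesis d_le : forall v, inT v -> d v <= D.

Definition child v : pred T := [pred u | inT u && (par u == Some v)].

(** Fuel stands in for recursion on the tree; [D.+1] suffices since [d] increases strictly towards
    the leaves and is at most [D]. *)
Fixpoint up_iter t (v : T) : nat :=
  if t is t'.+1 then own v + \sum_(u in child v) up_iter t' u else 0.

Definition subtotal := up_iter D.+1.

Lemma up_iter_stable t v : inT v -> D < d v + t -> up_iter t.+1 v = up_iter t v.
Proof.
elim: t v => [|t IH] v hv ht; first by have := d_le hv; lia.
rewrite [LHS]/= [RHS]/=; congr addn; apply: eq_bigr => u /andP[hu /eqP hp].
by apply: IH => //; have [_] := par_in hu hp; lia.
Qed.

Lemma subtotalE v : inT v ->
  subtotal v = own v + \sum_(u in child v) subtotal u.
Proof. by move=> hv; rewrite /subtotal -(up_iter_stable hv) //; lia. Qed.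

(** Preorder: a vertex comes before its subtree, and siblings follow the order of [key]. *)
Fixpoint off_iter t (v : T) : nat :=
  if t is t'.+1 then
    if par v is Some p then
      off_iter t' p + own p + \sum_(u in child p | key u < key v) subtotal u
    else 0
  else 0.

Definition offset := off_iter D.+1.

Lemma off_iter_stable t v : inT v -> d v < t -> off_iter t.+1 v = off_iter t v.
Proof.
elim: t v => [|t IH] v hv ht; first by lia.
rewrite [LHS]/= [RHS]/=; case hp: (par v) => [p|] //.
by have [h1 h2] := par_in hv hp; rewrite -IH //; lia.
Qed.

Lemma offsetE v : inT v ->
  offset v = if par v is Some p then
      offset p + own p + \sum_(u in child p | key u < key v) subtotal u
    else 0.
Proof.
by move=> hv; rewrite /offset -(off_iter_stable hv) // ltnS; apply: d_le.
Qed.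

Definition block (g : nat -> nat) o c := \sum_(0 <= i < c) g (o + i).

Lemma block_cat g o c c' : block g o (c + c') = block g o c + block g (o + c) c'.
Proof.
rewrite /block (@big_cat_nat _ _ _ c) ?leq_addr //=; congr addn.
rewrite -{1}[c]add0n big_addn addKn.
by apply: eq_bigr => i _; rewrite (addnC i) addnA.
Qed.

Lemma block_sorted g o (s : seq T) (f : T -> nat) :
  sorted (fun x y => key x < key y) s ->
  block g o (\sum_(u <- s) f u) =
  \sum_(u <- s) block g (o + \sum_(x <- s | key x < key u) f x) (f u).
Proof.
elim: s o => [|a s IH] o hs; first by rewrite !big_nil /block big_nil.
have tr : transitive (fun x y => key x < key y) by move=> x y z; apply: ltn_trans.
have /allP ha := order_path_min tr hs.
rewrite !big_cons block_cat ltnn; congr addn.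
  rewrite big_seq_cond big1 ?addn0 // => x /andP[/ha] /=; lia.
rewrite IH ?(path_sorted hs) //; apply: eq_big_seq => u /ha /= hu.
by rewrite !big_cons hu addnA.
Qed.

(** The intervals of the children follow each other in the order of [key], which is strict by
    injectivity, and so tile an interval of their total length. *)
Lemma block_children g o v :
  block g o (\sum_(u in child v) subtotal u) =
  \sum_(w in child v)
     block g (o + \sum_(u in child v | key u < key w) subtotal u) (subtotal w).
Proof.
pose s := sort (fun x y => key x <= key y) (enum (child v)).
have ps : perm_eq (enum (child v)) s by rewrite perm_sym perm_sort.
have hs : sorted (fun x y => key x < key y) s.
  have : sorted (fun x y => key x <= key y) s.
    by apply: sort_sorted => x y; apply: leq_total.
  have : uniq s by rewrite sort_uniq enum_uniq.
  elim: s {ps} => [//|a s IH] /= /andP[ha hu] hp.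
  have {}IH := IH hu (path_sorted hp).
  case: s ha hp IH {hu} => //= a' s; rewrite inE negb_or => /andP[hne _] /andP[h1 _] ->.
  rewrite andbT ltn_neqAle h1 andbT; apply/eqP => /key_inj E.
  by rewrite E eqxx in hne.
have E P (F : T -> nat) :
    \sum_(u in child v | P u) F u = \sum_(u <- s | P u) F u.
  by rewrite -(perm_big _ ps) /= big_enum_cond.
have E' (F : T -> nat) : \sum_(u in child v) F u = \sum_(u <- s) F u.
  by rewrite -(perm_big _ ps) /= big_enum.
rewrite !E' (block_sorted _ _ _ hs); apply: eq_bigr => u _.
by rewrite E.
Qed.

Lemma sum_children (F : T -> nat) :
  \sum_(v | inT v) \sum_(u in child v) F u = \sum_(u | inT u && (par u != None)) F u.
Proof.
rewrite (exchange_big_dep inT) /=; last by move=> v u _ /andP[].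
rewrite [RHS]big_mkcondr; apply: eq_bigr => u hu.
case hp: (par u) => [p|] /=; last first.
  by rewrite big_pred0 // => v; rewrite unfold_in /= hp !andbF.
have [hin _] := par_in hu hp.
rewrite (big_pred1 p) // => v; rewrite unfold_in /= hu hp /=.
rewrite (inj_eq (@Some_inj _)) eq_sym.
by case: eqP => [->|]; rewrite ?hin ?andbF.
Qed.

Lemma root_exists v : inT v -> exists2 r, inT r & par r = None.
Proof.
elim: {v}(d v).+1 {-2}v (ltnSn (d v)) => // m IH v hm hv.
case hp: (par v) => [p|]; last by exists v.
by have [h1 h2] := par_in hv hp; apply: (IH p) => //; lia.
Qed.

(** Let [f v] be the sum of [g] over the interval of the whole subtree of [v]. It is the share of
    [v] plus the values of [f] at the children; summed over the tree, everything cancels except [f]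
    at the root. As [g] is arbitrary, this says that the vertices' own intervals tile an initial
    segment. *)
Lemma block_tree g r : inT r -> par r = None ->
  \sum_(v | inT v) block g (offset v) (own v) = block g 0 (subtotal r).
Proof.
move=> hr hp.
pose f v := block g (offset v) (subtotal v).
have hf v : inT v ->
    f v = block g (offset v) (own v) + \sum_(u in child v) f u.
  move=> hv; rewrite /f subtotalE // block_cat block_children; congr addn.
  apply: eq_bigr => w /andP[hw /eqP hpw].
  by rewrite [offset w]offsetE // hpw.
have : \sum_(v | inT v) f v =
    \sum_(v | inT v) block g (offset v) (own v) +
    \sum_(u | inT u && (par u != None)) f u.
  by rewrite -sum_children -big_split /=; apply: eq_bigr => v /hf.
rewrite (bigID (fun u => par u != None)) /= addnC => /addIn <-.
rewrite (big_pred1 r) => [|v]; first by rewrite /f offsetE // hp.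
rewrite negbK; apply/andP/eqP => [[hv /eqP h]|->]; first exact: root_uniq.
by rewrite hr hp.
Qed.

Lemma subtotal_root r : inT r -> par r = None ->
  subtotal r = \sum_(v | inT v) own v.
Proof.
move=> hr hp; have := block_tree (fun _ => 1) hr hp.
rewrite {2}/block sum_nat_const_nat muln1 subn0 => <-.
by apply: eq_bigr => v _; rewrite /block sum_nat_const_nat muln1 subn0.
Qed.

(** The interval of a child's subtree lies inside that of its parent, up to the root. Hence correct
    values never exceed the total, and sending them modulo a larger power of two loses nothing. *)
Lemma offset_subtotal_le v : inT v ->
  offset v + subtotal v <= \sum_(u | inT u) own u.
Proof.
elim: {v}(d v).+1 {-2}v (ltnSn (d v)) => // m IH v hm hv.
rewrite offsetE //; case hp: (par v) => [p|].
  have [h1 h2] := par_in hv hp.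
  apply: leq_trans (IH p _ h1); last by lia.
  rewrite [subtotal p]subtotalE // -!addnA !leq_add2l.
  rewrite [leqRHS](bigD1 v) /=; last by rewrite inE hv hp eqxx.
  rewrite addnC leq_add2l [leqRHS]big_mkcondr [leqLHS]big_mkcondr.
  apply: leq_sum => u _; case: ltnP => // h.
  by case: eqP h => // ->; rewrite ltnn.
by rewrite add0n (subtotal_root hv hp).
Qed.

End PrefixSums.

(** * Exchanging states and aggregating over Steiner trees *)

(* As in [out_trees]: the label of a tree and the parent, [None] at the root. *)
Definition entry := (nat * option nat)%type.

Definition keys (s : seq entry) : seq nat := map fst s.

Definition lookup (s : seq entry) (k : nat) : option (option nat) :=
  ohead [seq p.2 | p <- s & p.1 == k].

Lemma lookup_keys s k : (lookup s k != None) = (k \in keys s).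
Proof.
rewrite /lookup /keys; elim: s => //= p s IH.
by rewrite inE; case: (eqVneq p.1 k) => //= _; rewrite IH.
Qed.

Record pub := Pub {
  me : nat; alive : bool; lab : nat; cls : nat; col : nat; ents : seq entry }.

Definition opt_code (o : option nat) : nat := if o is Some i then i.+1 else 0.
Definition opt_decode (m : nat) : option nat := if m is i.+1 then Some i else None.

Definition enc_pub (p : pub) : seq nat :=
  [:: me p; nat_of_bool (alive p); lab p; cls p; col p; size (ents p)] ++
  flatten [seq [:: q.1; opt_code q.2] | q <- ents p].

Definition dec_pub (l : seq nat) : pub :=
  Pub (nth 0 l 0) (nth 0 l 1 != 0) (nth 0 l 2) (nth 0 l 3) (nth 0 l 4)
    (mkseq (fun j => (nth 0 l (6 + 2 * j), opt_decode (nth 0 l (7 + 2 * j))))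
       (nth 0 l 5)).

Lemma nth_flatten_const (A : Type) (x0 : A) (f : A -> seq nat) c s i j :
  (forall a, size (f a) = c) -> i < size s -> j < c ->
  nth 0 (flatten (map f s)) (c * i + j) = nth 0 (f (nth x0 s i)) j.
Proof.
move=> hf; elim: s i => //= a s IH [|i] hi hj.
  by rewrite muln0 nth_cat hf hj.
by rewrite nth_cat hf mulnS -addnA ltnNge leq_addr /= addKn IH.
Qed.

Lemma size_flatten_const (A : Type) (f : A -> seq nat) c s :
  (forall a, size (f a) = c) -> size (flatten (map f s)) = c * size s.
Proof.
by move=> hf; elim: s => /= [|a s IH]; rewrite ?muln0 // size_cat hf IH mulnS.
Qed.

Lemma size_enc_pub p : size (enc_pub p) = 6 + 2 * size (ents p).
Proof. by rewrite size_cat (@size_flatten_const _ _ 2). Qed.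

(** Agreement is asked position by position with default 0, so that the zero padding of
    [norm_digits] is harmless. *)
Lemma dec_enc_pub p l : (forall j, nth 0 l j = nth 0 (enc_pub p) j) -> dec_pub l = p.
Proof.
case: p => m a lb c cl es h; rewrite /dec_pub !h /=; congr Pub; first by case: a {h}.
apply: (@eq_from_nth _ (0, None)); first by rewrite size_mkseq.
move=> i; rewrite size_mkseq => hi; rewrite nth_mkseq // !h /enc_pub /=.
have E j := @nth_flatten_const _ (0, None)
  (fun q : entry => [:: q.1; opt_code q.2]) 2 es i j (fun _ => erefl) hi.
by rewrite add0n -[2 * i in X in (X, _)]addn0 (addnC 1) !E //=; case: (nth _ _ _) => ? [].
Qed.

Definition fits (w E : nat) (p : pub) : bool :=
  all (fun x => x < 2 ^ w) (enc_pub p) && (size (ents p) <= E).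

(* [tgt] is the label and class of a cluster whose tree the vertex has just
   entered, [cval] is a scratch value, [outp] the final color and cluster label,
   [hist] the tree entries of the colors already dealt with. *)
Record core := Core {
  pb : pub;
  tgt : option (nat * nat);
  cval : nat;
  outp : option (nat * nat);
  hist : seq entry }.

(* For a tree [k], [mup], [moff] and [mtot] converge to the sum over the subtree
   of the vertex, the sum over the vertices before it in preorder, and the sum
   over the tree.  [main] keeps the neighbours' last messages. *)
Record mstate := MState {
  mc : core;
  mtab : seq pub;
  main : seq (pub * seq nat);
  mup : nat -> nat;
  moff : nat -> nat;
  mtot : nat -> nat }.

(** A message holds three digits per tree of the sender, in the order of the sender's entries. The
    receiver knows these from the preceding exchange, so labels are not sent again and narrow
    messages remain narrow. *)
Definition digit (q : pub * seq nat) (k j : nat) : nat :=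
  nth 0 q.2 (3 * index k (keys (ents q.1)) + j).

Definition is_child (i k : nat) (p : pub) : bool :=
  lookup (ents p) k == Some (Some i).

Definition zero_fun (_ : nat) := 0.

Definition exchange (w E : nat) (f : core -> seq pub -> core) : instr mstate :=
  Instr w (6 + 2 * E) (fun s _ => enc_pub (pb (mc s)))
    (fun s inb => let tab := [seq dec_pub q.2 | q <- inb] in
       MState (f (mc s) tab) tab [::] zero_fun zero_fun zero_fun).

(** The parent computes where the interval of its child [i] starts, since it is the parent that
    hears from all siblings. *)
Definition off_to (own : core -> nat -> nat) (s : mstate) (i k : nat) : nat :=
  moff s k + own (mc s) k +
  \sum_(q <- main s | is_child (me (pb (mc s))) k q.1 && (me q.1 < i)) digit q k 0.

Definition agg_msg own (s : mstate) (i : nat) : seq nat :=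
  flatten [seq [:: mup s k; off_to own s i k; mtot s k] | k <- keys (ents (pb (mc s)))].

Definition agg_upd (own : core -> nat -> nat) (s : mstate)
    (inb : seq (nat * seq nat)) : mstate :=
  let z := zip (mtab s) [seq q.2 | q <- inb] in
  let p := pb (mc s) in
  let up k := own (mc s) k + \sum_(q <- z | is_child (me p) k q.1) digit q k 0 in
  MState (mc s) (mtab s) z up
    (fun k => if lookup (ents p) k is Some (Some i)
              then \sum_(q <- z | me q.1 == i) digit q k 1 else 0)
    (fun k => if lookup (ents p) k is Some (Some i)
              then \sum_(q <- z | me q.1 == i) digit q k 2 else up k).

Definition agg_round (om E : nat) own : instr mstate :=
  Instr om (3 * E) (agg_msg own) (agg_upd own).

Definition local (f : core -> (nat -> nat) -> (nat -> nat) -> core) : instr mstate :=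
  Instr 0 0 (fun _ _ => [::])
    (fun s _ => MState (f (mc s) (moff s) (mtot s)) [::] [::]
                  zero_fun zero_fun zero_fun).

(* [Agg] computes prefix sums of its second argument over every tree, with
   values sent in as many bits as its first argument says. *)
Inductive op :=
| Loc of (core -> seq pub -> core)
| Agg of nat & (core -> nat -> nat) & (core -> (nat -> nat) -> (nat -> nat) -> core).

(** Subtotals are correct after [D + 1] rounds, one more round delivers them to the parents, and
    offsets and totals then need [D + 1] rounds to descend: [2 * D + 3] in all. *)
Definition op_instrs (w E D : nat) (o : op) : seq (instr mstate) :=
  match o with
  | Loc f => [:: exchange w E f]
  | Agg om own f =>
      exchange w E (fun c _ => c) ::
      nseq (2 * D + 3) (agg_round om E own) ++ [:: local f]
  end.

(** * Semantics of operations and convergence of aggregations *)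

Section Semantics.
Variables (T : finType) (e : rel T) (id : T -> nat).
Hypothesis e_sym : symmetric e.
Hypothesis id_inj : injective id.
Notation N := (nbrs e id).

(** The potential [d] bounds depths and excludes cycles. The map [rt] gives the identifier of the
    root: the label itself while a color is built, a quotient of the label in the final output. *)
Definition wf_trees (tr : T -> seq entry) (rt : nat -> nat) (D : nat) : Prop :=
  exists d : nat -> T -> nat, forall v k, k \in keys (tr v) ->
    d k v <= D /\
    if lookup (tr v) k is Some (Some i) then
      exists u, [/\ id u = i, e v u, k \in keys (tr u) & d k u < d k v]
    else id v = rt k.

Definition cfg := T -> core.

Definition trees (s : cfg) v := ents (pb (s v)).

(** The second clause says that the intervals of length [own (s u) k] starting at [off u k] tile the
    segment below the total. Testing it on [i == 0] elects a single vertex, testing it on parity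
    splits a set into halves; no explicit ranking is required. *)
Definition agg_spec (s : cfg) (own : core -> nat -> nat) (off tot : T -> nat -> nat) :=
  (forall v k, k \in keys (trees s v) -> tot v k = \sum_u own (s u) k) /\
  (forall k g, \sum_u \sum_(0 <= i < own (s u) k) g (off u k + i) =
               \sum_(0 <= i < \sum_u own (s u) k) g i).

Definition exec (o : op) (s s' : cfg) : Prop :=
  match o with
  | Loc f => forall v, s' v = f (s v) [seq pb (s u) | u <- N v]
  | Agg _ own f => exists off tot, agg_spec s own off tot /\
      forall v, s' v = f (s v) (off v) (tot v)
  end.

Definition ready (w E D : nat) (o : op) (s : cfg) : Prop :=
  (forall v, fits w E (pb (s v))) /\
  match o with
  | Loc _ => True
  | Agg om own _ =>
    [/\ (forall v, me (pb (s v)) = id v),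
        wf_trees (trees s) (fun k => k) D,
        (forall v k, 0 < own (s v) k -> k \in keys (trees s v)) &
        forall k, \sum_u own (s u) k < 2 ^ om]
  end.

Lemma step_exchange w E f (x : T -> mstate) v :
  (forall u, fits w E (pb (mc (x u)))) ->
  let tab := [seq pb (mc (x u)) | u <- N v] in
  step e id (exchange w E f) x v =
  MState (f (mc (x v)) tab) tab [::] zero_fun zero_fun zero_fun.
Proof.
move=> hf tab; rewrite /step /=.
suff -> : [seq dec_pub q.2 | q <- [seq (id u,
    norm_digits w (6 + 2 * E) (enc_pub (pb (mc (x u))))) | u <- N v]] = tab by [].
rewrite -map_comp; apply: eq_map => u /=; apply: dec_enc_pub.
have /andP[h1 h2] := hf u.
by apply: norm_digits_id => //; rewrite size_enc_pub; lia.
Qed.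

Lemma sum_nbrs v (P : pred T) (F : T -> nat) :
  \sum_(u <- N v | P u) F u = \sum_(u | e v u && P u) F u.
Proof.
rewrite /nbrs (perm_big _ (permEl (perm_sort _ _))) /=.
by rewrite big_filter_cond /= big_enum_cond.
Qed.

Section Agg.
Variables (w om E D : nat) (s : cfg) (own : core -> nat -> nat).
Hypothesis me_id : forall v, me (pb (s v)) = id v.
Hypothesis fits_s : forall v, fits w E (pb (s v)).
Variable d : nat -> T -> nat.
Hypothesis wf : forall v k, k \in keys (trees s v) ->
    d k v <= D /\
    if lookup (trees s v) k is Some (Some i) then
      exists u, [/\ id u = i, e v u, k \in keys (trees s u) & d k u < d k v]
    else id v = k.
Hypothesis own_in : forall v k, 0 < own (s v) k -> k \in keys (trees s v).
Hypothesis own_small : forall k, \sum_u own (s u) k < 2 ^ om.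
Let W := 2 ^ om.

Definition tpar k v : option T :=
  if lookup (trees s v) k is Some (Some i) then [pick u | id u == i] else None.

Definition in_tr k : pred T := fun v => k \in keys (trees s v).

Lemma tpar_Some k v p :
  in_tr k v -> (tpar k v == Some p) = (lookup (trees s v) k == Some (Some (id p))).
Proof.
move=> hv; rewrite /tpar; case: lookup (wf hv) => [[i|]|] [_ h] //.
case: h => u [<- _ _ _]; case: pickP => [x /eqP/id_inj ->|/(_ u)]; last by rewrite eqxx.
by rewrite !(inj_eq (@Some_inj _)) (inj_eq id_inj).
Qed.

Lemma tpar_in k v p : in_tr k v -> tpar k v = Some p ->
  [/\ in_tr k p, d k p < d k v & e v p].
Proof.
move=> hv /eqP; rewrite tpar_Some // => /eqP h.
have := wf hv; rewrite h => -[_ [u [/id_inj <- h1 h2 h3]]]; by split.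
Qed.

Lemma tpar_root k v : in_tr k v -> tpar k v = None -> id v = k.
Proof.
move=> hv; rewrite /tpar; case: lookup (wf hv) => [[i|]|] [_ h] //.
by case: h => u [<- _ _ _]; case: pickP => // /(_ u); rewrite eqxx.
Qed.

Lemma child_is_child k v u :
  (u \in child (in_tr k) (tpar k) v) = is_child (id v) k (pb (s u)).
Proof.
rewrite unfold_in /= /is_child; case hu: (in_tr k u) => /=; first exact: tpar_Some.
move: hu; rewrite /in_tr -lookup_keys /trees => /negbFE/eqP ->; by [].
Qed.

Lemma child_edge k v u : u \in child (in_tr k) (tpar k) v -> e v u.
Proof.
by rewrite unfold_in => /andP[hu /eqP hp]; have [_ _] := tpar_in hu hp; rewrite e_sym.
Qed.

Let ownk k v := own (s v) k.
Let U k := subtotal (in_tr k) (tpar k) D (ownk k).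
Let OFF k := offset (in_tr k) (tpar k) id D (ownk k).
Let M k := \sum_u own (s u) k.

Let par_in k v p : in_tr k v -> tpar k v = Some p -> in_tr k p /\ d k p < d k v.
Proof. by move=> hv hp; have [] := tpar_in hv hp. Qed.

Let root_uniq k v v' : in_tr k v -> in_tr k v' ->
  tpar k v = None -> tpar k v' = None -> v = v'.
Proof.
by move=> hv hv' /(tpar_root hv) h /(tpar_root hv') h'; apply: id_inj; rewrite h h'.
Qed.

Let d_le k v : in_tr k v -> d k v <= D.
Proof. by case/wf. Qed.

Let M_in k : \sum_(v | in_tr k v) own (s v) k = M k.
Proof.
rewrite big_mkcond; apply: eq_bigr => v _; case: ifP => // h.
by case E0: (own (s v) k) => //; rewrite /in_tr own_in ?E0 in h.
Qed.

Let OFFU_le k v : in_tr k v -> OFF k v + U k v <= M k.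
Proof.
move=> hv; rewrite -M_in.
exact: (offset_subtotal_le (ownk k) id_inj (@par_in k) (@root_uniq k) (@d_le k) hv).
Qed.

Definition consistent (x : T -> mstate) :=
  forall v, mc (x v) = s v /\ mtab (x v) = [seq pb (s u) | u <- N v].

Definition payload (x : T -> mstate) u v :=
  norm_digits om (3 * E) (agg_msg own (x u) (id v)).

Lemma digit_payload k x u v j : consistent x -> in_tr k u -> j < 3 ->
  digit (pb (s u), payload x u v) k j =
  nth 0 [:: mup (x u) k; off_to own (x u) (id v) k; mtot (x u) k] j %% W.
Proof.
move=> hx hu hj; rewrite /digit /= /payload /norm_digits.
have hi : index k (keys (ents (pb (s u)))) < size (keys (ents (pb (s u)))).
  by rewrite index_mem.
have hE : size (keys (ents (pb (s u)))) <= E.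
  by rewrite size_map; have /andP[] := fits_s u.
rewrite nth_mkseq; last by lia.
rewrite /agg_msg (hx u).1.
rewrite (@nth_flatten_const _ 0
  (fun k => [:: mup (x u) k; off_to own (x u) (id v) k; mtot (x u) k]) 3) //.
by rewrite nth_index.
Qed.

Let ag := agg_round om E own.

Lemma step_main x v : consistent x ->
  main (step e id ag x v) = [seq (pb (s u), payload x u v) | u <- N v].
Proof.
move=> hx; rewrite /step /= (hx v).2 -map_comp.
by rewrite zip_map; apply: eq_map.
Qed.

Lemma step_consistent x : consistent x -> consistent (step e id ag x).
Proof. by move=> hx v; rewrite /step /=; split; case: (hx v). Qed.

Lemma sum_child_N k v (F : T -> nat) :
  \sum_(u <- N v | is_child (id v) k (pb (s u))) F u =
  \sum_(u in child (in_tr k) (tpar k) v) F u.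
Proof.
rewrite sum_nbrs; apply: eq_bigl => u; rewrite child_is_child.
case h: is_child; rewrite ?andbF // andbT; apply: (@child_edge k).
by rewrite child_is_child.
Qed.

Lemma step_mup k x v : consistent x ->
  mup (step e id ag x v) k =
  own (s v) k + \sum_(u in child (in_tr k) (tpar k) v) (mup (x u) k %% W).
Proof.
move=> hx; have h := step_main v hx; rewrite /= in h.
rewrite /step /= h (hx v).1 me_id big_map /= sum_child_N; congr addn.
by apply: eq_bigr => u /andP[hu _]; rewrite digit_payload.
Qed.

Lemma sum_parent k v p (F : T -> nat) : in_tr k v -> tpar k v = Some p ->
  \sum_(u <- N v | id u == id p) F u = F p.
Proof.
move=> hv hp; rewrite sum_nbrs (big_pred1 p) // => u /=.
rewrite (inj_eq id_inj); case: eqP => [->|]; rewrite ?andbF // andbT.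
by have [_ _ ->] := tpar_in hv hp.
Qed.

Lemma step_moff k x v : consistent x -> in_tr k v ->
  moff (step e id ag x v) k =
  if tpar k v is Some p then off_to own (x p) (id v) k %% W else 0.
Proof.
move=> hx hv; have h := step_main v hx; rewrite /= in h.
rewrite /step /= h (hx v).1.
case hp: (tpar k v) => [p|].
  have [hin _ _] := tpar_in hv hp.
  move/eqP: (hp); rewrite tpar_Some // /trees => /eqP ->.
  rewrite big_map /=; under eq_bigl => u do rewrite me_id.
  by rewrite (sum_parent _ hv hp) digit_payload.
move: hp; rewrite /tpar /trees; case: lookup (wf hv) => [[i|]|] [_ hw] //.
by case: hw => u [<- _ _ _]; case: pickP => // /(_ u); rewrite eqxx.
Qed.

Lemma step_mtot k x v : consistent x -> in_tr k v ->
  mtot (step e id ag x v) k =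
  if tpar k v is Some p then mtot (x p) k %% W else mup (step e id ag x v) k.
Proof.
move=> hx hv; have h := step_main v hx; rewrite /= in h.
rewrite /step /= h (hx v).1.
case hp: (tpar k v) => [p|].
  have [hin _ _] := tpar_in hv hp.
  move/eqP: (hp); rewrite tpar_Some // /trees => /eqP ->.
  rewrite big_map /=; under eq_bigl => u do rewrite me_id.
  by rewrite (sum_parent _ hv hp) digit_payload.
move: hp; rewrite /tpar /trees; case E0: lookup (wf hv) => [[i|]|] [_ hw] //.
by case: hw => u [<- _ _ _]; case: pickP => // /(_ u); rewrite eqxx.
Qed.

Lemma step_off_to k x i p : consistent x ->
  off_to own (step e id ag x p) i k =
  moff (step e id ag x p) k + own (s p) k +
  \sum_(u in child (in_tr k) (tpar k) p | id u < i) (mup (x u) k %% W).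
Proof.
move=> hx; rewrite /off_to step_main // big_map /=.
rewrite (step_consistent hx p).1 me_id; congr addn.
rewrite sum_nbrs; under eq_bigl => u do rewrite me_id.
rewrite (eq_bigl (fun u => (u \in child (in_tr k) (tpar k) p) && (id u < i))).
  by apply: eq_bigr => u /andP[/andP[hu _] _]; rewrite digit_payload.
move=> u; rewrite child_is_child; case h: is_child; rewrite ?andbF //=.
by rewrite (@child_edge k p u) // child_is_child.
Qed.

Fixpoint iter_ag t (x : T -> mstate) :=
  if t is t'.+1 then step e id ag (iter_ag t' x) else x.

Lemma run_nseq_ag t p x : run e id (nseq t ag ++ p) x = run e id p (iter_ag t x).
Proof.
elim: t x => //= t IH x; rewrite IH; congr run.
by elim: t {IH} => //= t ->.
Qed.

Section Conv.
Variables (x0 : T -> mstate).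
Hypothesis x0_cons : consistent x0.
Let x t := iter_ag t x0.
Let x_cons t : consistent (x t).
Proof. by elim: t => [|t IH]; [exact: x0_cons | exact: step_consistent]. Qed.

Let M_small k : M k < W. Proof. exact: own_small. Qed.

(** Correctness climbs one level per round from the leaves; the reduction modulo [W] is void because
    subtotals are at most [M k]. *)
Lemma mup_conv k t v : in_tr k v -> D < d k v + t -> mup (x t v) k = U k v.
Proof.
elim: t v => [|t IH] v hv ht; first by have [] := wf hv; lia.
rewrite [LHS](step_mup k v (x_cons t)) /U (subtotalE (ownk k) (@par_in k) (@d_le k)) //.
congr addn; apply: eq_bigr => u /andP[hu /eqP hp].
rewrite IH //; last by have [_] := par_in hu hp; lia.
by rewrite modn_small //; have := OFFU_le hu; have := M_small k; rewrite /U; lia.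
Qed.

(** Once all subtotals have reached the parents, correctness of offsets descends one level per round
    from the root. *)
Lemma moff_conv k t v : in_tr k v -> d k v < t ->
  moff (x (D.+2 + t) v) k = OFF k v.
Proof.
elim: t v => // t IH v hv ht; rewrite addnS [LHS](step_moff (x_cons (D.+2 + t)) hv).
rewrite /OFF (offsetE id (ownk k) (@par_in k) (@d_le k)) //.
case hp: (tpar k v) => [p|] //; have [hp1 hp2] := par_in hv hp.
rewrite -/(x (D.+2 + t)) (step_off_to k (id v) p (x_cons (D.+1 + t))).
rewrite -/(x (D.+2 + t)).
rewrite IH //; last by lia.
have E1 : \sum_(u in child (in_tr k) (tpar k) p | id u < id v)
      mup (x (D.+1 + t) u) k %% W =
    \sum_(u in child (in_tr k) (tpar k) p | id u < id v) U k u.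
  apply: eq_bigr => u /andP[/andP[hu _] _]; rewrite mup_conv //; last by lia.
  by rewrite modn_small //; have := OFFU_le hu; have := M_small k; lia.
rewrite E1 modn_small //.
have := OFFU_le hv; rewrite /OFF (offsetE id (ownk k) (@par_in k) (@d_le k)) // hp.
move=> h2; apply: leq_ltn_trans (M_small k); apply: leq_trans h2; exact: leq_addr.
Qed.

Lemma mtot_conv k t v : in_tr k v -> d k v < t ->
  mtot (x (D.+2 + t) v) k = M k.
Proof.
elim: t v => // t IH v hv ht; rewrite addnS [LHS](step_mtot (x_cons (D.+2 + t)) hv).
case hp: (tpar k v) => [p|].
  have [hp1 hp2] := par_in hv hp.
  by rewrite -/(x (D.+2 + t)) IH ?modn_small //; lia.
change (mup (x (D.+2 + t).+1 v) k = M k); rewrite mup_conv //; last by lia.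
by rewrite /U (subtotal_root (ownk k) id_inj (@par_in k) (@root_uniq k) (@d_le k) hv hp) M_in.
Qed.

Lemma agg_spec_run :
  let y := x (2 * D + 3) in
  agg_spec s own (fun v => moff (y v)) (fun v => mtot (y v)).
Proof.
move=> y; have hy : 2 * D + 3 = D.+2 + D.+1 by lia.
split=> [v k hv|k g].
  by rewrite /y hy mtot_conv //; have [] := wf hv; lia.
have E1 : \sum_u \sum_(0 <= i < own (s u) k) g (moff (y u) k + i) =
    \sum_(u | in_tr k u) block g (OFF k u) (ownk k u).
  rewrite [RHS]big_mkcond; apply: eq_bigr => u _; case: ifP => hu.
    by rewrite /y hy moff_conv //; have [] := wf hu; lia.
  case E0: (own (s u) k) => [|m]; first by rewrite big_nil.
  by rewrite /in_tr own_in ?E0 in hu.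
rewrite E1 -/(M k).
case: (pickP (in_tr k)) => [v hv|h0]; last first.
  by rewrite -M_in [LHS]big_pred0 // [X in index_iota 0 X]big_pred0 // big_geq.
have [r hr hp] := root_exists (@par_in k) hv.
rewrite (block_tree (ownk k) id_inj (@par_in k) (@root_uniq k) (@d_le k) g hr hp).
rewrite (subtotal_root (ownk k) id_inj (@par_in k) (@root_uniq k) (@d_le k) hr hp) M_in.
by rewrite /block; under eq_bigr do rewrite add0n.
Qed.

End Conv.
End Agg.

Lemma exec_op w E D o (x : T -> mstate) :
  ready w E D o (mc \o x) ->
  exec o (mc \o x) (mc \o run e id (op_instrs w E D o) x).
Proof.
case: o => [f|om own f] [hf] h.
  by move=> v; exact: (congr1 mc (step_exchange f v hf)).
case: h => hme [d wf] hin hsm; rewrite [op_instrs _ _ _ _]/=.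
set x0 := step e id (exchange w E (fun c _ => c)) x.
have hc : consistent (mc \o x) x0.
  by move=> v; split; [exact: (congr1 mc (step_exchange _ v hf)) |
                       exact: (congr1 mtab (step_exchange _ v hf))].
rewrite [run _ _ _ _]/= -/x0 run_nseq_ag.
set y := iter_ag _ _ _ _ _.
exists (fun v => moff (y v)), (fun v => mtot (y v)); split.
  by apply: (agg_spec_run (w := w) hme hf wf hin hsm hc).
have hy : consistent (mc \o x) y.
  rewrite /y; elim: (2 * D + 3) => //= t IH; exact: step_consistent.
by move=> v /=; rewrite (hy v).1.
Qed.

End Semantics.

(** * The algorithm *)

Definition bitn (i m : nat) : bool := odd (m %/ 2 ^ i).

Definition seek (q : pred pub) (nb : seq pub) : option pub := ohead [seq p <- nb | q p].

(** A vertex that already relays for the tree [k] keeps its old parent there, so that rejoining a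
    cluster adds neither load nor depth. *)
Definition add_entry (p : pub) (k i : nat) : pub :=
  if k \in keys (ents p) then p
  else Pub (me p) (alive p) (lab p) (cls p) (col p) ((k, Some i) :: ents p).

Definition set_pub (c : core) (p : pub) : core := Core p (tgt c) (cval c) (outp c) (hist c).
Definition set_tgt (c : core) t : core := Core (pb c) t (cval c) (outp c) (hist c).
Definition set_val (c : core) x : core := Core (pb c) (tgt c) x (outp c) (hist c).
Definition set_cls (c : core) x : core :=
  let p := pb c in set_pub c (Pub (me p) (alive p) (lab p) x (col p) (ents p)).
Definition set_col (c : core) x : core :=
  let p := pb c in set_pub c (Pub (me p) (alive p) (lab p) (cls p) x (ents p)).

Definition aim (c : core) (o : option pub) : core :=
  if o is Some p then
    set_tgt (set_pub c (add_entry (pb c) (lab p) (me p))) (Some (lab p, cls p))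
  else set_tgt c None.

Definition hits (c : core) (k : nat) : bool := if tgt c is Some (k', _) then k' == k else false.
Definition member (c : core) (k : nat) : bool := alive (pb c) && (lab (pb c) == k).

Definition propose (i : nat) (c : core) (nb : seq pub) : core :=
  aim c (if alive (pb c) && ~~ bitn i (cls (pb c))
         then seek (fun p => alive p && bitn i (cls p)) nb else None).

(* Members and proposals are counted in a single sum, as digits in base [n.+1]. *)
Definition own_props (n : nat) (c : core) (k : nat) : nat :=
  member c k + n.+1 * hits c k.

Definition settle (n P : nat) (c : core) (off tot : nat -> nat) : core :=
  if tgt c is Some (k, q) then
    let p := pb c in
    let yes := tot k %% n.+1 <= 2 * P * (tot k %/ n.+1) in
    set_tgt (set_pub c (Pub (me p) yes (if yes then k else lab p)
                         (if yes then q else cls p) (col p) (ents p))) None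
  else c.

Definition rg_step (n P w i : nat) : seq op :=
  [:: Loc (propose i); Agg w (own_props n) (settle n P)].

Definition foreign (c : core) (p : pub) : bool := alive p && (lab p != lab (pb c)).

(** Labels differ between clusters and so can serve as initial colors for the Cole-Vishkin
    process. *)
Definition mark (c : core) (nb : seq pub) : core :=
  if alive (pb c) then set_val (set_col c (lab (pb c))) (has (foreign c) nb)
  else c.

Definition own_val (c : core) (k : nat) : nat := if member c k then cval c else 0.

(** Border vertices contribute 1 to the sum, hence exactly one of them in each cluster that has any
    sees offset 0. *)
Definition elect (c : core) (off tot : nat -> nat) : core :=
  set_val c ((cval c == 1) && (off (lab (pb c)) == 0)).

Definition point (c : core) (nb : seq pub) : core :=
  aim c (if alive (pb c) && (cval c == 1) then seek (foreign c) nb else None).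

(** Twice the position of the lowest bit where [x] and [y] differ, plus the bit of [x] there. *)
Fixpoint cole_vishkin (fuel x y : nat) : nat :=
  if fuel is f.+1 then
    if odd x != odd y then nat_of_bool (odd x) else (cole_vishkin f x./2 y./2).+2
  else 0.

(** Values are shifted by one, 0 meaning that there is no pointer; [b + 3] bounds the number of bits
    of every color that occurs. *)
Definition look (b : nat) (c : core) (nb : seq pub) : core :=
  set_val c
    (if tgt c is Some (k, _) then
       if seek (fun p => alive p && (lab p == k)) nb is Some p
       then (cole_vishkin (b + 3) (col (pb c)) (col p)).+1 else 0
     else 0).

Definition recolor (c : core) (off tot : nat -> nat) : core :=
  if alive (pb c) then set_col c (tot (lab (pb c))).-1 else c.

Definition own_hits (c : core) (k : nat) : nat := hits c k.

Definition side (c : core) (off tot : nat -> nat) : core :=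
  set_val c (if tgt c is Some (k, _) then (odd (off k)).+1 else 0).

(** Four bits of color and one bit for the half: the five bits that a phase separates. *)
Definition classify (c : core) (off tot : nat -> nat) : core :=
  if alive (pb c) then set_cls c (col (pb c) + 16 * (tot (lab (pb c))).-1) else c.

Definition own_member (c : core) (k : nat) : nat := member c k.

Definition reset (c : core) (nb : seq pub) : core :=
  let m := me (pb c) in
  let u := outp c == None in
  Core (Pub m u m 0 0 (if u then [:: (m, None)] else [::])) None 0 (outp c) (hist c).

(* A vertex may be the root of clusters of several colors, hence the final label
   [k * L + i] for the cluster of root [k] in color [i]. *)
Definition finish (L i : nat) (c : core) (off tot : nat -> nat) : core :=
  let p := pb c in
  Core p (tgt c) (cval c)
    (if alive p then Some (i, lab p * L + i) else outp c)
    (hist c ++ [seq (q.1 * L + i, q.2) | q <- ents p & 0 < tot q.1]).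

Fixpoint repeat_ops (m : nat) (p : seq op) : seq op :=
  if m is m'.+1 then p ++ repeat_ops m' p else [::].

Definition log_n (n : nat) : nat := (trunc_log 2 n).+1.
(** There are [2 * log_n n] phases of five subphases. In a phase a vertex enters at most six trees,
    one when pointing and one per subphase, which with its own tree gives [max_ents]; depths grow by
    at most one when pointing and by one in each of the [5 * n_step n] growth steps, which gives
    [max_depth]. *)
Definition n_sub (n : nat) : nat := 10 * log_n n.
Definition n_step (n : nat) : nat := 2 * n_sub n * log_n n.
Definition max_ents (n : nat) : nat := 12 * log_n n + 1.
Definition max_depth (n : nat) : nat := 2 * log_n n * (1 + 5 * n_step n).
(** The two-digit sums of [own_props] are of order [n ^ 2] with [n <= 2 ^ b]; the six extra bits
    absorb constant factors and small [b]. *)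
Definition word (b : nat) : nat := 4 * b + 6.
(* Cole-Vishkin colors have at most [2 (b + 3)] values, see [cv_bits_le]. *)
Definition cv_width (b : nat) : nat := trunc_log 2 b + 5.

Definition classify_ops (b : nat) : seq op :=
  [:: Loc mark; Agg (word b) own_val elect; Loc point] ++
  repeat_ops (log_star b) [:: Loc (look b); Agg (cv_width b) own_val recolor] ++
  [:: Agg (word b) own_hits side; Agg (word b) own_val classify].

Fixpoint separate_ops (n b i m : nat) : seq op :=
  if m is m'.+1 then
    repeat_ops (n_step n) (rg_step n (n_sub n) (word b) i) ++ separate_ops n b i.+1 m'
  else [::].

Lemma separate_opsS n b i m : separate_ops n b i m.+1 =
  repeat_ops (n_step n) (rg_step n (n_sub n) (word b) i) ++ separate_ops n b i.+1 m.
Proof. by []. Qed.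

Definition phase_ops (n b : nat) : seq op := classify_ops b ++ separate_ops n b 0 5.

Definition color_ops (n b i : nat) : seq op :=
  Loc reset :: repeat_ops (2 * log_n n) (phase_ops n b) ++
  [:: Agg (word b) own_member (finish (log_n n) i)].

Fixpoint all_ops (n b i m : nat) : seq op :=
  if m is m'.+1 then color_ops n b i ++ all_ops n b i.+1 m' else [::].

Definition ops_instrs (n b : nat) (p : seq op) : seq (instr mstate) :=
  flatten [seq op_instrs (word b) (max_ents n) (max_depth n) o | o <- p].

Definition program (n b : nat) : seq (instr mstate) :=
  ops_instrs n b (all_ops n b 0 (log_n n)).

Definition init_core (i : nat) : core := Core (Pub i false i 0 0 [::]) None 0 None [::].

Definition init_state (i : nat) : mstate :=
  MState (init_core i) [::] [::] zero_fun zero_fun zero_fun.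

Definition output (s : mstate) : node_output :=
  let c := mc s in
  let o := odflt (0, 0) (outp c) in NodeOutput o.1 o.2 (hist c).

Definition decomposition_alg : congest_alg := compile program init_state output word.

(** * Hoare triples and encodable configurations *)

Section Hoare.
Variables (T : finType) (e : rel T) (id : T -> nat) (b : nat).
Hypothesis e_sym : symmetric e.
Hypothesis id_inj : injective id.
Hypothesis id_lt : forall v, id v < 2 ^ b.
Notation n := #|T|.
Notation cfg := (cfg T).

Definition triple (P : cfg -> Prop) (p : seq op) (Q : cfg -> Prop) : Prop :=
  forall x : T -> mstate, P (mc \o x) -> Q (mc \o run e id (ops_instrs n b p) x).

Definition ready_op := ready e id (word b) (max_ents n) (max_depth n).

Lemma triple_nil (P : cfg -> Prop) : triple P [::] P.
Proof. by []. Qed.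

Lemma triple_weaken (P P' Q Q' : cfg -> Prop) p :
  (forall s, P s -> P' s) -> (forall s, Q' s -> Q s) ->
  triple P' p Q' -> triple P p Q.
Proof. by move=> h1 h2 h x /h1/h/h2. Qed.

Lemma triple_cat P Q R p q : triple P p Q -> triple Q q R -> triple P (p ++ q) R.
Proof.
by move=> h1 h2 x /h1/h2; rewrite /ops_instrs map_cat flatten_cat run_cat.
Qed.

Lemma triple_op (P Q : cfg -> Prop) o :
  (forall s, P s -> ready_op o s) ->
  (forall s s', P s -> exec e id o s s' -> Q s') -> triple P [:: o] Q.
Proof.
move=> h1 h2 x hP; rewrite /ops_instrs /= cats0.
by apply: h2 (hP) _; apply: exec_op => //; apply: h1.
Qed.

Lemma triple_cons P Q R o p : triple P [:: o] Q -> triple Q p R -> triple P (o :: p) R.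
Proof. exact: (@triple_cat P Q R [:: o] p). Qed.

Lemma triple_repeat (I : nat -> cfg -> Prop) p m :
  (forall i, i < m -> triple (I i) p (I i.+1)) -> triple (I 0) (repeat_ops m p) (I m).
Proof.
elim: m I => [|m IH] I h //=.
apply: (triple_cat (h 0 (ltn0Sn _))); apply: (IH (fun i => I i.+1)) => i hi.
exact: h.
Qed.

Lemma triple_exists (A : Type) (P : A -> cfg -> Prop) p Q :
  (forall a, triple (P a) p Q) -> triple (fun s => exists a, P a s) p Q.
Proof. by move=> h x [a /h]. Qed.

Lemma card_le : n <= 2 ^ b.
Proof.
rewrite -(card_ord (2 ^ b)).
by apply: (@leq_card _ _ (fun v => Ordinal (id_lt v))) => u v [/id_inj].
Qed.

Lemma log_n_le : log_n n <= b.+1.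
Proof.
rewrite /log_n ltnS; have [h0|h0] := posnP n; first by rewrite h0.
rewrite -(@leq_exp2l 2) //; apply: leq_trans card_le.
exact: trunc_logP.
Qed.

Lemma lt_word x c : x <= c * 2 ^ b -> c < 64 -> x < 2 ^ word b.
Proof.
move=> hx hc; apply: leq_ltn_trans hx _; rewrite /word expnD.
have h1 : 2 ^ b <= 2 ^ (4 * b) by rewrite leq_exp2l //; lia.
have h2 : 0 < 2 ^ b by rewrite expn_gt0.
apply: (@leq_trans (64 * 2 ^ b)); first by rewrite ltn_pmul2r.
by rewrite mulnC leq_mul.
Qed.

Lemma max_ents_word : max_ents n < 2 ^ word b.
Proof.
apply: (@lt_word _ 13) => //; rewrite /max_ents.
have := log_n_le; have := ltn_expl b (isT : 1 < 2); lia.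
Qed.

(** The index [a] bounds the depth of all trees; it rises whenever vertices hang themselves below
    others. *)
Record basic (a : nat) (s : cfg) : Prop := Basic {
  basic_me : forall v, me (pb (s v)) = id v;
  basic_lab : forall v, alive (pb (s v)) -> lab (pb (s v)) \in keys (trees s v);
  basic_uniq : forall v, uniq (keys (trees s v));
  basic_wf : wf_trees e id (trees s) (fun k => k) a;
  basic_ents : forall v q, q \in trees s v -> q.1 < 2 ^ b /\ opt_code q.2 <= 2 ^ b;
  basic_lab_lt : forall v, lab (pb (s v)) < 2 ^ b;
  basic_cls : forall v, cls (pb (s v)) < 32;
  basic_col : forall v, col (pb (s v)) < 2 ^ (b + 3) }.

Definition sized (m : nat) (s : cfg) : Prop := forall v, size (trees s v) <= m.

Lemma basic_fits a m s : basic a s -> sized m s -> m <= max_ents n ->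
  forall v, fits (word b) (max_ents n) (pb (s v)).
Proof.
move=> h hs hm v; apply/andP; split; last by apply: leq_trans (hs v) hm.
have hp : 0 < 2 ^ b by rewrite expn_gt0.
have hcol := basic_col h v; rewrite expnD (_ : 2 ^ 3 = 8) // in hcol.
have W x c : x <= c * 2 ^ b -> c < 64 -> x < 2 ^ word b by exact: lt_word.
apply/allP => x; rewrite mem_cat => /orP[|].
  rewrite !inE => /or4P[/eqP->|/eqP->|/eqP->|/orP[/eqP->|/orP[/eqP->|/eqP->]]].
  - by apply: (W _ 1) => //; rewrite (basic_me h) mul1n ltnW.
  - by apply: (W _ 1) => //; rewrite mul1n; case: alive.
  - by apply: (W _ 1) => //; rewrite mul1n ltnW ?(basic_lab_lt h).
  - by apply: (W _ 32) => //; have := basic_cls h v; lia.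
  - by apply: (W _ 8) => //; lia.
  - by apply: leq_ltn_trans max_ents_word; apply: leq_trans (hs v) hm.
case/flattenP => l /mapP[q hq ->]; have [h1 h2] := basic_ents h hq.
by rewrite !inE => /orP[]/eqP->; apply: (W _ 1) => //; rewrite mul1n //; apply: ltnW.
Qed.

End Hoare.

Arguments triple_cat {T e id b P} Q {R p q} _ _ x _.
Arguments triple_cons {T e id b P} Q {R o p} _ _ x _.

(** * Cluster growth *)

Section Growth.
Variables (T : finType) (e : rel T).
Hypothesis e_sym : symmetric e.

Record view := View { va : T -> bool; vl : T -> nat; vc : T -> nat }.

Definition members (x : view) k := #|[set u | va x u && (vl x u == k)]|.
Definition props (x : view) (pr : T -> option T) k :=
  #|[set v | if pr v is Some u then vl x u == k else false]|.

Definition rg_rel (i P : nat) (x y : view) : Prop :=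
  exists pr : T -> option T,
  [/\ forall v u, pr v = Some u ->
        [/\ va x v, ~~ bitn i (vc x v), e v u, va x u & bitn i (vc x u)],
      forall v u, va x v -> ~~ bitn i (vc x v) -> e v u -> va x u ->
        bitn i (vc x u) -> pr v != None &
      forall v, (va y v, vl y v, vc y v) =
        if pr v is Some u then
          if members x (vl x u) <= 2 * P * props x pr (vl x u)
          then (true, vl x u, vc x u) else (false, vl x v, vc x v)
        else (va x v, vl x v, vc x v)].

(** Equal labels count as links because the members of a cluster may be connected only through dead
    relays of its Steiner tree. Components are thus those of the graph of clusters. *)
Definition linked (x : view) : rel T :=
  fun u v => [&& va x u, va x v & e u v || (vl x u == vl x v)].

Lemma linked_sym x : symmetric (linked x).
Proof. by move=> u v; rewrite /linked andbCA e_sym eq_sym. Qed.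

(* [x0] is the view in which the classes were assigned, [i] the number of
   class bits along which the living vertices are already separated. *)
Record refines (x0 : view) (i : nat) (x : view) : Prop := Refines {
  ref_alive : forall v, va x v -> va x0 v;
  ref_origin : forall v, va x v -> exists u,
    [/\ va x0 u, vl x0 u = vl x v, vc x0 u = vc x v & connect (linked x0) v u];
  ref_bits : forall u v, va x u -> va x v -> e u v ->
    forall j, j < i -> bitn j (vc x u) = bitn j (vc x v) }.

Definition class_of_label (x : view) := forall u v, va x u -> va x v ->
  vl x u = vl x v -> vc x u = vc x v.

Lemma refines_class x0 i x : class_of_label x0 -> refines x0 i x -> class_of_label x.
Proof.
move=> h0 h u v hu hv E.
have [u' [h1 h2 h3 _]] := ref_origin h hu; have [v' [h4 h5 h6 _]] := ref_origin h hv.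
by rewrite -h3 -h6; apply: h0; rewrite // h2 h5.
Qed.

(** The blue clusters without red neighbours. They have stopped growing, and their sizes pay for the
    vertices killed. *)
Definition free (i : nat) (x : view) : {set T} :=
  [set u | [&& va x u, bitn i (vc x u) &
    ~~ [exists w, [exists z, [&& va x w, vl x w == vl x u, va x z,
                                 ~~ bitn i (vc x z) & e z w]]]]].

Definition living (x : view) : {set T} := [set u | va x u].

(** With [S] living vertices at the start, the first field bounds the number of killed ones by
    [#|free i x| / (2 * P)]. The second says that a blue cluster with a red neighbour has at least
    [(1 + 1 / (2 * P)) ^ t] members. Both are cleared of subtraction and division. *)
Record growing (i P S t : nat) (x : view) : Prop := Growing {
  gr_killed : 2 * P * S <= #|free i x| + 2 * P * #|living x|;
  gr_size : forall u z, va x u -> bitn i (vc x u) -> va x z ->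
    ~~ bitn i (vc x z) -> e z u ->
    (2 * P).+1 ^ t <= members x (vl x u) * (2 * P) ^ t }.

Lemma growing_start i P x : growing i P #|living x| 0 x.
Proof.
split; first exact: leq_addl.
move=> u z hu _ _ _ _; rewrite !expn0 muln1 /members card_gt0.
by apply/set0Pn; exists u; rewrite inE hu eqxx.
Qed.

Section Step.
Variables (i P : nat) (x0 x y : view).
Hypothesis x0_class : class_of_label x0.
Variable j : nat.
Hypothesis ref_x : refines x0 j x.
Variable pr : T -> option T.
Hypothesis pr_Some : forall v u, pr v = Some u ->
  [/\ va x v, ~~ bitn i (vc x v), e v u, va x u & bitn i (vc x u)].
Hypothesis pr_None : forall v u, va x v -> ~~ bitn i (vc x v) -> e v u ->
  va x u -> bitn i (vc x u) -> pr v != None.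
Let acc k := members x k <= 2 * P * props x pr k.
Hypothesis y_def : forall v, (va y v, vl y v, vc y v) =
  if pr v is Some u then
    if acc (vl x u) then (true, vl x u, vc x u) else (false, vl x v, vc x v)
  else (va x v, vl x v, vc x v).

Let y_None v : pr v = None -> [/\ va y v = va x v, vl y v = vl x v & vc y v = vc x v].
Proof. by move=> h; have := y_def v; rewrite h => -[]. Qed.

Let y_Some v u : pr v = Some u ->
  if acc (vl x u) then [/\ va y v, vl y v = vl x u & vc y v = vc x u]
  else va y v = false.
Proof. by move=> h; have := y_def v; rewrite h; case: ifP => _ []. Qed.

Let y_cases v : va y v -> va x v /\
  ((pr v = None /\ vl y v = vl x v /\ vc y v = vc x v) \/
   exists u, [/\ pr v = Some u, acc (vl x u), vl y v = vl x u & vc y v = vc x u]).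
Proof.
move=> hv; case hp: (pr v) => [u|].
  have [h1 _ _ _ _] := pr_Some hp; split=> //; right; exists u.
  by have := y_Some hp; case: ifP; [move=> ? [] | rewrite hv].
by have [h1 h2 h3] := y_None hp; split; [rewrite -h1 | left].
Qed.

(** A vertex changes cluster only along an edge between living vertices, whose classes already agree
    on the separated bits; its new class therefore keeps these bits. *)
Lemma refines_step : refines x0 j y.
Proof.
split=> [v /y_cases[/(ref_alive ref_x)] //|v|].
  case/y_cases=> hv [[hp [-> ->]]|[u [hp _ -> ->]]]; first exact: (ref_origin ref_x).
  have [_ _ huv hu _] := pr_Some hp.
  have [u' [h1 h2 h3 h4]] := ref_origin ref_x hu; exists u'; split=> //.
  apply: connect_trans h4; apply: connect1.
  by rewrite /linked !(ref_alive ref_x) // huv.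
have key v : va y v -> forall k, k < j -> bitn k (vc y v) = bitn k (vc x v).
  case/y_cases=> hv [[hp [_ ->]]|[u [hp _ _ ->]]] // k hk.
  have [_ _ huv hu _] := pr_Some hp.
  by rewrite (ref_bits ref_x hv hu huv hk).
move=> u v hu hv huv k hk; rewrite !key //.
by apply: (ref_bits ref_x _ _ huv) => //; [case/y_cases: hu | case/y_cases: hv].
Qed.

Lemma blue_stays v : va x v -> bitn i (vc x v) ->
  [/\ va y v, vl y v = vl x v & vc y v = vc x v].
Proof.
move=> hv hb; have : pr v = None.
  by case hp: (pr v) => [u|] //; have [_] := pr_Some hp; rewrite hb.
by case/y_None=> -> -> ->.
Qed.

Lemma red_after z : va y z -> ~~ bitn i (vc y z) ->
  [/\ va x z, ~~ bitn i (vc x z) & pr z = None].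
Proof.
case/y_cases=> hz [[hp [_ ->]]|[u [hp _ _ ->]]] // hb.
by have [_ _ _ _] := pr_Some hp; rewrite (negbTE hb).
Qed.

(* Had [u] been blue before the step, [z] would have proposed. *)
Lemma blue_with_red_joined u z : va y u -> bitn i (vc y u) -> va y z ->
  ~~ bitn i (vc y z) -> e z u ->
  exists w, [/\ pr u = Some w, acc (vl x w) & vl y u = vl x w].
Proof.
move=> hu hb hz hbz hzu; have [h1 h2 h3] := red_after hz hbz.
case: (y_cases hu) => hxu [[hp [E1 E2]]|[w [hp ha E1 _]]]; last by exists w.
by have := pr_None h1 h2 hzu hxu; rewrite h3 -E2 => /(_ hb).
Qed.

(** Blue members never leave, and the accepted proposers were red, hence not yet members. *)
Lemma members_step w : va x w -> bitn i (vc x w) -> acc (vl x w) ->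
  members x (vl x w) + props x pr (vl x w) <= members y (vl x w).
Proof.
move=> hw hb ha; rewrite /members /props -cardsUI addnC.
have -> : [set u | va x u && (vl x u == vl x w)] :&:
   [set v | if pr v is Some u then vl x u == vl x w else false] = set0.
  apply/setP => v; rewrite !inE; apply/negbTE/negP => /andP[/andP[hv /eqP E]].
  case hp: (pr v) => [u|] // _; have [_] := pr_Some hp.
  by rewrite (refines_class x0_class ref_x hv hw E) hb.
rewrite cards0 add0n; apply: subset_leq_card; apply/subsetP => v.
rewrite !inE => /orP[/andP[hv /eqP E]|].
  have hbv : bitn i (vc x v) by rewrite (refines_class x0_class ref_x hv hw E).
  by have [-> -> _] := blue_stays hv hbv; rewrite E eqxx.
case hp: (pr v) => [u|] // /eqP E; have := y_Some hp.
by rewrite E ha => -[-> -> _]; rewrite eqxx.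
Qed.

Let rej : {set T} := [set u | [&& va x u, bitn i (vc x u) & ~~ acc (vl x u)]].
Let dead : {set T} := [set v | if pr v is Some u then ~~ acc (vl x u) else false].

Lemma living_step : #|living x| = #|living y| + #|dead|.
Proof.
rewrite -cardsUI.
have -> : living y :&: dead = set0.
  apply/setP => v; rewrite !inE; case hp: (pr v) => [u|]; rewrite ?andbF //.
  by have := y_Some hp; case: (acc _) => [_|->]; rewrite ?andbF.
rewrite cards0 addn0; apply: eq_card => v; rewrite !inE.
case hp: (pr v) => [u|].
  have := y_Some hp; have [-> _ _ _ _] := pr_Some hp.
  by case: ifP => [_ [->]|_ ->].
by rewrite orbF; have [-> _ _] := y_None hp.
Qed.

(** A cluster without red neighbours receives no proposal, and a nonempty cluster rejects zero
    proposals. *)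
Lemma free_sub_rej : free i x \subset rej.
Proof.
apply/subsetP => u; rewrite !inE => /and3P[hu hb /existsPn h]; rewrite hu hb /=.
rewrite /acc -ltnNge (_ : props _ _ _ = 0) ?muln0.
  by rewrite card_gt0; apply/set0Pn; exists u; rewrite inE hu eqxx.
apply/eqP; rewrite cards_eq0; apply/eqP/setP => v; rewrite !inE.
case hp: (pr v) => [w|] //; apply/negP => /eqP E.
have [h1 h2 h3 h4 h5] := pr_Some hp.
by have /existsPn/(_ v) := h w; rewrite h4 E eqxx h1 h2 h3.
Qed.

(** After the step, a red vertex can only be adjacent to a blue one that has just joined, so its
    neighbouring cluster accepted; a cluster that rejected has no red neighbour left. *)
Lemma rej_sub_free : rej \subset free i y.
Proof.
apply/subsetP => u; rewrite !inE => /and3P[hu hb ha].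
have [-> E1 ->] := blue_stays hu hb; rewrite hb E1 /=.
apply/existsPn => w; apply/existsPn => z; apply/negP => /and5P[h1 /eqP h2 h3 h4 h5].
have hbw : bitn i (vc y w).
  have [hu' E1' E2'] := blue_stays hu hb.
  by rewrite (refines_class x0_class refines_step h1 hu') ?E2' // h2.
have [w' [_ h6 h7]] := blue_with_red_joined h1 hbw h3 h4 h5.
by rewrite -h2 h7 h6 in ha.
Qed.

(** Count the killed vertices by the label of the cluster that rejected them. Such a cluster had a
    red neighbour, so it lies in [rej] outside [free i x], and it has more than [2 * P] members per
    killed proposer. *)
Lemma dead_bound : #|free i x| + 2 * P * #|dead| <= #|rej|.
Proof.
pose B := (\max_v vl x v).+1.
have lB v : vl x v < B by rewrite ltnS; apply: (leq_bigmax v).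
pose Rk k := [set u in rej :\: free i x | vl x u == k].
pose Dk k := [set v in dead | if pr v is Some u then vl x u == k else false].
have hR : #|rej :\: free i x| = \sum_(k < B) #|Rk k|.
  rewrite -sum1_card (partition_big (fun u => Ordinal (lB u)) predT) //=.
  apply: eq_bigr => k _; rewrite -sum1_card; apply: eq_bigl => u.
  by rewrite !inE -val_eqE /=.
have hD : #|dead| = \sum_(k < B) #|Dk k|.
  pose f v := if pr v is Some u then Ordinal (lB u) else Ordinal (lB v).
  rewrite -sum1_card (partition_big f predT) //=.
  apply: eq_bigr => k _; rewrite -sum1_card; apply: eq_bigl => u.
  by rewrite !inE /f -val_eqE /=; case: (pr u).
rewrite -(cardsID (free i x) rej) (setIidPr free_sub_rej) leq_add2l hR hD big_distrr.
apply: leq_sum => k _ /=.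
have [->|[v hv]] := set_0Vmem (Dk k); first by rewrite cards0 muln0.
move: hv; rewrite !inE; case hp: (pr v) => [u|] //= /andP[ha /eqP E].
have [h1 h2 h3 h4 h5] := pr_Some hp.
have -> : #|Dk k| = props x pr k.
  apply: eq_card => z; rewrite !inE; case: (pr z) => [z'|] //.
  by case: eqP => [->|]; rewrite ?andbF // andbT -E.
apply: (@leq_trans (members x k)).
  by move: ha; rewrite /acc E -ltnNge => /ltnW.
apply: subset_leq_card; apply/subsetP => z; rewrite !inE => /andP[hz /eqP Ez].
have hbz : bitn i (vc x z).
  by rewrite (refines_class x0_class ref_x hz h4) // Ez.
rewrite hz hbz Ez eqxx -E ha !andbT /= negbK.
by apply/existsP; exists u; apply/existsP; exists v; rewrite h4 eqxx h1 h2 h3.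
Qed.

Lemma growing_step S t : growing i P S t x -> growing i P S t.+1 y.
Proof.
case=> hk hg; split.
  have := subset_leq_card rej_sub_free; have := dead_bound.
  by move: hk; rewrite living_step mulnDr; lia.
move=> u z hu hb hz hbz hzu.
have [w [hp ha E]] := blue_with_red_joined hu hb hz hbz hzu.
have [h1 h2 h3 h4 h5] := pr_Some hp.
have := members_step h4 h5 ha.
have huw : e u w by [].
have := hg w u h4 h5 h1 h2 huw; rewrite E.
move: ha; rewrite /acc; set m := members x _; set p := props _ _ _; set m' := members y _.
set Q := 2 * P => ha hq hm.
(* The growth factor: [Q.+1 * m <= Q * (m + p) <= Q * m'], from [m <= Q * p] and [m + p <= m']. *)
rewrite !expnS mulnA (mulnC m').
apply: (@leq_trans (Q.+1 * (m * Q ^ t))); first by rewrite leq_mul2l hq orbT.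
rewrite mulnA leq_mul2r; apply/orP; right.
by rewrite mulSn; apply: (@leq_trans (Q * (m + p))); rewrite ?leq_mul2l ?hm ?orbT // mulnDr addnC leq_add2l.
Qed.

End Step.

Lemma rg_step_inv i P S t j x0 x y : class_of_label x0 -> refines x0 j x ->
  growing i P S t x -> rg_rel i P x y -> refines x0 j y /\ growing i P S t.+1 y.
Proof.
move=> h0 hr hg [pr [h1 h2 h3]]; split; first exact: (refines_step hr h1 h3).
exact: (growing_step h0 hr h1 h2 h3).
Qed.

(** Bernoulli's inequality for [(1 + 1 / Q) ^ Q], with denominators cleared. *)
Lemma double_pow Q : 0 < Q -> 2 * Q ^ Q <= Q.+1 ^ Q.
Proof.
move=> hQ; have bern m : Q ^ m * (Q + m) <= Q * Q.+1 ^ m.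
  elim: m => [|m IH]; first by rewrite !expn0 addn0 mulnC.
  rewrite !expnS; move: IH; move: (Q ^ m) (Q.+1 ^ m) => p q; nia.
have := bern Q; rewrite addnn -mul2n mulnCA (mulnC (Q ^ Q)) => h.
by rewrite -(leq_pmul2l hQ) mulnCA.
Qed.

(** By [double_pow], a blue cluster that still had a red neighbour would contain at least [2 ^ L]
    vertices, more than there are. *)
Lemma growing_end i P S L x0 x : 0 < P -> #|T| < 2 ^ L -> class_of_label x0 ->
  refines x0 i x -> growing i P S (2 * P * L) x ->
  refines x0 i.+1 x /\ 2 * P * S <= #|living x| + 2 * P * #|living x|.
Proof.
move=> hP hn h0 hr [hk hg].
have key u z : va x u -> bitn i (vc x u) -> va x z -> ~~ bitn i (vc x z) -> e z u -> False.
  move=> h1 h2 h3 h4 h5; have := hg _ _ h1 h2 h3 h4 h5.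
  rewrite leqNgt => /negP; apply.
  rewrite !(expnM _ (2 * P) L).
  have hQ : 0 < 2 * P by lia.
  have hd := double_pow hQ.
  apply: (@leq_trans ((2 * (2 * P) ^ (2 * P)) ^ L)).
    rewrite (expnMn 2 ((2 * P) ^ (2 * P)) L) ltn_pmul2r ?expn_gt0 ?hQ //.
    apply: leq_ltn_trans hn; exact: max_card.
  by case: (L) => [|l]; rewrite ?expn0 // leq_exp2r.
split; last first.
  apply: leq_trans hk _; rewrite leq_add2r; apply: subset_leq_card.
  by apply/subsetP => u; rewrite !inE => /and3P[].
split; [exact: ref_alive hr | exact: ref_origin hr |].
move=> u v hu hv huv k; rewrite ltnS leq_eqVlt => /orP[/eqP->|]; last first.
  exact: (ref_bits hr).
case h1: (bitn i (vc x u)); case h2: (bitn i (vc x v)) => //.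
  by case: (key u v); rewrite ?h1 ?h2 // e_sym.
by case: (key v u); rewrite ?h1 ?h2.
Qed.

End Growth.

(** * Cole-Vishkin colors and balanced classes *)

Lemma half_lt x m : x < 2 ^ m.+1 -> x./2 < 2 ^ m.
Proof. by rewrite expnS => h; lia. Qed.

Lemma cole_vishkin_lt f m x y : x != y -> x < 2 ^ m -> y < 2 ^ m -> m <= f ->
  cole_vishkin f x y < 2 * m.
Proof.
elim: f m x y => [|f IH] [|m] x y hxy hx hy hm //=; try by lia.
case: eqP => /= h; last by case: (odd x); lia.
have h2 : x./2 != y./2 by apply: contraNneq hxy => h2; lia.
by have := IH m _ _ h2 (half_lt hx) (half_lt hy) hm; lia.
Qed.

(** Equal values would mean the same position for both pairs and the same bit of [x] and [y] there,
    although [x] and [y] differ at that position. *)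
Lemma cole_vishkin_proper f x y z : x != y -> y != z ->
  x < 2 ^ f -> y < 2 ^ f -> z < 2 ^ f -> cole_vishkin f x y != cole_vishkin f y z.
Proof.
elim: f x y z => [|f IH] x y z hxy hyz hx hy hz; first by lia.
rewrite /=; case: (odd x =P odd y) => h1; case: (odd y =P odd z) => h2 /=.
- rewrite !eqSS; apply: IH; try exact: half_lt; by apply/eqP; lia.
- by case: (odd y).
- by case: (odd x).
- by apply/eqP; lia.
Qed.

Lemma lt_trunc_log m : 2 * m < 2 ^ (trunc_log 2 m + 2).
Proof.
by rewrite addnS expnS ltn_pmul2l // addn1; apply: trunc_log_ltn.
Qed.

Lemma trunc_log_le y t : y < 2 ^ t.+1 -> trunc_log 2 y <= t.
Proof.
move=> h; have [->|hy] := posnP y; first by rewrite trunc_log0.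
rewrite -ltnS -(@ltn_exp2l 2) //; apply: leq_ltn_trans h; exact: trunc_logP.
Qed.

Definition cv_bits (b i : nat) : nat := iter i (fun m => trunc_log 2 m + 2) b.

(** The margin 3 is for small [b], where a step can increase the number of bits. *)
Lemma cv_bits_le b i : cv_bits b i <= b + 3.
Proof.
rewrite /cv_bits; elim: i => [|i IH] /=; first by lia.
set m := iter _ _ _ in IH *.
suff : trunc_log 2 m <= b + 1 by lia.
apply: trunc_log_le; apply: leq_ltn_trans IH _.
have := ltn_expl b (isT : 1 < 2); rewrite addn1 !expnS; lia.
Qed.

Lemma trunc_log_shift x m : 1 < x -> m <= x + 3 -> trunc_log 2 m <= (trunc_log 2 x).+1.
Proof.
move=> hx hm; apply: trunc_log_le.
have h := trunc_log_ltn x (isT : 1 < 2).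
have : 2 <= 2 ^ trunc_log 2 x.
  by rewrite -{1}(expn1 2) leq_exp2l // trunc_log_gt0.
by move: h; rewrite !expnS; lia.
Qed.

(** The bit count [m] stays within 3 of the iterated logarithm [x]: taking logarithms leaves a gap
    of at most 1, to which the step adds 2. When [x] has reached 1, [m] is at most 4. *)
Lemma cv_bits_log_star b : cv_bits b (log_star b) <= 4.
Proof.
suff H f x m : x <= f -> m <= x + 3 ->
    iter (log_star_aux f x) (fun m => trunc_log 2 m + 2) m <= 4.
  by apply: H => //; apply: leq_addr.
elim: f x m => [|f IH] x m hx hm /=; first by lia.
case: (leqP x 1) => h1; first by rewrite /=; lia.
rewrite iterSr; apply: IH.
  have := trunc_logP (isT : 1 < 2) (ltnW h1).
  by have := ltn_expl (trunc_log 2 x) (isT : 1 < 2); lia.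
by have := trunc_log_shift h1 hm; lia.
Qed.

Lemma bits_of_eq w m m' : (forall j, j < w -> bitn j m = bitn j m') ->
  bits_of w m = bits_of w m'.
Proof.
elim: w m m' => //= w IH m m' h; congr cons.
  by have := h 0 isT; rewrite /bitn !divn1.
by apply: IH => j hj; have := h j.+1 hj; rewrite /bitn expnS !divnMA !divn2.
Qed.

Lemma eq_of_bits w m m' : m < 2 ^ w -> m' < 2 ^ w ->
  (forall j, j < w -> bitn j m = bitn j m') -> m = m'.
Proof.
move=> h h' /bits_of_eq E.
by rewrite -(modn_small h) -(modn_small h') -!bits_ofK E.
Qed.

(** All arrows from [S] end in [X :\: S], and each target receives from [S] at most half of its
    arrows, rounded up. Summing, [2 * #|S| <= #|X| + (#|X| - #|S|)]. *)
Lemma two_thirds (T : finType) (X S : {set T}) (f : T -> T) :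
  S \subset X -> (forall x, x \in X -> f x \in X) ->
  (forall x, x \in S -> f x \notin S) ->
  (forall y, y \in X ->
     2 * #|[set x in S | f x == y]| <= #|[set x in X | f x == y]| + 1) ->
  3 * #|S| <= 2 * #|X|.
Proof.
move=> /subsetP hS hf hfS hb.
have part (A : {set T}) (B : pred T) : (forall x, x \in A -> f x \in B) ->
    #|A| = \sum_(y in B) #|[set x in A | f x == y]|.
  move=> h; rewrite -sum1_card (partition_big f (mem B)) //=.
  apply: eq_bigr => y _; rewrite -sum1_card; apply: eq_bigl => x.
  by rewrite !inE.
have h1 : 2 * #|S| <= \sum_(y in X :\: S) (#|[set x in X | f x == y]| + 1).
  rewrite (part S (mem (X :\: S))); last first.
    by move=> x hx; rewrite !inE hfS // hf // hS.
  rewrite big_distrr; apply: leq_sum => y; rewrite !inE => /andP[_ hy].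
  exact: hb.
have h2 : \sum_(y in X :\: S) #|[set x in X | f x == y]| <= #|X|.
  rewrite [leqRHS](part X (mem X)) // [leqRHS](big_setID S) /=.
  exact: leq_addl.
move: h1; rewrite big_split /= sum1_card.
have := cardsID S X; rewrite (setIidPr _); last exact/subsetP.
lia.
Qed.

Section Classes.
Variables (T : finType) (e : rel T).
Hypothesis e_sym : symmetric e.

Definition labels_if (x : view T) (v : T) (q : pred T) : seq nat :=
  undup [seq vl x u | u <- enum [pred u | [&& va x u, connect (linked e x) v u & q u]]].

Definition labels x v := labels_if x v predT.

Lemma mem_labels_if x v (q : pred T) k : reflect
  (exists u, [/\ va x u, connect (linked e x) v u, q u & vl x u = k])
  (k \in labels_if x v q).
Proof.
rewrite mem_undup; apply: (iffP mapP) => [[u]|[u [h1 h2 h3 h4]]].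
  by rewrite mem_enum inE => /and3P[h1 h2 h3 ->]; exists u.
by exists u => //; rewrite mem_enum inE h1 h2.
Qed.

Record selected (x : view T) (rep : pred T) (pt : T -> T) : Prop := Selected {
  sel_pt : forall u, rep u -> [/\ va x u, e u (pt u), va x (pt u) & vl x (pt u) != vl x u];
  sel_ex : forall u v, va x u -> e u v -> va x v -> vl x v != vl x u ->
    exists2 r, rep r & vl x r = vl x u;
  sel_uniq : forall r r', rep r -> rep r' -> vl x r = vl x r' -> r = r' }.

Definition pointing (x : view T) (rep : pred T) (pt : T -> T) k :=
  [set u | rep u && (vl x (pt u) == k)].

Lemma crossing x u p : path (linked e x) u p -> vl x (last u p) != vl x u ->
  exists a c, [/\ va x a, va x c, e a c, vl x a = vl x u & vl x c != vl x u].
Proof.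
elim: p u => [|w p IH] u /=; first by rewrite eqxx.
case/andP=> /and3P[hu hw huw] hp hl.
have [E|hne] := eqVneq (vl x u) (vl x w).
  by rewrite E in hl *; apply: IH.
by exists u, w; rewrite eq_sym hne; move: huw; rewrite (negbTE hne) orbF.
Qed.

(** An application of [two_thirds] to the representatives of the clusters of one component, with one
    class as [S]: the colors differ along a pointer, and the sides halve the pointers into each
    cluster. *)
Lemma class_count (x : view T) (rep : pred T) (pt : T -> T) (colr : T -> nat)
    (side : T -> bool) :
  class_of_label x -> selected x rep pt ->
  (forall u v, va x u -> va x v -> vl x u = vl x v -> colr u = colr v) ->
  (forall u, va x u -> colr u < 16) ->
  (forall r, rep r -> colr r != colr (pt r)) ->
  (forall r, rep r -> vc x r = colr r + 16 * side r) ->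
  (forall k s, 2 * #|[set u in pointing x rep pt k | side u == s]|
       <= #|pointing x rep pt k| + 1) ->
  forall v q, 1 < size (labels x v) ->
  3 * size (labels_if x v (fun u => vc x u == q)) <= 2 * size (labels x v).
Proof.
move=> hcl hsel hcol hc16 hprop hcls hbal v q hN.
pose R := linked e x.
have Rsym : connect_sym R by apply: sym_connect_sym; exact: linked_sym.
(* A path to a vertex with another label leaves the cluster of [u], which therefore has a foreign
   neighbour and a representative. *)
have rep_in u : va x u -> connect R v u ->
    exists r, [/\ rep r, vl x r = vl x u & connect R v r].
  move=> hu hvu.
  have [k hk hku] : exists2 k, k \in labels x v & k != vl x u.
    move: hN; have := undup_uniq [seq vl x u | u <-
      enum [pred u | [&& va x u, connect (linked e x) v u & predT u]]].
    rewrite -/(labels_if x v predT) -/(labels x v).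
    case: (labels x v) => [|k [|k' s]] //=; rewrite inE negb_or => /andP[/andP[h _] _] _.
    have [E|hne] := eqVneq k (vl x u); last by exists k; rewrite ?inE ?eqxx.
    by exists k'; rewrite ?inE ?eqxx ?orbT // -E eq_sym.
  have /mem_labels_if[z [hz hvz _ E]] := hk.
  have /connectP[p hp hl] : connect R u z.
    by apply: connect_trans hvz; rewrite Rsym.
  have [a [c [ha hc hac Ea hne]]] : exists a c,
     [/\ va x a, va x c, e a c, vl x a = vl x u & vl x c != vl x u].
    by apply: (crossing hp); rewrite -hl E.
  have hne' : vl x c != vl x a by rewrite Ea.
  have [r hr Er] := sel_ex hsel ha hac hc hne'.
  exists r; rewrite hr Er Ea; split=> //; apply: connect_trans hvu _; apply: connect1.
  by have [hra _ _ _] := sel_pt hsel hr; rewrite /R /linked hu hra Er Ea eqxx orbT.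
pose X := [set r | rep r && connect R v r].
pose S := [set r in X | vc x r == q].
(* A pointer to a vertex becomes a pointer to the representative of the cluster of that vertex. *)
pose f r := odflt r [pick r' in X | vl x r' == vl x (pt r)].
have ptX r : r \in X -> va x (pt r) /\ connect R v (pt r).
  rewrite inE => /andP[hr hvr]; have [h1 h2 h3 h4] := sel_pt hsel hr.
  split=> //; apply: connect_trans hvr _; apply: connect1.
  by rewrite /R /linked h1 h3 h2.
have fP r : r \in X -> f r \in X /\ vl x (f r) = vl x (pt r).
  move=> hr; rewrite /f; case: pickP => [r' /andP[h1 /eqP h2] //|h].
  have [h1 h2] := ptX r hr; have [r' [h3 h4 h5]] := rep_in _ h1 h2.
  by have := h r'; rewrite inE h3 h5 h4 eqxx.
have repX r : r \in X -> rep r by rewrite inE => /andP[].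
have vaX r : r \in X -> va x r by move/repX/(sel_pt hsel) => -[].
have f_eq r y : r \in X -> y \in X -> (f r == y) = (vl x (pt r) == vl x y).
  move=> hr hy; have [h1 h2] := fP r hr.
  apply/eqP/eqP => [<-|E]; first by rewrite h2.
  by apply: (sel_uniq hsel); rewrite ?repX // h2.
have inS r : (r \in S) = (r \in X) && (vc x r == q) by rewrite in_set.
have main : 3 * #|S| <= 2 * #|X|.
  apply: (@two_thirds _ X S f); first by apply/subsetP => r; rewrite inE => /andP[].
  - by move=> r /fP[].
  - move=> r; rewrite inE => /andP[hr /eqP hq]; rewrite inE negb_and.
    have [h1 h2] := fP r hr; have [h3 _] := ptX r hr.
    rewrite h1 /=; apply/eqP => hq'.
    have := hprop r (repX r hr).
    rewrite -(hcol _ _ (vaX _ h1) h3 h2).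
    have := hc16 _ (vaX _ h1); have := hc16 _ (vaX _ hr).
    move: hq hq'; rewrite !hcls ?repX //.
    by case: (side r); case: (side (f r)) => /=; lia.
  - move=> y hy.
    have E1 : [set r in X | f r == y] = pointing x rep pt (vl x y).
      apply/setP => r; rewrite !inE.
      apply/andP/andP => -[h1 h2].
        have hr : r \in X by rewrite inE.
        by rewrite f_eq // in h2; case/andP: h1.
      have hyv : connect R v y by move: hy; rewrite inE => /andP[].
      have [h3 h4 h5 h6] := sel_pt hsel h1.
      have hr : r \in X.
        rewrite inE h1; apply: connect_trans hyv _; rewrite Rsym.
        apply: (@connect_trans _ _ (pt r)); apply: connect1; rewrite /R /linked ?h3 ?h5 ?h4 //.
        by rewrite vaX // h2 orbT.
      by rewrite f_eq // h2; move: hr; rewrite inE.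
    (* The side can be read off the class, since colors are below 16. *)
    pose s := 15 < q.
    have := hbal (vl x y) s; rewrite E1; apply: leq_trans.
    rewrite leq_mul2l /=; apply: subset_leq_card.
    apply/subsetP => r; rewrite in_set => /andP[]; rewrite inS => /andP[hr /eqP hq] hf.
    have hp : r \in pointing x rep pt (vl x y) by rewrite -E1 in_set hr.
    rewrite in_set hp /=; have := hcls r (repX r hr); have := hc16 r (vaX r hr).
    by rewrite hq /s; case: (side r) => /= h1 h2; case: ltnP => //; lia.
have leS : size (labels_if x v (fun u => vc x u == q)) <= #|S|.
  rewrite cardE -(size_map (vl x)); apply: uniq_leq_size; first exact: undup_uniq.
  move=> k /mem_labels_if[u [hu hvu hq <-]].
  have [r [h1 h2 h3]] := rep_in u hu hvu.
  rewrite -h2; apply: map_f; rewrite mem_enum !inE h1 h3 /=.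
  by rewrite (hcl r u) //; have [] := sel_pt hsel h1.
have leX : #|X| <= size (labels x v).
  rewrite cardE -(size_map (vl x)); apply: uniq_leq_size.
    rewrite map_inj_in_uniq ?enum_uniq // => r r'; rewrite !mem_enum => hr hr' E.
    by apply: (sel_uniq hsel); rewrite ?repX.
  move=> k /mapP[r]; rewrite mem_enum => hr ->; apply/mem_labels_if; exists r.
  by split=> //; [exact: vaX | move: hr; rewrite inE => /andP[]].
lia.
Qed.

(** Adjacent living vertices agree on all five bits, hence on the class, and vertices with equal
    labels always do. A component of [y] thus stays within one class and, tracing labels to their
    origin, within one component of [x]. *)
Lemma refines_connect x y v u : class_of_label x -> refines e x 5 y ->
  (forall v, vc y v < 32) -> connect (linked e y) v u ->
  connect (linked e x) v u /\ (va y v -> vc y v = vc y u).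
Proof.
move=> hcl hr h32 /connectP[p hp ->] {u}.
elim: p v hp => [|w p IH] v /=; first by move=> _; rewrite connect0.
case/andP=> /and3P[hv hw hvw] /IH[h1 h2].
have Rsym : connect_sym (linked e x) by apply: sym_connect_sym; exact: linked_sym.
suff [h3 h4] : connect (linked e x) v w /\ vc y v = vc y w.
  by split; [apply: connect_trans h3 h1 | rewrite h4 => _; exact: h2].
case/orP: hvw => [hvw|/eqP E].
  split; first by apply: connect1; rewrite /linked !(ref_alive hr) ?hvw.
  apply: (@eq_of_bits 5); rewrite ?h32 // => j hj; exact: (ref_bits hr).
split; last exact: (refines_class hcl hr).
have [a [a1 a2 _ a3]] := ref_origin hr hv; have [c [c1 c2 _ c3]] := ref_origin hr hw.
apply: connect_trans a3 _; rewrite Rsym; apply: connect_trans c3 _; apply: connect1.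
by rewrite /linked a1 c1 a2 c2 E eqxx orbT.
Qed.

Lemma labels_refine x y v : class_of_label x -> refines e x 5 y ->
  (forall v, vc y v < 32) ->
  {subset labels y v <= labels_if x v (fun u => vc x u == vc y v)}.
Proof.
move=> hcl hr h32 k /mem_labels_if[u [hu hvu _ <-]].
have [h1 h2] := refines_connect hcl hr h32 hvu.
have [a [a1 a2 a3 a4]] := ref_origin hr hu.
apply/mem_labels_if; exists a; split=> //; first exact: connect_trans h1 a4.
rewrite a3 h2 //.
by case/connectP: hvu => -[|w p] /=; [move=> _ <- | move=> /andP[/and3P[]]].
Qed.

End Classes.

(** * Invariants of a growth step *)

Section Structure.
Variables (T : finType) (e : rel T) (id : T -> nat) (b : nat).
Hypothesis e_sym : symmetric e.
Hypothesis id_inj : injective id.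
Hypothesis id_lt : forall v, id v < 2 ^ b.
Notation n := #|T|.
Notation N := (nbrs e id).
Notation cfg := (cfg T).
Notation basic := (basic e id b).
Notation triple := (triple e id b).
Notation ready_op := (ready_op e id b).

Definition view_of (s : cfg) : view T :=
  View (fun v => alive (pb (s v))) (fun v => lab (pb (s v))) (fun v => cls (pb (s v))).

Definition same_trees (s s' : cfg) := forall v, trees s' v = trees s v.

Definition pub_ok (s : cfg) : Prop := forall v, let p := pb (s v) in
  [/\ me p = id v, lab p < 2 ^ b, cls p < 32, col p < 2 ^ (b + 3) &
      alive p -> lab p \in keys (trees s v)].

Lemma basic_pub_ok a s : basic a s -> pub_ok s.
Proof. by case=> h1 h2 _ _ _ h3 h4 h5 v; split; auto. Qed.

Lemma basic_same a s s' : basic a s -> same_trees s s' -> pub_ok s' -> basic a s'.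
Proof.
case=> h1 h2 h3 h4 h5 h6 h7 h8 ht hp; split; try by move=> v; case: (hp v).
- by move=> v; rewrite ht.
- case: h4 => d hd; exists d => v k; rewrite ht => /hd[hk].
  case: lookup => [[i|]|] // [u [u1 u2 u3 u4]]; split=> //.
  by exists u; rewrite ht.
- by move=> v q; rewrite ht; apply: h5.
Qed.

Definition grown (s s' : cfg) := forall v, trees s' v = trees s v \/
  exists u k, [/\ e v u, k \in keys (trees s u), k \notin keys (trees s v) &
    trees s' v = (k, Some (id u)) :: trees s v].

Lemma lookup_cons q (t : seq entry) k :
  lookup (q :: t) k = if q.1 == k then Some q.2 else lookup t k.
Proof. by rewrite /lookup /=; case: ifP. Qed.

(** Old entries keep their depth and new ones get depth [a.+1]; the parent of a new entry had the
    tree before the step. *)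
Lemma basic_grown a s s' : basic a s -> grown s s' -> pub_ok s' -> basic a.+1 s'.
Proof.
case=> h1 h2 h3 h4 h5 h6 h7 h8 ht hp; split; try by move=> v; case: (hp v).
- move=> v; case: (ht v) => [->//|[u [k [_ _ hk ->]]]].
  by rewrite /= hk h3.
- have sub v k : k \in keys (trees s v) -> k \in keys (trees s' v).
    by case: (ht v) => [->//|[u [k' [_ _ _ ->]]]]; rewrite inE orbC => ->.
  case: h4 => d hd.
  exists (fun k v => if k \in keys (trees s v) then d k v else a.+1) => v k hk.
  have old : k \in keys (trees s v) -> lookup (trees s' v) k = lookup (trees s v) k.
    case: (ht v) => [->//|[u [k' [_ _ hk' ->]]]]; rewrite lookup_cons /=.
    by case: eqP => // <-; rewrite (negbTE hk').
  case: ifP => hin.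
    have [h h'] := hd v k hin; split; first exact: leqW.
    rewrite old //; case: lookup h' => [[i|]|] // [u [u1 u2 u3 u4]].
    by exists u; rewrite u3 u1 u2 sub.
  split=> //; move: hk; case: (ht v) => [->|[u [k' [u1 u2 u3 E]]]]; first by rewrite hin.
  rewrite E inE /= lookup_cons [k \in map _ _]hin orbF => /eqP -> /=; rewrite eqxx.
  exists u; rewrite u2 u1 sub //; split=> //.
  by have [] := hd u k' u2.
- move=> v q; case: (ht v) => [->|[u [k [_ hk _ ->]]]]; first exact: h5.
  rewrite inE => /orP[/eqP-> /=|]; last exact: h5.
  by case/mapP: hk => q' /h5[h _] ->.
Qed.

Definition choice (q : T -> pred pub) (s : cfg) (v : T) : option T :=
  ohead [seq u <- N v | q v (pb (s u))].

Lemma seek_choice (q : T -> pred pub) (s : cfg) v :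
  seek (q v) [seq pb (s u) | u <- N v] = omap (fun u => pb (s u)) (choice q s v).
Proof. by rewrite /seek /choice filter_map; case: filter. Qed.

Lemma choice_Some (q : T -> pred pub) (s : cfg) v u : choice q s v = Some u -> e v u /\ q v (pb (s u)).
Proof.
rewrite /choice => h.
have : u \in [seq u <- N v | q v (pb (s u))].
  by case: filter h => //= a l [->]; rewrite inE eqxx.
by rewrite mem_filter mem_nbrs => /andP[].
Qed.

Lemma choice_ex (q : T -> pred pub) (s : cfg) v u : e v u -> q v (pb (s u)) -> choice q s v != None.
Proof.
move=> h1 h2; have : u \in [seq u <- N v | q v (pb (s u))].
  by rewrite mem_filter mem_nbrs h1 h2.
by rewrite /choice; case: filter.
Qed.

Section Aim.
Variables (a : nat) (s s' : cfg) (pt : T -> option T).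
Hypothesis bas : basic a s.
Hypothesis pt_edge : forall v u, pt v = Some u -> e v u /\ alive (pb (s u)).
Hypothesis s'_def : forall v, s' v = aim (s v) (omap (fun u => pb (s u)) (pt v)).

Lemma aim_fields v :
  [/\ me (pb (s' v)) = me (pb (s v)), alive (pb (s' v)) = alive (pb (s v)),
      lab (pb (s' v)) = lab (pb (s v)), cls (pb (s' v)) = cls (pb (s v)) &
      col (pb (s' v)) = col (pb (s v))] /\
  [/\ tgt (s' v) = omap (fun u => (lab (pb (s u)), cls (pb (s u)))) (pt v),
      cval (s' v) = cval (s v), outp (s' v) = outp (s v) & hist (s' v) = hist (s v)].
Proof.
rewrite s'_def; case: (pt v) => [u|] //=.
by split=> //; rewrite /add_entry; case: ifP.
Qed.

Lemma aim_trees v : trees s' v =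
  if pt v is Some u then
    if lab (pb (s u)) \in keys (trees s v) then trees s v
    else (lab (pb (s u)), Some (id u)) :: trees s v
  else trees s v.
Proof.
rewrite /trees s'_def; case: (pt v) => [u|] //=; rewrite /add_entry.
by case: ifP => // _ /=; rewrite (basic_me bas).
Qed.

Lemma aim_grown : grown s s'.
Proof.
move=> v; rewrite aim_trees; case hp: (pt v) => [u|]; last by left.
have [h1 h2] := pt_edge hp.
case: ifP => h; first by left.
by right; exists u, (lab (pb (s u))); rewrite h1 h (basic_lab bas).
Qed.

Lemma aim_keys v u : pt v = Some u -> lab (pb (s u)) \in keys (trees s' v).
Proof. by move=> hp; rewrite aim_trees hp; case: ifP => //=; rewrite inE eqxx. Qed.

Lemma aim_basic : basic a.+1 s'.
Proof.
apply: basic_grown bas aim_grown _ => v /=.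
have [[-> h1 -> -> ->] _] := aim_fields v.
have [-> h2 h3 h4 h5] := basic_pub_ok bas v; split=> //.
rewrite h1 => /h5; rewrite aim_trees; case: (pt v) => // u; case: ifP => // _.
by rewrite inE orbC => ->.
Qed.

Lemma aim_size v : size (trees s' v) <= size (trees s v) + (pt v != None).
Proof.
rewrite aim_trees; case: (pt v) => [u|]; last by rewrite addn0.
by case: ifP => _; rewrite /= ?addn1.
Qed.

End Aim.

(** The outputs [O] and the tree entries [H] of earlier colors are frozen while a color is built. *)
Definition keeps (O : T -> option (nat * nat)) (H : T -> seq entry) (s : cfg) :=
  forall v, [/\ outp (s v) = O v, hist (s v) = H v & alive (pb (s v)) -> O v = None].

Lemma hits_eq c k : hits c k = (omap fst (tgt c) == Some k).
Proof. by rewrite /hits; case: (tgt c) => [[k' q]|]. Qed.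

Lemma sum_bool (P : pred T) : \sum_u P u = #|[set u | P u]|.
Proof.
rewrite -sum1_card [RHS]big_mkcond; apply: eq_bigr => u _.
by rewrite inE; case: (P u).
Qed.

Lemma sum_props s pr k :
  (forall v, tgt (s v) = omap (fun u => (lab (pb (s u)), cls (pb (s u)))) (pr v)) ->
  \sum_u own_props n (s u) k = members (view_of s) k + n.+1 * props (view_of s) pr k.
Proof.
move=> h; rewrite /own_props big_split -big_distrr /=; congr addn.
  by rewrite sum_bool.
congr muln; rewrite sum_bool; apply: eq_card => v; rewrite !inE /hits h.
by case: (pr v).
Qed.

Lemma card_pow_le : n <= 2 ^ b. Proof. exact: card_le id_inj id_lt. Qed.

Lemma sum_props_lt m p : m <= n -> p <= n -> m + n.+1 * p < 2 ^ word b.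
Proof.
move=> hm hp; have h := card_pow_le; have h0 : 0 < 2 ^ b by rewrite expn_gt0.
rewrite /word expnD (_ : 4 * b = b + b + (b + b)); last by lia.
rewrite !expnD (_ : 2 ^ 6 = 64) //.
move: h0 h; move: (2 ^ b) => q; move: (n) hm hp => c hm hp h0 h.
have h1 : c.+1 * p <= c.+1 * c by rewrite leq_mul2l hp orbT.
have h2 : c.+1 * c <= q.+1 * q by apply: leq_mul.
have h3 : q * q * 1 <= q * q * (q * q) by rewrite leq_mul2l muln_gt0 h0 orbT.
nia.
Qed.

Section RgStep.
Variables (O : T -> option (nat * nat)) (H : T -> seq entry) (x0 : view T).
Variables (m i S : nat).
Notation P := (n_sub n).
Hypothesis x0_class : class_of_label x0.
Hypothesis m_le : m < max_ents n.

(** In the third clause, a living red vertex reserves room for one entry. It spends it when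
    proposing and then turns blue or dies, so at most one entry is added in a subphase of many
    steps. *)
Definition rg_inv (a t : nat) (s : cfg) : Prop :=
  [/\ basic (a + t) s, keeps O H s,
      forall v, size (trees s v) + (alive (pb (s v)) && ~~ bitn i (cls (pb (s v)))) <= m.+1,
      refines e x0 i (view_of s) & growing e i P S t (view_of s)].

Definition proposal (s : cfg) (v : T) : option T :=
  if alive (pb (s v)) && ~~ bitn i (cls (pb (s v)))
  then choice (fun _ p => alive p && bitn i (cls p)) s v else None.

Lemma propose_aim s s' : exec e id (Loc (propose i)) s s' ->
  forall v, s' v = aim (s v) (omap (fun u => pb (s u)) (proposal s v)).
Proof.
move=> h v; rewrite h /propose /proposal; case: ifP => // _.
by rewrite (seek_choice (fun _ p => alive p && bitn i (cls p))).
Qed.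

Lemma proposal_Some s v u : proposal s v = Some u ->
  [/\ alive (pb (s v)), ~~ bitn i (cls (pb (s v))), e v u, alive (pb (s u)) &
      bitn i (cls (pb (s u)))].
Proof.
by rewrite /proposal; case: ifP => // /andP[h1 h2] /choice_Some[h3 /andP[h4 h5]].
Qed.

Lemma rg_step_triple a t : a + t < max_depth n ->
  triple (rg_inv a t) (rg_step n P (word b) i) (rg_inv a t.+1).
Proof.
move=> hD.
refine (triple_cons
  (fun s1 => exists s, rg_inv a t s /\ exec e id (Loc (propose i)) s s1) _ _).
  apply: triple_op => // [s [hb _ hs _ _]|s s1 h1 h2]; last by exists s.
  split=> //; apply: (basic_fits id_inj id_lt hb (m := m.+1)) => // v.
  by apply: leq_trans (hs v); apply: leq_addr.
have hsize s s1 : rg_inv a t s -> exec e id (Loc (propose i)) s s1 -> 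
    forall v, size (trees s1 v) <= m.+1.
  move=> [hb _ hs _ _] hex v.
  have := aim_size hb (propose_aim hex) v; have := hs v.
  rewrite /proposal; case: (alive _ && _); last by rewrite /=; lia.
  by case: (choice _ _ _ != None); lia.
apply: triple_op => // [s1 [s [hI hex]]|s1 s2 [s [hI hex]] hex2].
  have [hb _ hs _ _] := hI; have ha := propose_aim hex.
  have pe v u (hp : proposal s v = Some u) := let: And5 _ _ p3 p4 _ := proposal_Some hp in conj p3 p4.
  have hb1 := aim_basic hb pe ha.
  split; first exact: (basic_fits id_inj id_lt hb1 (hsize _ _ hI hex)).
  have htgt v : tgt (s1 v) = omap (fun u => (lab (pb (s1 u)), cls (pb (s1 u)))) (proposal s v).
    have [_ [-> _ _ _]] := aim_fields ha v; case: (proposal s v) => //= u.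
    by have [[_ _ -> -> _] _] := aim_fields ha u.
  split; first exact: basic_me hb1.
  - have [d hd] := basic_wf hb1; exists d => v k /hd[h1 h2]; split=> //.
    by apply: leq_trans h1 _.
  - move=> v k; rewrite /own_props /member.
    case: (boolP (_ && _)) => [/andP[hv /eqP <-] _|_]; first exact: basic_lab hb1 _ hv.
    rewrite /hits htgt; case hp: (proposal s v) => [u|] /=; last by rewrite muln0.
    case: eqP => [<- _|]; last by rewrite muln0.
    have [[_ _ -> _ _] _] := aim_fields ha u; exact: (aim_keys hb ha hp).
  - move=> k; rewrite (sum_props _ htgt).
    by apply: sum_props_lt; exact: max_card.
have [hb hk hs hr hg] := hI; have ha := propose_aim hex.
have pe v u (hp : proposal s v = Some u) := let: And5 _ _ p3 p4 _ := proposal_Some hp in conj p3 p4.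
have hb1 := aim_basic hb pe ha.
case: hex2 => off [tot [[htot _] hs2]].
pose x := view_of s; pose pr := proposal s.
have htgt v : tgt (s1 v) = omap (fun u => (lab (pb (s1 u)), cls (pb (s1 u)))) (proposal s v).
  have [_ [-> _ _ _]] := aim_fields ha v; case: (proposal s v) => //= u.
  by have [[_ _ -> -> _] _] := aim_fields ha u.
have hmem k : members (view_of s1) k = members x k.
  by apply: eq_card => u; rewrite !inE /=; have [[_ -> -> _ _] _] := aim_fields ha u.
have hprops k : props (view_of s1) pr k = props x pr k.
  apply: eq_card => v; rewrite !inE; case: (pr v) => //= u.
  by have [[_ _ -> _ _] _] := aim_fields ha u.
have htotE v k : k \in keys (trees s1 v) -> tot v k = members x k + n.+1 * props x pr k.
  by move=> hk'; rewrite htot // (sum_props _ htgt) hmem hprops.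
(* At most [n] members, so the two digits in base [n.+1] do not interfere. *)
have modE v k : k \in keys (trees s1 v) -> 
   (tot v k %% n.+1 = members x k) /\ (tot v k %/ n.+1 = props x pr k).
  move=> hk'; rewrite htotE // addnC mulnC modnMDl divnMDl //.
  have hm : members x k < n.+1 by rewrite ltnS; exact: max_card.
  by rewrite modn_small // divn_small // addn0.
pose acc k := members x k <= 2 * P * props x pr k.
have s2E v : s2 v =
  if pr v is Some u then
    let p := pb (s1 v) in let k := lab (pb (s u)) in
    set_tgt (set_pub (s1 v) (Pub (me p) (acc k) (if acc k then k else lab p)
      (if acc k then cls (pb (s u)) else cls p) (col p) (ents p))) None
  else s1 v.
  rewrite hs2 /settle; have [_ [-> _ _ _]] := aim_fields ha v.
  rewrite -/(pr v); case hp: (pr v) => [u|] //=.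
  by have [-> ->] := modE v _ (aim_keys hb ha hp).
have htr : same_trees s1 s2 by move=> v; rewrite /trees s2E; case: (pr v).
have hview v : (va (view_of s2) v, vl (view_of s2) v, vc (view_of s2) v) =
    if pr v is Some u then
      if acc (vl x u) then (true, vl x u, vc x u) else (false, vl x v, vc x v)
    else (va x v, vl x v, vc x v).
  have [[_ e1 e2 e3 _] _] := aim_fields ha v.
  rewrite /= s2E; case: (pr v) => [u|] /=; last by rewrite e1 e2 e3.
  by case: (acc _); rewrite ?e2 ?e3.
have hrel : rg_rel e i P x (view_of s2).
  exists pr; split=> //; first by move=> v u /proposal_Some.
  move=> v u /= h1 h2 h3 h4 h5; rewrite /pr /proposal h1 h2 /=.
  by apply: (@choice_ex (fun _ p => alive p && bitn i (cls p)) s v u); rewrite ?h4 ?h5.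
have [hr2 hg2] := rg_step_inv x0_class hr hg hrel.
split=> //.
- rewrite addnS; apply: (basic_same hb1 htr) => v /=; rewrite htr.
  have [h1 h2 h3 h4 h5] := basic_pub_ok hb1 v; rewrite s2E.
  case hp: (pr v) => [u|] //=; split=> //.
  + by case: (acc _) => //; exact: basic_lab_lt hb u.
  + by case: (acc _) => //; exact: basic_cls hb u.
  + by case: (acc _) => // _; exact: (aim_keys hb ha hp).
- move=> v; have [h1 h2 h3] := hk v.
  have [[_ e1 _ _ _] [_ _ e2 e3]] := aim_fields ha v.
  rewrite s2E; case hp: (pr v) => [u|] /=; rewrite ?e2 ?e3 ?e1; split=> // _.
  by have [h _ _ _ _] := proposal_Some hp; apply: h3.
- move=> v; have := hsize _ _ hI hex v; have := hs v; rewrite htr => h1 h2.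
  have /= := hview v; case hp: (pr v) => [u|].
    case: (acc _) => -[-> _ ->] //=; rewrite ?addn0 //.
    by have [_ _ _ _ ->] := proposal_Some hp; rewrite addn0.
  case=> -> _ ->; rewrite (aim_trees hb ha) -/(pr v) hp; exact: h1.
Qed.

End RgStep.
End Structure.

(** * Classifying and separating clusters *)

Lemma sum_at_zero m : \sum_(0 <= i < m) (i == 0) = (0 < m).
Proof.
case: m => [|m]; first by rewrite big_nil.
by rewrite big_nat_recl // big1_seq // => i _.
Qed.

Lemma sum_parity s m : 2 * \sum_(0 <= i < m) (odd i == s) <= m + 1.
Proof.
(* The exact count depends on the parities of [s] and [m]; this stronger form is inductive. *)
suff : 2 * \sum_(0 <= i < m) (odd i == s) + (s && odd m) <= m + (~~ s && odd m).
  by case: s; case: (odd m) => /=; lia.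
elim: m => [|m IH]; first by rewrite big_nil andbF.
rewrite big_nat_recr //= mulnDr; move: IH.
by case: s; case: (odd m) => /=; lia.
Qed.

Section Phase.
Variables (T : finType) (e : rel T) (id : T -> nat) (b : nat).
Hypothesis e_sym : symmetric e.
Hypothesis id_inj : injective id.
Hypothesis id_lt : forall v, id v < 2 ^ b.
Notation n := #|T|.
Notation N := (nbrs e id).
Notation cfg := (cfg T).
Notation basic := (basic e id b).
Notation triple := (triple e id b).
Notation ready_op := (ready_op e id b).
Notation P := (n_sub n).
Variables (O : T -> option (nat * nat)) (H : T -> seq entry).
Let S := #|[set v | O v == None]|.

(** Parameters: [a] for tree depth, [m] for entries per vertex, [J] for subphases done. The budget
    says that each subphase kills at most [S / (2 * P)] vertices. *)
Record colored (a m J : nat) (s : cfg) : Prop := Colored {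
  co_basic : basic a s;
  co_keeps : keeps O H s;
  co_sized : sized m s;
  co_budget : 2 * P * S <= 2 * P * #|living (view_of s)| + J * S }.

Lemma living_le a m J s : colored a m J s -> #|living (view_of s)| <= S.
Proof.
move=> h; apply: subset_leq_card; apply/subsetP => v; rewrite !inE => /= hv.
by have [_ _ ->] := co_keeps h v.
Qed.

Definition separating (x0 : view T) (a m i J : nat) (s : cfg) : Prop :=
  colored a m J s /\ refines e x0 i (view_of s).

Lemma card_lt_log : n < 2 ^ log_n n.
Proof. exact: trunc_log_ltn. Qed.

Lemma n_sub_gt0 : 0 < P. Proof. by rewrite /n_sub muln_gt0. Qed.

Lemma sub_triple x0 a m i J : class_of_label x0 ->
  m < max_ents n -> a + n_step n <= max_depth n ->
  triple (separating x0 a m i J)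
    (repeat_ops (n_step n) (rg_step n P (word b) i))
    (separating x0 (a + n_step n) m.+1 i.+1 J.+1).
Proof.
move=> hx0 hm ha.
(* The number of living vertices at the start is named, because the growth invariant refers to it in
   all later steps. *)
apply: (@triple_weaken _ _ _ _ _
  (fun s => exists S', [/\ separating x0 a m i J s & #|living (view_of s)| = S'])
  _ _ _ _ (fun _ h => h)).
  by move=> s h; exists #|living (view_of s)|.
apply: triple_exists => S'.
have := @triple_repeat _ e id b
  (fun t s => rg_inv e id b O H x0 m i S' a t s /\ (S' <= S /\ 2 * P * S <= 2 * P * S' + J * S))
  (rg_step n P (word b) i) (n_step n).
have step t : t < n_step n ->
  triple (fun s => rg_inv e id b O H x0 m i S' a t s /\ (S' <= S /\ 2 * P * S <= 2 * P * S' + J * S))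
    (rg_step n P (word b) i)
    (fun s => rg_inv e id b O H x0 m i S' a t.+1 s /\ (S' <= S /\ 2 * P * S <= 2 * P * S' + J * S)).
  move=> ht x [h1 h2]; split=> //; move: x h1.
  by apply: rg_step_triple => //; lia.
move/(_ step); apply: triple_weaken.
  move=> s [[hc hr] <-]; have hl := living_le hc.
  split; last by split=> //; have := co_budget hc.
  split; [by rewrite addn0; exact: co_basic hc | exact: co_keeps hc | | by [] | exact: growing_start].
  by move=> v; have := co_sized hc v; case: (_ && _); lia.
move=> s [[hb hk hs hr hg] [h1 h2]].
have [hr' hS] := growing_end e_sym n_sub_gt0 card_lt_log hx0 hr hg.
split=> //; split=> //; first by move=> v; apply: leq_trans (hs v); exact: leq_addr.
have hl : #|living (view_of s)| <= S.
  apply: subset_leq_card; apply/subsetP => v; rewrite !inE => /= hv.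
  by have [_ _ ->] := hk v.
by rewrite mulSn; lia.
Qed.

Lemma separate_triple x0 a m i J k : class_of_label x0 ->
  m + k <= max_ents n -> a + k * n_step n <= max_depth n ->
  triple (separating x0 a m i J) (separate_ops n b i k)
    (separating x0 (a + k * n_step n) (m + k) (i + k) (J + k)).
Proof.
move=> hx0; elim: k a m i J => [|k IH] a m i J hm ha.
  by rewrite mul0n !addn0; exact: triple_nil.
rewrite mulSn in ha *; rewrite separate_opsS.
refine (triple_cat (separating x0 (a + n_step n) m.+1 i.+1 J.+1) _ _).
  by apply: sub_triple => //; lia.
have h1 : m.+1 + k <= max_ents n by lia.
have h2 : a + n_step n + k * n_step n <= max_depth n by lia.
by rewrite -(addSnnS m k) -(addSnnS i k) -(addSnnS J k) (addnA a); exact: (IH _ _ _ _ h1 h2).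
Qed.

(** * Pointers between clusters and the choice of classes *)

Section Classify.
Variables (A : T -> bool) (l : T -> nat).

Definition foreign_edge v := [exists u, [&& e v u, A u & l u != l v]].

(** Classification moves no vertex: living vertices and labels are the fixed [A] and [l]. *)
Record calm (a m J : nat) (s : cfg) : Prop := Calm {
  ca_colored : colored a m J s;
  ca_alive : forall v, alive (pb (s v)) = A v;
  ca_lab : forall v, lab (pb (s v)) = l v }.

Lemma calm_fits a m J s : calm a m J s -> m <= max_ents n ->
  forall v, fits (word b) (max_ents n) (pb (s v)).
Proof.
case=> [[hb _ hs _] _ _] hm; exact: (basic_fits id_inj id_lt hb hs hm).
Qed.

Lemma calm_update a m J s s' : calm a m J s ->
  (forall v, [/\ me (pb (s' v)) = me (pb (s v)),
     alive (pb (s' v)) = alive (pb (s v)), lab (pb (s' v)) = lab (pb (s v)),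
     trees s' v = trees s v & outp (s' v) = outp (s v) /\ hist (s' v) = hist (s v)]) ->
  (forall v, cls (pb (s' v)) < 32 /\ col (pb (s' v)) < 2 ^ (b + 3)) ->
  calm a m J s'.
Proof.
case=> [[hb hk hs hj] hA hl] h1 h2; split.
- split.
  + apply: (basic_same hb) => [v|v /=]; have [e1 e2 e3 e4 _] := h1 v; first by [].
    have [f1 f2 _ _ f5] := basic_pub_ok hb v.
    by have [h3 h4] := h2 v; rewrite e1 e2 e3 e4.
  + move=> v; have [_ -> _ _ [-> ->]] := h1 v; exact: hk.
  + by move=> v; have [_ _ _ -> _] := h1 v; exact: hs.
  + rewrite (_ : living (view_of s') = living (view_of s)) //.
    by apply/setP => v; rewrite !inE /=; have [_ -> _ _ _] := h1 v.
- by move=> v; have [_ -> _ _ _] := h1 v.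
- by move=> v; have [_ _ -> _ _] := h1 v.
Qed.

Lemma calm_member a m J s v k : calm a m J s -> member (s v) k = A v && (l v == k).
Proof. by move=> h; rewrite /member (ca_alive h) (ca_lab h). Qed.

Lemma calm_keys a m J s v k : calm a m J s -> A v -> l v = k -> k \in keys (trees s v).
Proof.
by move=> h hv <-; rewrite -(ca_lab h); apply: basic_lab (co_basic (ca_colored h)) _ _; rewrite (ca_alive h).
Qed.

Lemma calm_ready a m J s om own f : calm a m J s -> m <= max_ents n ->
  a <= max_depth n -> (forall v k, 0 < own (s v) k -> k \in keys (trees s v)) ->
  (forall k, \sum_u own (s u) k < 2 ^ om) -> ready_op (Agg om own f) s.
Proof.
move=> h hm ha h1 h2; split; first exact: calm_fits h hm.
split=> //; first exact: basic_me (co_basic (ca_colored h)).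
have [d hd] := basic_wf (co_basic (ca_colored h)); exists d => v k /hd[h3 h4].
by split=> //; apply: leq_trans h3 ha.
Qed.

Lemma own_val_keys a m J s v k : calm a m J s ->
  0 < own_val (s v) k -> k \in keys (trees s v).
Proof.
move=> h; rewrite /own_val (calm_member _ _ h); case: ifP => // /andP[hv /eqP E] _.
exact: calm_keys h hv E.
Qed.

Lemma calm_bounds a m J s v : calm a m J s ->
  cls (pb (s v)) < 32 /\ col (pb (s v)) < 2 ^ (b + 3).
Proof.
by move=> h; split; [exact: basic_cls (co_basic (ca_colored h)) v |
  exact: basic_col (co_basic (ca_colored h)) v].
Qed.

Section Fixed.
Variables (a m J : nat).
Hypothesis m_lt : m < max_ents n.
Hypothesis a_lt : a < max_depth n.

Definition after_mark (s : cfg) := calm a m J s /\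
  forall v, A v -> cval (s v) = foreign_edge v /\ col (pb (s v)) = l v.

Lemma mark_triple : triple (calm a m J) [:: Loc mark] after_mark.
Proof.
apply: triple_op => // [s h|s s' h hex].
  by split=> //; apply: (calm_fits h); lia.
have hf v : has (foreign (s v)) [seq pb (s u) | u <- N v] = foreign_edge v.
  rewrite has_map; apply/hasP/existsP => -[u].
    rewrite mem_nbrs /= /foreign !(ca_alive h) !(ca_lab h) => h1 /andP[h2 h3].
    by exists u; rewrite h1 h2 h3.
  by case/and3P=> h1 h2 h3; exists u; rewrite ?mem_nbrs //= /foreign !(ca_alive h) !(ca_lab h) h2.
have hl v : l v < 2 ^ (b + 3).
  rewrite -(ca_lab h); apply: leq_trans (basic_lab_lt (co_basic (ca_colored h)) v) _.
  by rewrite leq_exp2l // leq_addr.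
split.
  apply: (calm_update h) => v; rewrite /trees hex /mark; case: ifP => // _.
    by have [h1 _] := calm_bounds v h; rewrite /= (ca_lab h).
  exact: calm_bounds h.
by move=> v hv; rewrite hex /mark (ca_alive h) hv /= hf (ca_lab h).
Qed.

Definition after_elect (s : cfg) := exists rep : T -> bool, [/\ calm a m J s,
  forall v, A v -> cval (s v) = rep v /\ col (pb (s v)) = l v,
  forall v, rep v -> A v /\ foreign_edge v,
  forall v, A v -> foreign_edge v -> exists2 r, rep r & l r = l v &
  forall r r', rep r -> rep r' -> l r = l r' -> r = r'].

Lemma elect_triple : triple after_mark [:: Agg (word b) own_val elect] after_elect.
Proof.
have own_le s : after_mark s ->
    forall u k, own_val (s u) k = [&& A u, l u == k & foreign_edge u].
  move=> [h1 h2] u k; rewrite /own_val (calm_member _ _ h1).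
  by case: ifP => [/andP[hu ->]|]; [rewrite hu (h2 u hu).1 | case: (A u) => //= ->].
apply: triple_op => // [s h|s s' h [off [tot [[htot hoff] hex]]]].
  have [h1 h2] := h; apply: (calm_ready _ h1); try lia.
    by move=> v k; apply: own_val_keys h1.
  move=> k; apply: (@leq_ltn_trans n).
    rewrite -sum1_card; apply: leq_sum => u _; rewrite own_le //; exact: leq_b1.
  by apply: leq_ltn_trans (sum_props_lt id_inj id_lt (leqnn _) (leqnn _)); lia.
have [h1 h2] := h.
pose rep v := [&& A v, foreign_edge v & off v (l v) == 0].
(* The tiling tested on [i == 0]: one marked member has offset 0 if there are marked members at
   all. *)
have count k : #|[set u | rep u && (l u == k)]| = (0 < \sum_u own_val (s u) k).
  rewrite -sum_at_zero -(hoff k (fun i => i == 0)) -sum_bool.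
  apply: eq_bigr => u _; rewrite own_le // /rep.
  case: (A u) => //=; last by rewrite big_nil.
  case: (l u =P k) => [->|]; last by rewrite andbF big_nil.
  case: (foreign_edge u) => /=; last by rewrite big_nil.
  by rewrite big_nat1 addn0 andbT.
exists rep; split.
- by apply: (calm_update h1) => v; rewrite /trees hex //=; exact: calm_bounds h1.
- move=> v hv; rewrite hex /= (ca_lab h1) (h2 v hv).1 (h2 v hv).2 /rep hv.
  by split=> //; case: (foreign_edge v).
- by move=> v /and3P[].
- move=> v hv hf; have : 0 < #|[set u | rep u && (l u == l v)]|.
    rewrite count lt0b; rewrite (bigD1 v) //= own_le // hv eqxx hf; lia.
  by rewrite card_gt0 => /set0Pn[r]; rewrite inE => /andP[hr /eqP E]; exists r.
- move=> r r' hr hr' E.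
  have : #|[set u | rep u && (l u == l r)]| <= 1 by rewrite count leq_b1.
  by move/card_le1_eqP; apply; rewrite inE ?hr ?hr' ?E eqxx.
Qed.

(** A pseudoforest on clusters, carried by a partial map on vertices: [pt] is defined at one
    representative of each cluster with a foreign neighbour. *)
Definition pointers (pt : T -> option T) : Prop := [/\
  forall v u, pt v = Some u -> [/\ A v, e v u, A u & l u != l v],
  forall v, A v -> foreign_edge v -> exists r u, pt r = Some u /\ l r = l v &
  forall r u r' u', pt r = Some u -> pt r' = Some u' -> l r = l r' -> r = r'].

Definition aimed (pt : T -> option T) (s : cfg) : Prop := [/\ calm a.+1 m.+1 J s,
  forall v, omap fst (tgt (s v)) = omap l (pt v) &
  forall v u, pt v = Some u -> l u \in keys (trees s v)].

Definition after_point (s : cfg) := exists pt, [/\ pointers pt, aimed pt s &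
  forall v, A v -> col (pb (s v)) = l v].

Lemma point_triple : triple after_elect [:: Loc point] after_point.
Proof.
apply: triple_op => // [s [rep [h _ _ _ _]]|s s' [rep [h h1 h2 h3 h4]] hex].
  by split=> //; apply: (calm_fits h); lia.
pose pt v := if alive (pb (s v)) && (cval (s v) == 1)
  then choice e id (fun v => foreign (s v)) s v else None.
have hrep v : alive (pb (s v)) && (cval (s v) == 1) = rep v.
  rewrite (ca_alive h); case hv: (A v) => /=; first by rewrite (h1 v hv).1; case: (rep v).
  by apply/esym/negbTE/negP => /h2[]; rewrite hv.
have ptP v u : pt v = Some u -> [/\ rep v, A v, e v u, A u & l u != l v].
  rewrite /pt hrep; case: ifP => // hr /choice_Some[h5].
  rewrite /foreign (ca_alive h) !(ca_lab h) => /andP[h6 h7].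
  by have [h8 _] := h2 v hr.
have s'E v : s' v = aim (s v) (omap (fun u => pb (s u)) (pt v)).
  by rewrite hex /point /pt; case: ifP => // _; rewrite (seek_choice e id (fun v => foreign (s v))).
have hb := co_basic (ca_colored h).
have pe v u : pt v = Some u -> e v u /\ alive (pb (s u)).
  by case/ptP=> _ _ -> hu _; rewrite (ca_alive h).
exists pt; split; first split.
- by move=> v u /ptP[].
- move=> v hv hf; have [r hr E] := h3 v hv hf; have [hAr] := h2 r hr.
  case/existsP=> u /and3P[f1 f2 f3].
  have : pt r != None.
    rewrite /pt hrep hr; apply: (@choice_ex _ _ _ (fun v => foreign (s v)) s r u) => //.
    by rewrite /foreign (ca_alive h) f2 !(ca_lab h).
  by case hp: (pt r) => [u'|] // _; exists r, u'.
- by move=> r u r' u' /ptP[hr _ _ _ _] /ptP[hr' _ _ _ _]; apply: h4.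
- have af := aim_fields s'E; split.
  + split; first split.
    * exact: (aim_basic id_lt hb pe s'E).
    * move=> v; have [[_ -> _ _ _] [_ _ -> ->]] := af v; exact: (co_keeps (ca_colored h)).
    * move=> v; have := aim_size hb s'E v; have := co_sized (ca_colored h) v.
      by case: (_ != None); lia.
    * rewrite (_ : living (view_of s') = living (view_of s)).
        exact: co_budget (ca_colored h).
      by apply/setP => v; rewrite !inE /=; have [[_ -> _ _ _] _] := af v.
    * by move=> v; have [[_ -> _ _ _] _] := af v; exact: ca_alive h v.
    * by move=> v; have [[_ _ -> _ _] _] := af v; exact: ca_lab h v.
  + move=> v; have [_ [-> _ _ _]] := af v; case: (pt v) => //= u.
    by rewrite (ca_lab h).
  + by move=> v u hp; rewrite -(ca_lab h); exact: (aim_keys hb s'E hp).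
- by move=> v hv; have [[_ _ _ _ ->] _] := aim_fields s'E v; case: (h1 v hv).
Qed.

Section Pointers.
Variable pt : T -> option T.
Hypothesis pt_ok : pointers pt.

(** The pointing edge, read backwards, is a foreign edge of the target cluster. *)
Lemma pt_target_rep v u : pt v = Some u -> exists r w, pt r = Some w /\ l r = l u.
Proof.
case: pt_ok => h1 h2 h3 /h1[hv hvu hu hl]; apply: h2 => //.
by apply/existsP; exists v; rewrite e_sym hvu hv eq_sym.
Qed.

(** A function supported on representatives sums to the representative's value, so that aggregation
    broadcasts this value to the cluster. *)
Lemma sum_rep (F : T -> nat) r u : (forall v, pt v = None -> F v = 0) ->
  pt r = Some u -> \sum_v (if A v && (l v == l r) then F v else 0) = F r.
Proof.
case: pt_ok => h1 h2 h3 hF hr; have [hA _ _ _] := h1 _ _ hr.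
rewrite (bigD1 r) //= hA eqxx /= big1 ?addn0 // => v hv.
case: ifP => // /andP[_ /eqP E]; case hp: (pt v) => [w|]; last exact: hF.
by rewrite (h3 _ _ _ _ hp hr E) eqxx in hv.
Qed.

Lemma sum_no_rep (F : T -> nat) k : (forall v, pt v = None -> F v = 0) ->
  (forall r u, pt r = Some u -> l r <> k) ->
  \sum_v (if A v && (l v == k) then F v else 0) = 0.
Proof.
move=> hF h; rewrite big1 // => v _; case: ifP => // /andP[_ /eqP E].
by apply: hF; case hp: (pt v) => [u|] //; case: (h v u hp).
Qed.

Lemma rep_dec k : (exists r u, pt r = Some u /\ l r = k) \/
  (forall r u, pt r = Some u -> l r <> k).
Proof.
case: (boolP [exists r, (pt r != None) && (l r == k)]) => [/existsP[r]|/existsPn h].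
  by case hp: (pt r) => [u|] //= /eqP E; left; exists r, u.
by right=> r u hp E; have := h r; rewrite hp E eqxx.
Qed.

Definition hued (w : nat) (s : cfg) : Prop := [/\
  forall v, A v -> col (pb (s v)) < 2 ^ w,
  forall u v, A u -> A v -> l u = l v -> col (pb (s u)) = col (pb (s v)) &
  forall v u, pt v = Some u -> col (pb (s v)) != col (pb (s u))].

Definition after_look (i : nat) (s : cfg) := [/\ aimed pt s, hued (cv_bits b i) s &
  forall v, cval (s v) = if pt v is Some u
    then (cole_vishkin (b + 3) (col (pb (s v))) (col (pb (s u)))).+1 else 0].

Lemma aimed_target s v : aimed pt s ->
  match tgt (s v) with Some (k, _) => exists2 u, pt v = Some u & k = l u
  | None => pt v = None end.
Proof.
case=> _ h _; have := h v; case: (tgt _) => [[k q]|]; case: (pt v) => //= u [->].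
by exists u.
Qed.

Lemma look_triple i : triple (fun s => aimed pt s /\ hued (cv_bits b i) s)
  [:: Loc (look b)] (after_look i).
Proof.
apply: triple_op => // [s [[h _ _] _]|s s' [ha hh] hex].
  by split=> //; apply: (calm_fits h); lia.
have [h ht hk] := ha; have [c1 c2 c3] := hh; have [p1 _ _] := pt_ok.
have hpb v : pb (s' v) = pb (s v) by rewrite hex.
split.
- split.
  + by apply: (calm_update h) => v; rewrite /trees hex //=; exact: calm_bounds h.
  + by move=> v; rewrite hex /= ht.
  + by move=> v u; rewrite /trees hpb; exact: hk.
- by split=> [v|u v|v u]; rewrite !hpb; auto.
- move=> v; rewrite !hpb hex /=; have := aimed_target v ha.
  case: (tgt _) => [[k q]|] => [[u hp ->]|-> //].
  rewrite hp (seek_choice e id (fun _ p => alive p && (lab p == l u))).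
  have [hv huv hu _] := p1 _ _ hp.
  have : choice e id (fun _ p => alive p && (lab p == l u)) s v != None.
    by apply: (@choice_ex _ _ _ (fun _ p => alive p && (lab p == l u)) s v u) => //; rewrite (ca_alive h) hu (ca_lab h) eqxx.
  case hc: (choice _ _ _ _) => [w|] //= _; rewrite !hpb.
  have [_ /andP[]] := choice_Some hc; rewrite (ca_alive h) (ca_lab h) => hw /eqP E.
  by rewrite (c2 w u).
Qed.

Lemma own_valE s k : calm a.+1 m.+1 J s ->
  \sum_u own_val (s u) k = \sum_v (if A v && (l v == k) then cval (s v) else 0).
Proof. by move=> h; apply: eq_bigr => u _; rewrite /own_val (calm_member _ _ h). Qed.

Lemma cv_lt i v u s : hued (cv_bits b i) s -> A v -> A u -> pt v = Some u ->
  cole_vishkin (b + 3) (col (pb (s v))) (col (pb (s u))) < 2 * cv_bits b i.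
Proof.
by case=> c1 _ c3 hv hu hp; apply: cole_vishkin_lt; auto; exact: cv_bits_le.
Qed.

Lemma recolor_triple i : triple (after_look i)
  [:: Agg (cv_width b) own_val recolor]
  (fun s => aimed pt s /\ hued (cv_bits b i.+1) s).
Proof.
have [p1 _ _] := pt_ok.
have val0 s : after_look i s -> forall v, pt v = None -> cval (s v) = 0.
  by case=> _ _ h v hp; rewrite h hp.
apply: triple_op => // [s h|s s' h [off [tot [[htot _] hex]]]].
  have [[h1 _ _] hh hc] := h; apply: (calm_ready _ h1); try lia.
    by move=> v k; apply: own_val_keys h1.
  move=> k; rewrite own_valE //.
  have pow : 2 * (b + 3) < 2 ^ cv_width b.
    rewrite /cv_width (_ : _ + 5 = (trunc_log 2 b).+1 + 4) 1?expnD; last by lia.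
    by have := trunc_log_ltn b (isT : 1 < 2); rewrite (_ : 2 ^ 4 = 16) //; lia.
  case: (rep_dec k) => [[r [u [hp <-]]]|hn]; last first.
    by rewrite sum_no_rep ?expn_gt0 //; exact: val0.
  rewrite (sum_rep (val0 s h) hp) hc hp.
  have [hA _ hu _] := p1 _ _ hp.
  have := cv_lt hh hA hu hp; have := cv_bits_le b i; lia.
have [ha hh hc] := h; have [h1 ht hk] := ha; have [c1 c2 c3] := hh.
have totE v : A v -> tot v (l v) = \sum_w (if A w && (l w == l v) then cval (s w) else 0).
  by move=> hv; rewrite htot ?own_valE //; exact: calm_keys h1 hv _.
have totR v r u : A v -> pt r = Some u -> l r = l v ->
    tot v (l v) = (cole_vishkin (b + 3) (col (pb (s r))) (col (pb (s u)))).+1.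
  by move=> hv hp E; rewrite totE // -E (sum_rep (val0 s h) hp) hc hp.
have tot0 v : A v -> (forall r u, pt r = Some u -> l r <> l v) -> tot v (l v) = 0.
  by move=> hv hn; rewrite totE // sum_no_rep //; exact: val0.
have colE v : A v -> col (pb (s' v)) = (tot v (l v)).-1.
  by move=> hv; rewrite hex /recolor (ca_alive h1) hv /= (ca_lab h1).
have hlt v : A v -> (tot v (l v)).-1 < 2 ^ cv_bits b i.+1.
  move=> hv; case: (rep_dec (l v)) => [[r [u [hp E]]]|hn]; last first.
    by rewrite tot0 // expn_gt0.
  have [hA _ hu _] := p1 _ _ hp.
  rewrite (totR v r u) //=; apply: ltn_trans (cv_lt hh hA hu hp) _.
  exact: lt_trunc_log.
split.
- split.
  + apply: (calm_update h1) => v.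
      by rewrite /trees hex /recolor; case: ifP.
    have [b1 b2] := calm_bounds v h1; case hv: (A v).
      split; first by rewrite hex /recolor; case: ifP.
      rewrite colE //; apply: leq_trans (hlt v hv) _.
      by rewrite leq_exp2l // cv_bits_le.
    by rewrite hex /recolor (ca_alive h1) hv.
  + by move=> v; rewrite -ht hex /recolor; case: ifP.
  + by move=> v u /hk; rewrite /trees hex /recolor; case: ifP.
- split.
  + by move=> v hv; rewrite colE //; exact: hlt.
  + by move=> u v hu hv E; rewrite !colE // !totE // E.
  + move=> v u hp; have [hv _ hu _] := p1 _ _ hp.
    (* The target cluster has a representative [r] of the same color as [u], so three successive
       colors along pointers feed [cole_vishkin_proper]. *)
    have [r [w [hr E]]] := pt_target_rep hp; have [hAr _ hw _] := p1 _ _ hr.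
    rewrite !colE // (totR v v u) // (totR u r w) //= -(c2 r u) //.
    have lt x : A x -> col (pb (s x)) < 2 ^ (b + 3).
      by move=> hx; apply: leq_trans (c1 x hx) _; rewrite leq_exp2l // cv_bits_le.
    apply: cole_vishkin_proper; auto.
    by rewrite (c2 r u) //; exact: c3.
Qed.

Definition pointed (k : nat) : {set T} := [set v | omap l (pt v) == Some k].

Definition after_side (s : cfg) := exists sd : T -> bool, [/\ aimed pt s, hued 4 s,
  forall v, cval (s v) = if pt v is Some u then (sd v).+1 else 0 &
  forall k c, 2 * #|[set v in pointed k | sd v == c]| <= #|pointed k| + 1].

Lemma side_triple : triple (fun s => aimed pt s /\ hued 4 s)
  [:: Agg (word b) own_hits side] after_side.
Proof.
have ownE s : aimed pt s -> forall u k, own_hits (s u) k = (u \in pointed k).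
  by move=> [_ ht _] u k; rewrite /own_hits hits_eq ht inE.
apply: triple_op => // [s [h hh]|s s' [h hh] [off [tot [[_ hoff] hex]]]].
  have [h1 ht hk] := h; apply: (calm_ready _ h1); try lia.
    move=> v k; rewrite ownE // lt0b inE; case hp: (pt v) => [u|] //= /eqP[<-].
    exact: hk hp.
  move=> k; apply: (@leq_ltn_trans n).
    rewrite -sum1_card; apply: leq_sum => u _; rewrite ownE //; exact: leq_b1.
  by apply: leq_ltn_trans (sum_props_lt id_inj id_lt (leqnn _) (leqnn _)); lia.
have [h1 ht hk] := h; have [c1 c2 c3] := hh.
have hpb v : pb (s' v) = pb (s v) by rewrite hex.
exists (fun v => if pt v is Some u then odd (off v (l u)) else false); split.
- split.
  + by apply: (calm_update h1) => v; rewrite /trees hex //=; exact: calm_bounds h1.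
  + by move=> v; rewrite hex /= ht.
  + by move=> v u; rewrite /trees hpb; exact: hk.
- by split=> [v|u v|v u]; rewrite !hpb; auto.
- move=> v; rewrite hex /=; have := aimed_target v h.
  by case: (tgt _) => [[k q]|] => [[u -> ->]|->].
- move=> k c.
  have -> : #|pointed k| = \sum_u own_hits (s u) k.
    by under eq_bigr => u _ do rewrite ownE //; rewrite sum_bool; apply: eq_card => u; rewrite [RHS]inE.
  (* The ranks of the vertices pointing to [k] tile a segment, which contains each parity at most
     half the time, rounded up. *)
  apply: leq_trans (sum_parity c _); rewrite -(hoff k (fun i => odd i == c)) leq_mul2l /=.
  rewrite -sum1_card big_mkcond; apply: leq_sum => u _; rewrite ownE // inE.
  case hu: (u \in pointed k) => //=; rewrite big_nat1 addn0.
  by move: hu; rewrite inE; case: (pt u) => //= w /eqP[->]; case: eqP.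
Qed.

Definition classified (s : cfg) : Prop :=
  [/\ calm a.+1 m.+1 J s, class_of_label (view_of s) &
  forall v q, 1 < size (labels e (view_of s) v) ->
    3 * size (labels_if e (view_of s) v (fun u => vc (view_of s) u == q)) <=
    2 * size (labels e (view_of s) v)].

Lemma classify_triple : triple after_side [:: Agg (word b) own_val classify] classified.
Proof.
have [p1 p2 p3] := pt_ok.
apply: triple_op => // [s [sd [h hh hc hbal]]|s s' [sd [h hh hc hbal]] [off [tot [[htot _] hex]]]].
  have [h1 ht hk] := h; apply: (calm_ready _ h1); try lia.
    by move=> v k; apply: own_val_keys h1.
  move=> k; rewrite own_valE //.
  have val0 v : pt v = None -> cval (s v) = 0 by move=> hp; rewrite hc hp.
  case: (rep_dec k) => [[r [u [hp <-]]]|hn]; last by rewrite sum_no_rep ?expn_gt0.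
  rewrite (sum_rep val0 hp) hc hp; apply: (@leq_ltn_trans 2); first by case: (sd r).
  have h0 : 0 < 2 ^ (4 * b) by rewrite expn_gt0.
  by rewrite /word expnD (_ : 2 ^ 6 = 64) //; lia.
have [h1 ht hk] := h; have [c1 c2 c3] := hh.
have val0 v : pt v = None -> cval (s v) = 0 by move=> hp; rewrite hc hp.
have totE v : A v -> tot v (l v) = \sum_w (if A w && (l w == l v) then cval (s w) else 0).
  by move=> hv; rewrite htot ?own_valE //; exact: calm_keys h1 hv _.
have totR r u : pt r = Some u -> tot r (l r) = (sd r).+1.
  by move=> hp; have [hr _ _ _] := p1 _ _ hp; rewrite totE // (sum_rep val0 hp) hc hp.
have clsE v : A v -> cls (pb (s' v)) = col (pb (s v)) + 16 * (tot v (l v)).-1.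
  by move=> hv; rewrite hex /classify (ca_alive h1) hv /= (ca_lab h1).
have tot_le v : A v -> (tot v (l v)).-1 <= 1.
  move=> hv; case: (rep_dec (l v)) => [[r [u [hp E]]]|hn].
    by have := totR r u hp; have [hr _ _ _] := p1 _ _ hp; rewrite !totE // E => ->; case: (sd r).
  by rewrite totE // sum_no_rep.
have hcalm : calm a.+1 m.+1 J s'.
  apply: (calm_update h1) => v; first by rewrite /trees hex /classify; case: ifP.
  have [b1 b2] := calm_bounds v h1; case hv: (A v).
    split; first by rewrite clsE //; have := tot_le v hv; have := c1 v hv; rewrite (_ : 2 ^ 4 = 16) //; lia.
    by rewrite hex /classify; case: ifP.
  by rewrite hex /classify (ca_alive h1) hv.
have hcl : class_of_label (view_of s').
  move=> u v /=; rewrite !(ca_alive hcalm) !(ca_lab hcalm) => hu hv E.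
  by rewrite !clsE // !totE // E (c2 u v).
split=> // v q.
pose pt' v := odflt v (pt v).
apply: (@class_count _ e e_sym (view_of s') (fun r => pt r != None) pt'
  (fun v => col (pb (s v))) sd) => //.
- split=> [u|u w|r r'] /=.
  + rewrite /pt'; case hp: (pt u) => [w|] //= _.
    by rewrite !(ca_alive hcalm) !(ca_lab hcalm); exact: p1.
  + rewrite !(ca_alive hcalm) !(ca_lab hcalm) => hu huw hw hl.
    have hf : foreign_edge u by apply/existsP; exists w; rewrite huw hw.
    by have [r [w' [hr E]]] := p2 u hu hf; exists r; rewrite ?hr //= (ca_lab hcalm).
  + rewrite !(ca_lab hcalm); case hp: (pt r) => [w|] //; case hp': (pt r') => [w'|] // _ _.
    exact: p3 hp hp'.
- by move=> u w /=; rewrite !(ca_alive hcalm) !(ca_lab hcalm); exact: c2.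
- by move=> u /=; rewrite (ca_alive hcalm) => /c1.
- by move=> r; rewrite /pt'; case hp: (pt r) => [w|] //= _; exact: c3.
- move=> r; case hp: (pt r) => [w|] //= _; have [hr _ _ _] := p1 _ _ hp.
  by rewrite clsE // (totR r w).
- move=> k c; have E : pointing (view_of s') (fun r => pt r != None) pt' k = pointed k.
    apply/setP => u; rewrite !inE /pt'; case: (pt u) => //= w.
    by rewrite (ca_lab hcalm).
  by rewrite E; exact: hbal.
Qed.

End Pointers.

Lemma classify_ops_triple : triple (calm a m J) (classify_ops b) classified.
Proof.
refine (triple_cat after_point _ _).
  exact: (triple_cons _ mark_triple (triple_cons _ elect_triple point_triple)).
apply: triple_exists => pt x [hpt ha hc]; move: x ha hc.
have key : triple (fun s => aimed pt s /\ hued pt (cv_bits b 0) s)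
  (repeat_ops (log_star b) [:: Loc (look b); Agg (cv_width b) own_val recolor] ++
   [:: Agg (word b) own_hits side; Agg (word b) own_val classify]) classified.
  refine (triple_cat (fun s => aimed pt s /\ hued pt (cv_bits b (log_star b)) s) _ _).
    apply: (@triple_repeat _ e id b (fun i s => aimed pt s /\ hued pt (cv_bits b i) s)) => i _.
    exact: (triple_cons _ (look_triple (i := i) hpt) (recolor_triple (i := i) hpt)).
  refine (triple_cons _ _ (classify_triple hpt)).
  refine (triple_weaken _ (fun _ h => h) (side_triple (pt := pt))) => s [h1 [c1 c2 c3]].
  split=> //; split=> //.
  move=> v hv; apply: leq_trans (c1 v hv) _; rewrite leq_exp2l //.
  exact: cv_bits_log_star.
move=> x ha hc; apply: key; split=> //; have [h1 _ _] := ha; have [p1 _ _] := hpt.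
(* The initial colors are labels: they have [b] bits and differ between distinct clusters. *)
split=> [v hv|u v hu hv E|v u hp].
- rewrite hc // -(ca_lab h1); exact: (basic_lab_lt (co_basic (ca_colored h1)) v).
- by rewrite !hc.
- by have [hv _ hu hl] := p1 _ _ hp; rewrite !hc // eq_sym.
Qed.

End Fixed.
End Classify.
End Phase.

(** * From phases to colors *)

Lemma lookup_cat (s t : seq entry) k :
  lookup (s ++ t) k = if k \in keys s then lookup s k else lookup t k.
Proof.
rewrite -lookup_keys /lookup filter_cat map_cat.
by case: [seq p.2 | p <- s & p.1 == k].
Qed.

Lemma lookup_map (f : nat -> nat) (s : seq entry) k : injective f ->
  lookup [seq (f q.1, q.2) | q <- s] (f k) = lookup s k.
Proof.
move=> hf; elim: s => //= q s IH.
by rewrite !lookup_cons /= (inj_eq hf) IH.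
Qed.

Lemma lookup_filter (p : pred nat) (s : seq entry) k : p k ->
  lookup [seq q <- s | p q.1] k = lookup s k.
Proof.
move=> hp; elim: s => //= q s IH; rewrite lookup_cons; case: ifP => h.
  by rewrite lookup_cons IH.
by case: eqP => // E; rewrite -E h in hp.
Qed.

Lemma keys_filter (p : pred nat) (s : seq entry) :
  keys [seq q <- s | p q.1] = [seq k <- keys s | p k].
Proof. by rewrite /keys filter_map. Qed.

Lemma keys_map (f : nat -> nat) (s : seq entry) :
  keys [seq (f q.1, q.2) | q <- s] = map f (keys s).
Proof. by rewrite /keys -!map_comp. Qed.

Section Colors.
Variables (T : finType) (e : rel T) (id : T -> nat) (b : nat).
Hypothesis e_sym : symmetric e.
Hypothesis id_inj : injective id.
Hypothesis id_lt : forall v, id v < 2 ^ b.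
Notation n := #|T|.
Notation N := (nbrs e id).
Notation cfg := (cfg T).
Notation basic := (basic e id b).
Notation triple := (triple e id b).
Notation ready_op := (ready_op e id b).
Notation P := (n_sub n).
Notation L := (log_n n).

(** After [j] phases, a component with several clusters has at most [(2 / 3) ^ j * n] of them. *)
Definition converging (j : nat) (x : view T) : Prop := forall v,
  1 < size (labels e x v) -> 3 ^ j * size (labels e x v) <= 2 ^ j * n.

Lemma eq_linked (x y : view T) : va x =1 va y -> vl x =1 vl y ->
  linked e x =2 linked e y.
Proof. by move=> h1 h2 u v; rewrite /linked !h1 !h2. Qed.

Lemma eq_labels (x y : view T) v : va x =1 va y -> vl x =1 vl y ->
  labels e x v = labels e y v.
Proof.
move=> h1 h2; rewrite /labels /labels_if (eq_map h2); congr undup; congr map.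
by apply: eq_enum => u; rewrite !inE h1 (eq_connect (eq_linked h1 h2)).
Qed.

Lemma size_labels_if x v q : size (labels_if e x v q) <= size (labels e x v).
Proof.
apply: uniq_leq_size; first exact: undup_uniq.
move=> k /mem_labels_if[u [h1 h2 _ h3]]; apply/mem_labels_if; by exists u.
Qed.

Lemma size_labels x v : size (labels e x v) <= n.
Proof.
apply: leq_trans (size_undup _) _; rewrite size_map -cardE; exact: max_card.
Qed.

Section OneColor.
Variables (O : T -> option (nat * nat)) (H : T -> seq entry).

Definition phase_inv (j : nat) (s : cfg) : Prop :=
  colored e id b O H (j * (1 + 5 * n_step n)) (1 + 6 * j) (5 * j) s /\
  converging j (view_of s).

Lemma phase_triple j : j < 2 * L ->
  triple (phase_inv j) (phase_ops n b) (phase_inv j.+1).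
Proof.
move=> hj.
have hm : 1 + 6 * j.+1 <= max_ents n by rewrite /max_ents; lia.
have ha : j.+1 * (1 + 5 * n_step n) <= max_depth n by rewrite /max_depth leq_mul2r hj orbT.
pose Q (s : cfg) := exists x0 : view T, [/\ class_of_label x0,
  forall v q, 1 < size (labels e x0 v) ->
    3 * size (labels_if e x0 v (fun u => vc x0 u == q)) <= 2 * size (labels e x0 v),
  converging j x0 &
  separating e id b O H x0 (j * (1 + 5 * n_step n)).+1 (1 + 6 * j).+1 0 (5 * j) s].
refine (triple_cat Q _ _).
  move=> x [hc hp].
  pose s := mc \o x.
  have hcalm : calm e id b O H (fun v => alive (pb (s v))) (fun v => lab (pb (s v)))
    (j * (1 + 5 * n_step n)) (1 + 6 * j) (5 * j) s by split.
  have h1 : 1 + 6 * j < max_ents n by lia.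
  have h2 : j * (1 + 5 * n_step n) < max_depth n by move: ha; rewrite mulSn; lia.
  have [c1 c2 c3] := classify_ops_triple e_sym id_inj id_lt h1 h2 hcalm.
  set s' := mc \o _ in c1 c2 c3 *.
  exists (view_of s'); split=> //.
    move=> v; rewrite (_ : labels e (view_of s') v = labels e (view_of s) v); first exact: hp.
    by apply: eq_labels => u /=; rewrite ?(ca_alive c1) ?(ca_lab c1).
  split; first exact: ca_colored c1.
  split=> // v hv; exists v; split=> //; exact: connect0.
apply: triple_exists => x0 x [hcl hcount hprog hsep].
have hm' : (1 + 6 * j).+1 + 5 <= max_ents n by lia.
have ha' : (j * (1 + 5 * n_step n)).+1 + 5 * n_step n <= max_depth n.
  by move: ha; rewrite mulSn; lia.
have [h1 h2] := separate_triple e_sym id_inj id_lt hcl hm' ha' hsep.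
set s' := mc \o _ in h1 h2 *; split.
  have := h1; congr (colored _ _ _ _ _ _ _ _ _); rewrite ?mulSn; lia.
move=> v hv.
have hsub := labels_refine e_sym hcl h2 (basic_cls (co_basic h1)) (v := v).
have hle := uniq_leq_size (undup_uniq _) hsub.
have hle2 := size_labels_if x0 v (fun u => vc x0 u == vc (view_of s') v).
(* Labels only disappear, so several clusters now mean several clusters at the start of the
   phase. *)
have hN : 1 < size (labels e x0 v).
  by apply: leq_trans hle2; apply: leq_trans hle.
have := hcount v (vc (view_of s') v) hN; have := hprog v hN.
move: hle; rewrite -/(labels e (view_of s') v) -/(labels_if e (view_of s') v predT) -/(labels e (view_of s') v).
set a1 := size (labels e (view_of s') v); set a2 := size (labels_if _ _ _ _).
set a3 := size (labels e x0 v) => q1 q2 q3.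
rewrite !expnS -!mulnA (mulnCA 3).
apply: (@leq_trans (3 ^ j * (2 * a3))); first by rewrite leq_mul2l; apply/orP; right; lia.
by rewrite mulnCA leq_mul2l.
Qed.

Lemma phases_triple :
  triple (phase_inv 0) (repeat_ops (2 * L) (phase_ops n b)) (phase_inv (2 * L)).
Proof. by apply: (@triple_repeat _ e id b phase_inv) => j; apply: phase_triple. Qed.

(** Since [9 / 4 >= 2] and [n < 2 ^ L], the bound after [2 * L] phases is below 1. *)
Lemma converged x : converging (2 * L) x -> forall v, size (labels e x v) <= 1.
Proof.
move=> h v; rewrite leqNgt; apply/negP => hv; have := h v hv.
rewrite leqNgt => /negP; apply; rewrite !expnM.
have hn : n < 2 ^ L := card_lt_log T.
have h1 : (2 ^ 2) ^ L * n < (2 ^ 2) ^ L * 2 ^ L by rewrite ltn_pmul2l // !expn_gt0.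
apply: leq_trans h1 _; rewrite -expnMn.
apply: (@leq_trans ((3 ^ 2) ^ L)); first by rewrite leq_exp2r.
by rewrite leq_pmulr //; lia.
Qed.

Lemma adjacent_same_label x u v : converging (2 * L) x ->
  va x u -> va x v -> e u v -> vl x u = vl x v.
Proof.
move=> /converged h hu hv huv.
have h1 : vl x u \in labels e x u by apply/mem_labels_if; exists u; rewrite connect0.
have h2 : vl x v \in labels e x u.
  by apply/mem_labels_if; exists v; split=> //; apply: connect1; rewrite /linked hu hv huv.
by move: h1 h2 (h u); case: (labels e x u) => [|k [|k' t]] //=; rewrite !inE => /eqP-> /eqP->.
Qed.

(** All phases together have [P] subphases, each killing at most a fraction [1 / (2 * P)]. *)
Lemma half_living s : phase_inv (2 * L) s ->
  #|[set v | O v == None]| <= 2 * #|living (view_of s)|.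
Proof.
case=> h _; have := co_budget h.
rewrite (_ : 5 * (2 * L) = P); last by rewrite /n_sub; lia.
rewrite -[_ <= _ in X in _ -> X](leq_pmul2l (n_sub_gt0 T)).
move: (P) #|[set v | O v == None]| #|living (view_of s)| => p S l; nia.
Qed.

End OneColor.

(** A final label encodes its color as residue modulo [L] and its root as quotient. The uncolored
    vertices have been halved [c] times. *)
Record settled (c : nat) (O : T -> option (nat * nat)) (H : T -> seq entry) : Prop :=
  Settled {
  se_card : #|[set v | O v == None]| * 2 ^ c <= n;
  se_out : forall v q k, O v = Some (q, k) -> [/\ q < c, k %% L = q & k \in keys (H v)];
  se_adj : forall u v q k k', e u v -> O u = Some (q, k) -> O v = Some (q, k') -> k = k';
  se_hist : forall v k, k \in keys (H v) ->
    k %% L < c /\ exists u, O u = Some (k %% L, k);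
  se_uniq : forall v, uniq (keys (H v));
  se_wf : wf_trees e id H (fun k => k %/ L) (max_depth n);
  se_load : forall v q, count (fun k => k %% L == q) (keys (H v)) <= max_ents n }.

Definition between (c : nat) (s : cfg) : Prop :=
  [/\ settled c (fun v => outp (s v)) (fun v => hist (s v)),
      forall v, me (pb (s v)) = id v &
      forall v, fits (word b) (max_ents n) (pb (s v))].

Definition coloring (c j : nat) (s : cfg) : Prop := exists O H,
  settled c O H /\ phase_inv O H j s.

Lemma reset_triple c : triple (between c) [:: Loc reset] (coloring c 0).
Proof.
apply: triple_op => // [s [_ _ hf]|s s' [h1 h2 h3] hex]; first by split.
exists (fun v => outp (s v)), (fun v => hist (s v)); split=> //.
have hE v : s' v = reset (s v) [seq pb (s u) | u <- N v] by [].
have htr v : trees s' v = if outp (s v) == None then [:: (id v, None)] else [::].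
  by rewrite /trees hE /= h2.
split; last first.
  by move=> v _; rewrite !expn0 !mul1n; exact: size_labels.
rewrite mul0n muln0; split.
- split.
  + by move=> v; rewrite hE /= h2.
  + by move=> v; rewrite htr hE /= h2 => ->; rewrite inE.
  + by move=> v; rewrite htr; case: ifP.
  + exists (fun _ _ => 0) => v k; rewrite htr; case: ifP => // _; rewrite inE => /eqP ->.
    by rewrite lookup_cons eqxx.
  + move=> v q; rewrite htr; case: ifP => // _; rewrite inE => /eqP -> /=.
    by rewrite id_lt.
  + by move=> v; rewrite hE /= h2 id_lt.
  + by move=> v; rewrite hE.
  + by move=> v; rewrite hE /= expn_gt0.
- by move=> v; rewrite hE /=; split=> // /eqP.
- by move=> v; rewrite htr; case: ifP.
- rewrite mul0n addn0 leq_mul2l; apply/orP; right; apply: subset_leq_card.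
  by apply/subsetP => v; rewrite !inE /= hE.
Qed.

Lemma finish_triple c : c < L ->
  triple (coloring c (2 * L)) [:: Agg (word b) own_member (finish L c)] (between c.+1).
Proof.
move=> hc.
have sumE s k : \sum_u own_member (s u) k = #|[set u | member (s u) k]| by exact: sum_bool.
have hD : 2 * L * (1 + 5 * n_step n) = max_depth n by [].
have hm : 1 + 6 * (2 * L) = max_ents n by rewrite /max_ents; lia.
apply: triple_op => // [s [O [H [_ [[hb _ hs _] _]]]]|s s' [O [H [hS hI]]] hex].
  rewrite hD hm in hb hs.
  split; first exact: (basic_fits id_inj id_lt hb hs).
  split; [exact: basic_me hb | exact: basic_wf hb | |].
    move=> v k; rewrite /own_member /member; case: andP => // -[hv /eqP <-] _.
    exact: basic_lab hb _ hv.
  move=> k; rewrite sumE; apply: (@leq_ltn_trans n); first exact: max_card.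
  by apply: leq_ltn_trans (sum_props_lt id_inj id_lt (leqnn _) (leqnn _)); lia.
have hhalf := half_living hI.
have [[hb hk hs _] hconv] := hI; rewrite hD hm in hb hs.
case: hex => off [tot [[htot _] hex]].
have [d hd] := basic_wf hb.
pose f k := k * L + c.
have f_mod k : f k %% L = c by rewrite /f modnMDl modn_small.
have f_div k : f k %/ L = k by rewrite /f divnMDl ?divn_small ?addn0 //; lia.
have f_inj : injective f by move=> k k' E; rewrite -(f_div k) E f_div.
(* Trees whose cluster has lost all members are dropped, as each listed tree must belong to a
   cluster. *)
pose big k := 0 < \sum_u own_member (s u) k.
pose O' v := if alive (pb (s v)) then Some (c, f (lab (pb (s v)))) else O v.
pose new v := [seq (f q.1, q.2) | q <- trees s v & big q.1].
pose H' v := H v ++ new v.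
have outE v : outp (s' v) = O' v.
  by rewrite hex /finish /O' /=; case: ifP => // _; case: (hk v).
have histE v : hist (s' v) = H' v.
  rewrite hex /finish /= /H' /new; have [_ -> _] := hk v; congr cat; congr map.
  by apply: eq_in_filter => q hq; rewrite /big htot // /keys map_f.
have pbE v : pb (s' v) = pb (s v) by rewrite hex.
have newK v : keys (new v) = map f [seq k <- keys (trees s v) | big k].
  by rewrite /new keys_map keys_filter.
have new_mod v k : k \in keys (new v) -> k %% L = c.
  by rewrite newK => /mapP[r _ ->]; exact: f_mod.
have old_mod v k : k \in keys (H v) -> k %% L < c by case/(se_hist hS).
have newP v k : f k \in keys (new v) = (k \in keys (trees s v)) && big k.
  by rewrite newK (mem_map f_inj) mem_filter andbC.
have keysE v k : k \in keys (H' v) = (k \in keys (H v)) || (k \in keys (new v)).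
  by rewrite /keys map_cat mem_cat.
have oldO v q k : O v = Some (q, k) -> O' v = O v.
  by rewrite /O'; case: ifP => // hv h; have [_ _ /(_ hv)] := hk v; rewrite h.
have fitsH := basic_fits id_inj id_lt hb hs (leqnn _).
split=> [|v|v]; rewrite ?pbE //; last exact: basic_me hb v.
have alive_new v : alive (pb (s v)) -> f (lab (pb (s v))) \in keys (new v).
  move=> hv; rewrite newP (basic_lab hb hv) /= /big (bigD1 v) //=.
  by rewrite /own_member /member hv eqxx.
split.
- have h2 : 2 * #|[set v | outp (s' v) == None]| <= #|[set v | O v == None]|.
    have E : [set v | O v == None] = [set v | outp (s' v) == None] :|: living (view_of s).
      apply/setP => v; rewrite !inE outE /O' /=.
      by case hv: (alive _); have [_ _ h] := hk v; rewrite ?orbF //= h.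
    have E0 : [set v | outp (s' v) == None] :&: living (view_of s) = set0.
      by apply/setP => v; rewrite !inE outE /O' /=; case: (alive _); rewrite ?andbF.
    have := cardsUI [set v | outp (s' v) == None] (living (view_of s)).
    by rewrite E0 cards0 addn0 -E; move: hhalf; lia.
  rewrite expnS; apply: leq_trans (se_card hS); rewrite mulnA leq_mul2r.
  by rewrite mulnC h2 orbT.
- move=> v q k; rewrite outE histE /O' keysE; case: ifP => [hv [<- <-]|_ /(se_out hS)[h1 -> ->]].
    by rewrite f_mod alive_new ?orbT.
  by split=> //; apply: leqW.
- move=> u v q k k' huv; rewrite !outE /O'.
  case: ifP => hu; case: ifP => hv.
  + move=> [_ <-] [_ <-]; congr f.
    exact: (adjacent_same_label (x := view_of s) hconv).
  + by move=> [<- _] /(se_out hS)[]; rewrite ltnn.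
  + by move=> /(se_out hS)[h _ _] [E _]; move: h; rewrite E ltnn.
  + exact: (se_adj hS huv).
- move=> v k; rewrite histE keysE => /orP[hin|hin].
    have [h1 [u h2]] := se_hist hS hin; split; first exact: leqW.
    by exists u; rewrite outE (oldO _ _ _ h2).
  rewrite (new_mod _ _ hin); split=> //.
  move: hin; rewrite newK => /mapP[r]; rewrite mem_filter => /andP[hr _] ->.
  move: hr; rewrite /big sumE card_gt0 => /set0Pn[u]; rewrite inE => /andP[hu /eqP <-].
  by exists u; rewrite outE /O' hu.
- move=> v; rewrite histE /H' /keys map_cat cat_uniq (se_uniq hS).
  rewrite -/(keys (new v)) newK map_inj_uniq // filter_uniq ?(basic_uniq hb) // andbT.
  apply/hasPn => k hkn; apply/negP => hko.
  have := old_mod _ _ hko; rewrite (new_mod v) ?ltnn //.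
  by rewrite newK.
- have [dold hold] := se_wf hS.
  (* The residue of a label tells whether its tree is new, which lets the two depth functions be
     glued. *)
  exists (fun k v => if k %% L == c then d (k %/ L) v else dold k v) => v k.
  rewrite histE /H' lookup_cat keysE.
  case: (boolP (k \in keys (H v))) => /= [hin _|hout hin].
    have hlt := old_mod _ _ hin; rewrite ltn_eqF //.
    have [h1 h2] := hold v k hin; split=> //.
    case: (lookup _ _) h2 => [[i|]|] // [u [u1 u2 u3 u4]]; exists u.
    by rewrite histE keysE u3.
  have E := new_mod _ _ hin; rewrite E eqxx.
  move: hin; rewrite newK => /mapP[r]; rewrite mem_filter => /andP[hr hrk] Ek.
  rewrite /new Ek f_div (lookup_map _ _ f_inj) lookup_filter //.
  have [h1 h2] := hd v r hrk; split=> //.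
  case: (lookup _ _) h2 => [[i|]|] // [u [u1 u2 u3 u4]]; exists u.
  by rewrite histE keysE newP u3 hr orbT.
- move=> v q; rewrite histE /H' /keys map_cat count_cat.
  have [E|hne] := eqVneq q c.
    rewrite (_ : count _ (map fst (H v)) = 0); last first.
      apply/eqP; rewrite -leqn0 leqNgt -has_count; apply/hasPn => k /old_mod; rewrite E.
      by move=> h; rewrite ltn_eqF.
    apply: leq_trans (count_size _ _) _; rewrite -/(keys (new v)) newK size_map size_filter.
    by apply: leq_trans (count_size _ _) _; rewrite size_map; exact: hs.
  rewrite (_ : count _ (map fst (new v)) = 0) ?addn0; first exact: (se_load hS).
  apply/eqP; rewrite -leqn0 leqNgt -has_count; apply/hasPn => k /new_mod ->.
  by rewrite eq_sym.
Qed.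

Lemma between0 : between 0 (fun v => init_core (id v)).
Proof.
split=> [|v|v] //.
- split=> //; first by rewrite muln1; exact: max_card.
  by exists (fun _ _ => 0).
- apply/andP; split=> //=; rewrite expn_gt0 /= andbT.
  have h : id v < 2 ^ word b by apply: (@lt_word b _ 1) => //; rewrite mul1n ltnW.
  by rewrite h.
Qed.

Lemma color_triple c : c < L -> triple (between c) (color_ops n b c) (between c.+1).
Proof.
move=> hc; refine (triple_cons _ (reset_triple (c := c)) _).
refine (triple_cat (coloring c (2 * L)) _ (finish_triple hc)).
move=> x [O [H [hS hI]]]; exists O, H; split=> //.
exact: phases_triple hI.
Qed.

Lemma all_triple c m : c + m <= L ->
  triple (between c) (all_ops n b c m) (between (c + m)).
Proof.
elim: m c => [|m IH] c hm; first by rewrite addn0; exact: triple_nil.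
have hc : c < L by lia.
have hm' : c.+1 + m <= L by lia.
rewrite -(addSnnS c m); exact: (triple_cat _ (color_triple hc) (IH _ hm')).
Qed.

Lemma program_settled :
  let s := mc \o run e id (program n b) (fun v => init_state (id v)) in
  settled L (fun v => outp (s v)) (fun v => hist (s v)).
Proof.
have hL : 0 + L <= L by [].
have := all_triple hL; rewrite add0n => /(_ (fun v => init_state (id v))) h.
by case: (h between0).
Qed.

(** After [L] halvings less than one vertex is uncolored, as [n < 2 ^ L]. *)
Lemma settled_all O H : settled L O H -> forall v, exists q k, O v = Some (q, k).
Proof.
move=> hS v; case hO: (O v) => [[q k]|]; first by exists q, k.
have := se_card hS; rewrite leqNgt => /negP[]; apply: leq_trans (card_lt_log T) _.
rewrite leq_pmull // card_gt0; apply/set0Pn; exists v.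
by rewrite inE hO.
Qed.

End Colors.

(** * Round complexity *)

Section Rounds.
Variables (n b : nat).
Notation L := (log_n n).
Notation E := (max_ents n).
Notation D := (max_depth n).
Notation w := (word b).
Notation ls := (log_star b).

Definition cost (p : seq op) : nat := \sum_(i <- ops_instrs n b p) slots w i.

Lemma cost_cat p q : cost (p ++ q) = cost p + cost q.
Proof. by rewrite /cost /ops_instrs map_cat flatten_cat big_cat. Qed.

Lemma cost_cons o p : cost (o :: p) = cost [:: o] + cost p.
Proof. exact: (cost_cat [:: o] p). Qed.

Lemma cost_nil : cost [::] = 0.
Proof. by rewrite /cost big_nil. Qed.

Lemma cost_repeat m p : cost (repeat_ops m p) = m * cost p.
Proof. by elim: m => [|m IH]; rewrite ?cost_nil // cost_cat IH mulSn. Qed.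

Lemma word_gt0 : 0 < w. Proof. by rewrite /word addn_gt0 orbT. Qed.

Lemma cost_exchange f : slots w (exchange w E f) = 7 + 2 * E.
Proof. by rewrite /slots /= mulnK ?word_gt0 //; lia. Qed.

Lemma cost_loc f : cost [:: Loc f] = 7 + 2 * E.
Proof. by rewrite /cost /= big_seq1 cost_exchange. Qed.

Lemma cost_agg om own f : cost [:: Agg om own f] =
  7 + 2 * E + (2 * D + 3) * (3 * E * om %/ w + 1) + 1.
Proof.
rewrite /cost.
have -> : ops_instrs n b [:: Agg om own f] =
    exchange w E (fun c _ => c) :: nseq (2 * D + 3) (agg_round om E own) ++ [:: local f].
  by rewrite /ops_instrs /= cats0.
rewrite big_cons big_cat big_seq1 cost_exchange.
have -> : slots w (local f) = 1 by rewrite /slots mul0n div0n.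
rewrite addnA; congr (_ + _ + _); move: (2 * D + 3) => m.
by elim: m => [|m IH]; rewrite ?big_nil //= big_cons IH mulSn.
Qed.

Lemma log_gt0 : 0 < L. Proof. by []. Qed.

Lemma max_ents_le : E <= 13 * L.
Proof. have := log_gt0; rewrite /max_ents; lia. Qed.

Lemma max_depth_le : D <= 202 * L ^ 3.
Proof.
have h : L <= L ^ 3 by rewrite -{1}(expn1 L) leq_pexp2l.
rewrite /max_depth /n_step /n_sub.
have -> : 2 * L * (1 + 5 * (2 * (10 * L) * L)) = 2 * L + 200 * (L * L * L).
  by move: (L) => x; nia.
by move: h; rewrite (_ : L ^ 3 = L * L * L); [lia | rewrite !expnS expn0 muln1 mulnA].
Qed.

Definition full_agg : nat := 7 + 2 * E + (2 * D + 3) * (3 * E + 1) + 1.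

Lemma cost_full_agg own f : cost [:: Agg w own f] = full_agg.
Proof. by rewrite cost_agg mulnK ?word_gt0. Qed.

Lemma full_agg_le : full_agg <= 170 * 100 * L ^ 4.
Proof.
have h1 : 1 <= L ^ 3 by rewrite expn_gt0.
have h3 : L <= L ^ 4 by rewrite -{1}(expn1 L) leq_pexp2l.
have h4 : (2 * D + 3) * (3 * E + 1) <= (407 * L ^ 3) * (40 * L).
  apply: leq_mul; first by have := max_depth_le; lia.
  by have := max_ents_le; have := log_gt0; lia.
have h5 : (407 * L ^ 3) * (40 * L) = 407 * 40 * L ^ 4.
  by rewrite mulnACA -expnSr.
rewrite /full_agg; move: h4; rewrite h5; have := max_ents_le; have := log_gt0; lia.
Qed.

Lemma trunc_log_lt m : 0 < m -> trunc_log 2 m < m.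
Proof.
move=> h; apply: leq_trans (trunc_logP (isT : 1 < 2) h); exact: ltn_expl.
Qed.

Lemma log_star_le : ls <= (trunc_log 2 b).+1.
Proof.
suff H f x : log_star_aux f x <= (trunc_log 2 x).+1 by exact: H.
elim: f x => //= f IH x; case: (leqP x 1) => // hx; rewrite ltnS.
apply: leq_trans (IH _) _; apply: trunc_log_lt.
by rewrite trunc_log_gt0.
Qed.

(** All [ls] light messages together have [O(E * ls * log b)] bits, and [ls * log b] is [O(b)], the
    size of one word. Hence [log_star b] enters additively, without a factor [L]. *)
Lemma light_slots_le : ls * (3 * E * cv_width b %/ w + 1) <= 78 * L + ls.
Proof.
rewrite mulnDr muln1 leq_add2r.
have h : ls * cv_width b <= 2 * w.
  have [->|hb] := posnP b; first by [].
  apply: (@leq_trans (8 * b)); last by rewrite /word; lia.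
  apply: (@leq_trans (8 * 2 ^ trunc_log 2 b)); last by rewrite leq_mul2l trunc_logP.
  apply: (@leq_trans ((trunc_log 2 b).+1 * cv_width b)).
    by rewrite leq_mul2r log_star_le orbT.
  rewrite /cv_width; move: (trunc_log 2 b) => t.
  (* With [t] the logarithm of [b], this is [(t + 1) * (t + 5) <= 8 * 2 ^ t]. *)
  elim: t => // t IH; have h2 : t < 2 ^ t by exact: ltn_expl.
  rewrite expnS; case: t IH h2 => [|[|t]] // IH h2.
  have h3 : t + 3 <= 2 ^ t.+2 by have := ltn_expl t (isT : 1 < 2); rewrite !expnS; lia.
  by move: IH h3; move: (2 ^ t.+2) => q; lia.
have h2 : ls * (3 * E * cv_width b %/ w) <= (3 * E * (ls * cv_width b)) %/ w.
  rewrite leq_divRL ?word_gt0 // -mulnA (mulnCA (3 * E)) leq_mul2l.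
  by rewrite leq_trunc_div orbT.
apply: leq_trans h2 _.
apply: (@leq_trans ((3 * E * (2 * w)) %/ w)); first by rewrite leq_div2r // leq_mul2l h orbT.
rewrite mulnA mulnK ?word_gt0 //; have := max_ents_le; lia.
Qed.

Lemma cost_classify_le : cost (classify_ops b) <=
  200 * 500 * L ^ 4 + 500 * (L ^ 3 * ls).
Proof.
have hX : 7 + 2 * E <= 33 * L by have := max_ents_le; have := log_gt0; lia.
have hlight : ls * cost [:: Loc (look b); Agg (cv_width b) own_val recolor] <=
    67 * (L * ls) + 407 * 78 * L ^ 4 + 407 * (L ^ 3 * ls).
  rewrite cost_cons cost_loc cost_agg.
  set X := 7 + 2 * E in hX *; set Y := 2 * D + 3; set Z := _ %/ w + 1.
  have hY : Y <= 407 * L ^ 3.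
    have h0 : 1 <= L ^ 3 by rewrite expn_gt0.
    by have := max_depth_le; rewrite /Y; lia.
  have -> : ls * (X + (X + Y * Z + 1)) = ls * (2 * X + 1) + Y * (ls * Z) by nia.
  have h1 : ls * (2 * X + 1) <= 67 * (L * ls).
    rewrite (mulnC L) mulnCA leq_mul2l; apply/orP; right; have := log_gt0; lia.
  have h2 : Y * (ls * Z) <= 407 * L ^ 3 * (78 * L + ls).
    exact: leq_mul hY light_slots_le.
  have h3 : 407 * L ^ 3 * (78 * L + ls) = 407 * 78 * L ^ 4 + 407 * (L ^ 3 * ls).
    by rewrite mulnDr mulnACA -expnSr mulnA.
  lia.
have hL4 : L <= L ^ 4 by rewrite -{1}(expn1 L) leq_pexp2l.
have hLs : L * ls <= L ^ 3 * ls.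
  by rewrite leq_mul2r -{1}(expn1 L) leq_pexp2l ?orbT.
move: hlight; rewrite /classify_ops; set loop := [:: Loc _; _] => hlight.
rewrite !cost_cat cost_repeat; move: (cost loop) hlight => c hlight.
rewrite (cost_cons (Loc mark)) (cost_cons _ [:: Loc point]).
rewrite (cost_cons _ [:: Agg _ _ classify]) !cost_full_agg !cost_loc.
have := full_agg_le; lia.
Qed.

Lemma cost_separate_le k i : cost (separate_ops n b i k) <= k * (200 * 200 * 10 * L ^ 6).
Proof.
elim: k i => [|k IH] i; first by rewrite cost_nil.
rewrite separate_opsS cost_cat mulSn leq_add ?IH // cost_repeat.
rewrite /rg_step cost_cons cost_loc cost_full_agg.
have h : 7 + 2 * E + full_agg <= 200 * 100 * L ^ 4.
  have h0 : L <= L ^ 4 by rewrite -{1}(expn1 L) leq_pexp2l.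
  have := full_agg_le; have := max_ents_le; have := log_gt0; lia.
apply: (@leq_trans (n_step n * (200 * 100 * L ^ 4))); first by rewrite leq_mul2l h orbT.
rewrite /n_step /n_sub.
have -> : L ^ 6 = L * L * L ^ 4 by rewrite -[6]/(2 + 4) expnD -mulnn.
move: (L ^ 4) (L) => x y; nia.
Qed.

Lemma cost_program_le : cost (all_ops n b 0 L) <=
  500 * 500 * 100 * (L ^ 8 + ls * L ^ 5).
Proof.
pose K := 200 * 500 * L ^ 4 + 500 * (L ^ 3 * ls) + 5 * (200 * 200 * 10 * L ^ 6).
have hphase : cost (phase_ops n b) <= K.
  by rewrite /phase_ops cost_cat leq_add ?cost_classify_le ?cost_separate_le.
have hcolor c : cost (color_ops n b c) <= 2 * L * K + 200 * 200 * L ^ 4.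
  rewrite /color_ops cost_cons cost_cat cost_repeat cost_loc cost_full_agg.
  have h1 : 2 * L * cost (phase_ops n b) <= 2 * L * K by rewrite leq_mul2l hphase orbT.
  have h0 : L <= L ^ 4 by rewrite -{1}(expn1 L) leq_pexp2l.
  have := full_agg_le; have := max_ents_le; have := log_gt0; lia.
have hall m c : cost (all_ops n b c m) <= m * (2 * L * K + 200 * 200 * L ^ 4).
  elim: m c => [|m IH] c; first by rewrite cost_nil.
  by rewrite -[all_ops _ _ c m.+1]/(color_ops n b c ++ all_ops n b c.+1 m) cost_cat mulSn leq_add.
apply: leq_trans (hall L 0) _; rewrite /K.
have p5 : L ^ 5 = L * L * L ^ 3 by rewrite -[5]/(2 + 3) expnD -mulnn.
have p6 : L * L * L ^ 4 = L ^ 6 by rewrite -[6]/(2 + 4) expnD -mulnn.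
have p8 : L * L * L ^ 6 = L ^ 8 by rewrite -[8]/(2 + 6) expnD -mulnn.
have le5 : L * L ^ 4 <= L ^ 8 by rewrite -expnS leq_pexp2l.
have le6 : L ^ 6 <= L ^ 8 by rewrite leq_pexp2l.
have e1 : L * (2 * L * (200 * 500 * L ^ 4 + 500 * (L ^ 3 * ls) +
    5 * (200 * 200 * 10 * L ^ 6)) + 200 * 200 * L ^ 4) =
  2 * 200 * 500 * (L * L * L ^ 4) + 2 * 500 * (ls * (L * L * L ^ 3)) +
  2 * 5 * 200 * 200 * 10 * (L * L * L ^ 6) + 200 * 200 * (L * L ^ 4).
  by move: (L ^ 3) (L ^ 4) (L ^ 6) (L) => x y z t; nia.
rewrite e1 -p5 p6 p8; lia.
Qed.

End Rounds.

(** * The decomposition *)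

Section Final.
Variables (T : finType) (e : rel T) (id : T -> nat).
Hypothesis e_sym : symmetric e.
Hypothesis id_inj : injective id.
Notation n := #|T|.
Notation L := (log_n n).
Variables (O : T -> option (nat * nat)) (H : T -> seq entry).
Hypothesis hS : settled e id L O H.
Variable o : T -> node_output.
Hypothesis o_def : forall v, o v =
  NodeOutput (odflt (0, 0) (O v)).1 (odflt (0, 0) (O v)).2 (H v).

Lemma in_treeE k v : in_tree o k v = (k \in keys (H v)).
Proof. by rewrite /in_tree o_def. Qed.

Lemma tparentE k v : tparent o k v = lookup (H v) k.
Proof. by rewrite /tparent o_def. Qed.

Lemma out_some v : exists q k, [/\ O v = Some (q, k), out_color (o v) = q &
  out_cluster (o v) = k].
Proof. by have [q [k E]] := settled_all hS v; exists q, k; rewrite o_def E. Qed.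

Lemma color_of_cluster v : out_color (o v) = out_cluster (o v) %% L.
Proof. by have [q [k [h1 -> ->]]] := out_some v; have [_ -> _] := se_out hS h1. Qed.

Lemma cluster_in_tree v : out_cluster (o v) \in keys (H v).
Proof. by have [q [k [h1 _ ->]]] := out_some v; have [_ _ ->] := se_out hS h1. Qed.

(** Following parents decreases the potential [d], which bounds the length of the path. *)
Lemma path_to_root k v : k \in keys (H v) -> exists p r,
  [/\ path (tedge e id o k) v p, last v p = r, size p <= max_depth n,
      id r = k %/ L & k \in keys (H r) /\ lookup (H r) k = Some None].
Proof.
have [d hd] := se_wf hS => hv.
suff [p [r [h1 h2 h3 h4 h5]]] : exists p r, [/\ path (tedge e id o k) v p,
    last v p = r, size p <= d k v, id r = k %/ L &
    k \in keys (H r) /\ lookup (H r) k = Some None].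
  by exists p, r; split=> //; apply: leq_trans h3 _; have [] := hd v k hv.
elim: {v}(d k v).+1 {-2}v (ltnSn (d k v)) hv => // m IH v hm hv.
have [_] := hd v k hv; case hl: (lookup (H v) k) => [[i|]|].
- case=> u [u1 u2 u3 u4]; have hm' : d k u < m by lia.
  have [p [r [h1 h2 h3 h4 h5]]] := IH u hm' u3.
  exists (u :: p), r; split=> //=; last by lia.
  by rewrite h1 andbT /tedge !in_treeE hv u3 u2 tparentE hl u1 eqxx.
- by move=> hr; exists [::], v.
- by move: hv; rewrite -lookup_keys hl.
Qed.

Lemma tedge_path k v p : path (tedge e id o k) v p -> path e v p.
Proof. by apply: sub_path => x y /and4P[]. Qed.

Lemma settled_decomposition : network_decomposition e o L (2 * max_depth n).
Proof.
split.
- by move=> v; rewrite color_of_cluster ltn_pmod.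
- by move=> u v E; rewrite !color_of_cluster E.
- move=> u v huv hne E; apply: hne.
  have [q [k [h1 E1 ->]]] := out_some u; have [q' [k' [h1' E1' ->]]] := out_some v.
  by apply: (se_adj hS huv h1 (q := q)); rewrite h1' -E1' -E E1.
- move=> u v E; have := cluster_in_tree u; rewrite E => hu.
  have [p [r [h1 h2 h3 h4 _]]] := path_to_root hu.
  have [p' [r' [h1' h2' h3' h4' _]]] := path_to_root (cluster_in_tree v).
  have Er : r' = r by apply: id_inj; rewrite h4 h4'.
  (* Up to the common root from [u], then down to [v] along the reversed path; hence twice the
     depth. *)
  exists (p ++ rev (belast v p')); split.
  + rewrite cat_path (tedge_path h1) h2 -Er -h2' rev_path /=.
    rewrite (eq_path (e' := e)) ?(tedge_path h1') // => x y; exact: e_sym.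
  + rewrite last_cat h2 -Er -h2'; case: p' {h1' h2' h3'} => //= x p'.
    by rewrite rev_cons last_rcons.
  + by rewrite size_cat size_rev size_belast; lia.
Qed.

Lemma settled_steiner : steiner_trees e id o (max_depth n) (max_ents n).
Proof.
split.
- by move=> v; rewrite in_treeE cluster_in_tree.
- move=> k v; rewrite in_treeE => /(se_hist hS)[_ [u E]].
  by exists u; rewrite o_def E.
- move=> k [u E]; have hu := cluster_in_tree u; rewrite E in hu.
  have [p [r [_ _ _ hr [h5 h6]]]] := path_to_root hu.
  exists r; rewrite in_treeE h5 tparentE h6; split=> //.
    move=> r'; rewrite in_treeE tparentE => h7 h8; apply: id_inj; rewrite hr.
    by have [d hd] := se_wf hS; have := hd r' k h7; rewrite h8 => -[].
  move=> w; rewrite in_treeE => /path_to_root[p' [r' [h7 h8 h9 h10 _]]].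
  by exists p'; split=> //; rewrite h8; apply: id_inj; rewrite h10.
- move=> v c; rewrite undup_id; last by rewrite o_def; exact: se_uniq hS v.
  rewrite o_def; apply: leq_trans (se_load hS v c); apply: sub_count => k.
  by case/existsP=> u /andP[/eqP <- /eqP <-] /=; rewrite -color_of_cluster.
Qed.

End Final.

Lemma steiner_trees_weaken (T : finType) (e : rel T) (id : T -> nat)
  (o : T -> node_output) r r' l l' : r <= r' -> l <= l' ->
  steiner_trees e id o r l -> steiner_trees e id o r' l'.
Proof.
move=> hr hl [h1 h2 h3 h4]; split=> //; last by move=> v c; apply: leq_trans hl.
move=> k /h3[x [x1 x2 x3 x4]]; exists x; split=> // w /x4[p [p1 p2 p3]].
by exists p; split=> //; apply: leq_trans hr.
Qed.

Lemma network_decomposition_weaken (T : finType) (e : rel T)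
  (o : T -> node_output) c c' D D' : c <= c' -> D <= D' ->
  network_decomposition e o c D -> network_decomposition e o c' D'.
Proof.
move=> hc hD [h1 h2 h3 h4]; split=> //; first by move=> v; apply: leq_trans hc.
move=> u v /h4[p [p1 p2 p3]]; exists p; split=> //; exact: leq_trans hD.
Qed.

(** The existential keeps a large numeral out of later arithmetic; 404 is twice the constant of
    [max_depth_le], as needed for the diameter. *)
Lemma cost_program_bound : exists C, 404 <= C /\
  forall n b, cost n b (all_ops n b 0 (log_n n)) <=
    C * (log_n n ^ 8 + log_star b * log_n n ^ 5).
Proof.
exists (500 * 500 * 100); split; first by lia.
exact: cost_program_le.
Qed.

Theorem theorem3p4 :
  exists (A : congest_alg) (C : nat),
  forall (T : finType) (e : rel T) (id : T -> nat) (b : nat),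
    symmetric e -> irreflexive e ->
    injective id -> (forall v, id v < 2 ^ b) ->
    let n := #|T| in
    let L := (trunc_log 2 n).+1 in
    let o := final_output A e id b in
    [/\ alg_rounds A n b <= C * (L ^ 8 + log_star b * L ^ 5),
        (forall t u v, t < alg_rounds A n b -> e u v ->
           size (@alg_send A (state_at A e id b t u) (id v)) <= C * b),
        network_decomposition e o (C * L) (C * L ^ 3) &
        steiner_trees e id o (C * L ^ 3) (C * L)].
Proof.
have [C [hC hcost]] := cost_program_bound.
exists decomposition_alg, C => T e id b e_sym e_irr id_inj id_lt n L o.
have hS := program_settled e_sym id_inj id_lt.
have ho v : o v = output (run e id (program n b) (fun u => init_state (id u)) v).
  exact: (compile_final program init_state output e id (word_gt0 b) v).
have h13 : max_ents n <= 13 * L := max_ents_le n.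
have h202 : max_depth n <= 202 * L ^ 3 := max_depth_le n.
split.
- exact: hcost.
- move=> t u v _ huv.
  apply: leq_trans (compile_send_size program init_state output word e id b t u (id v)) _.
  (* An edge joins two vertices with distinct identifiers, so [b] is positive and [word b] is
     [O(b)]. *)
  have hb : 0 < b.
    rewrite lt0n; apply/eqP => b0; have := id_lt u; have := id_lt v.
    rewrite b0 expn0 !ltnS !leqn0 => /eqP E /eqP E'.
    by rewrite (id_inj u v) ?e_irr // E' in huv.
  apply: (@leq_trans (404 * b)); first by rewrite /word; lia.
  by rewrite leq_mul2r hC orbT.
- apply: network_decomposition_weaken (settled_decomposition e_sym id_inj hS ho).
    by apply: leq_pmull; apply: leq_trans hC.
  apply: (@leq_trans (404 * L ^ 3)).
    by apply: leq_trans (leq_mul (leqnn 2) h202) _; rewrite mulnA.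
  by rewrite leq_mul2r hC orbT.
- apply: steiner_trees_weaken (settled_steiner id_inj hS ho).
    by apply: leq_trans h202 _; rewrite leq_mul2r (leq_trans _ hC) ?orbT.
  by apply: leq_trans h13 _; rewrite leq_mul2r (leq_trans _ hC) ?orbT.
Qed.
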